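(* Given as input a number field $K$ and a positive integer $B$, the bounded-height algorithm described in the context outputs the set $\mathscr{S}$ of all elements $x\in K$ such that $H_K(x)\le B$.
   Context: Let $K$ be a number field with ring of integers $\mathcal{O}_K$ and set of places $M_K$. For an archimedean place $v$ coming from an embedding $\sigma:K\to\mathbf{C}$, $|x|_v=|\sigma(x)|$ is the usual absolute value; for a prime $\mathfrak p$ of $\mathcal O_K$ with ramification index $e_{\mathfrak p}$ and inertia degree $f_{\mathfrak p}$, $|x|_{\mathfrak p}=\mathrm{N}_{K/\mathbf{Q}}(\mathfrak p)^{-v_{\mathfrak p}(x)/(e_{\mathfrak p}f_{\mathfrak p})}$, which extends the $p$-adic absolute value on $\mathbf{Q}$. Let $n_v=[K_v:\mathbf{Q}_v]$. The height is $H_K(x)=\prod_{v\in M_K}\max\{|x|_v^{n_v},1\}$. Algorithm (input $K$, $B$): (1) Compute the list $\mathscr{L}$ of all nonzero integral ideals $\mathfrak c$ with $\mathrm{N}_{K/\mathbf{Q}}(\mathfrak c)\le B$. (2) Start with $\mathscr{G}=\emptyset$. For each $\mathfrak a,\mathfrak b\in\mathscr{L}$ such that $\mathfrak a\mathfrak b^{-1}$ is principal and $\gcd(\mathfrak a,\mathfrak b)=1$, find a generator $\xi$ of $\mathfrak a\mathfrak b^{-1}$ and append it to $\mathscr{G}$. (3) Let $B_0:=\max\{H_K(\xi):\xi\in\mathscr{G}\}$, and compute the set $\mathscr{U}$ of units $u\in\mathcal{O}_K^\times$ such that $H_K(u)\le B\cdot B_0$. (4) Start with $\mathscr{S}=\{0\}$.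 For each $\xi\in\mathscr{G}$ and each $u\in\mathscr{U}$ such that $H_K(u\xi)\le B$, append $u\xi$ to $\mathscr{S}$. (5) Return $\mathscr{S}$. *)

(* Defs.v *)
From HB Require Import structures.
From mathcomp Require Import finmap.
From mathcomp Require Import all_boot all_order all_algebra all_field.
From mathcomp Require Import all_classical all_reals all_analysis.
From mathcomp Require Import complex.

Set Implicit Arguments.
Unset Strict Implicit.
Unset Printing Implicit Defensive.

Import Order.TTheory GRing.Theory Num.Theory.
Import numFieldNormedType.Exports.

Local Open Scope classical_set_scope.
Local Open Scope ring_scope.

(* Number fields are finite extensions K : fieldExtType rat. Integral and
   fractional ideals of the ring of integers are represented by their underlying
   sets of elements of K. *)

(** * Dimension of quotients *)

(* For subsets A0, A, I of a commutative ring, where A is a subring, A0 a subring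
   of A and I an ideal of A such that A0 / (A0 `&` I) is a field, this says that
   the vector space A / I over A0 / (A0 `&` I) has a basis with n elements, the
   classes of the b i. *)
Definition quotient_has_dim (T : comPzRingType) (A0 A I : set T) (n : nat) :
    Prop :=
  exists b : 'I_n -> T,
    [/\ forall i, A (b i),
        forall x, A x -> exists c : 'I_n -> T,
          (forall i, A0 (c i)) /\ I (x - \sum_i c i * b i)
      & forall c : 'I_n -> T, (forall i, A0 (c i)) ->
          I (\sum_i c i * b i) -> forall i, I (c i)].

Definition quotient_dim (T : comPzRingType) (A0 A I : set T) : nat :=
  xget 0%N [set n | quotient_has_dim A0 A I n].

(** * Ideals *)

Section Ideals.
Variable K : fieldExtType rat.
Implicit Types (a b c d P : set K) (x y z : K).

Definition ring_of_integers : set K :=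
  [set x | integralOver (intr : int -> K) x].
Local Notation OK := ring_of_integers.

Definition integer_unit x : Prop := [/\ x != 0, OK x & OK x^-1].

Definition is_ideal a : Prop :=
  [/\ a `<=` OK, a 0, forall x y, a x -> a y -> a (x + y)
    & forall r x, OK r -> a x -> a (r * x)].

Definition nonzero_ideal a : Prop := is_ideal a /\ exists2 x, a x & x != 0.

Definition ideal_mul a b : set K :=
  [set z | exists n (x y : 'I_n -> K),
     [/\ forall i, a (x i), forall i, b (y i) & z = \sum_i x i * y i]].

Definition ideal_inv b : set K := [set x | forall y, b y -> OK (x * y)].

Definition principal_ideal x : set K := [set x * r | r in OK].

Definition ideal_dvd c a : Prop := exists2 d, is_ideal d & a = ideal_mul c d.

Definition ideal_is_gcd a b d : Prop :=
  [/\ is_ideal d, ideal_dvd d a, ideal_dvd d b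
    & forall c, is_ideal c -> ideal_dvd c a -> ideal_dvd c b -> ideal_dvd c d].

Definition ideal_coset a x : set K := [set x + y | y in a].

(* The absolute norm #(O_K / a); fset_set X is empty when X is infinite, but
   O_K / a is finite for every nonzero ideal a. *)
Definition ideal_norm a : nat := #|` fset_set [set ideal_coset a x | x in OK]|.

Definition prime_ideal P : Prop :=
  [/\ nonzero_ideal P, ~ P 1
    & forall x y, OK x -> OK y -> P (x * y) -> P x \/ P y].

Definition ideal_expn P (n : nat) : set K := iter n (ideal_mul P) OK.

Definition ideal_expz P (n : int) : set K :=
  match n with
  | Posz m => ideal_expn P m
  | Negz m => ideal_inv (ideal_expn P m.+1)
  end.

(* n is the exponent of P in the prime factorization of the fractional ideal
   x O_K: the part of the factorization away from P is of the form a b^-1. *)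
Definition has_valuation P x (n : int) : Prop :=
  exists a b, [/\ nonzero_ideal a, nonzero_ideal b, ~ ideal_dvd P a,
    ~ ideal_dvd P b
    & principal_ideal x =
      ideal_mul (ideal_expz P n) (ideal_mul a (ideal_inv b))].

Definition valuation P x : int := xget 0 [set n | has_valuation P x n].

Definition residue_char P : nat := xget 0%N [set p | prime p /\ P p%:R].

Definition ramification_index P : int := valuation P (residue_char P)%:R.

(* The base field Z / (Z `&` P) is the prime field of O_K / P. *)
Definition inertia_degree P : nat :=
  quotient_dim (range (intr : int -> K)) OK P.

End Ideals.

(** * Places and heights *)

Section Heights.
Variables (R : realType) (K : fieldExtType rat).

Definition padic_abs (P : set K) (x : K) : R :=
  if x == 0 then 0 else
  (ideal_norm P)%:R `^
    (- (valuation P x)%:~R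
     / ((ramification_index P)%:~R * (inertia_degree P)%:R)).

(* Normc.normc is the R-valued modulus on R[i]. *)
Definition arch_abs (sigma : {rmorphism K -> R[i]}) (x : K) : R :=
  Normc.normc (sigma x).

(* A place is represented by its absolute value extending one of the standard
   absolute values of Q; in particular, complex conjugate embeddings give the
   same place. *)
Definition places : set (K -> R) :=
  [set v | (exists sigma, v = arch_abs sigma) \/
           (exists2 P, prime_ideal P & v = padic_abs P)].

Definition cauchy_sequences (v : K -> R) : set (nat -> K) :=
  [set u | forall e : R, 0 < e -> exists N : nat, forall m n : nat,
     (N <= m)%N -> (N <= n)%N -> v (u m - u n) < e].

Definition null_sequences (v : K -> R) : set (nat -> K) :=
  [set u | v (u n) @[n --> \oo] --> (0 : R)].

Definition rational_sequences : set (nat -> K) :=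
  [set u | exists q : nat -> rat, u = fun n => (q n)%:A].

(* [K_v : Q_v], where the completion K_v is the ring of Cauchy sequences modulo
   the null sequences, and Q_v is the image in it of the rational Cauchy
   sequences. *)
Definition local_degree (v : K -> R) : nat :=
  quotient_dim (cauchy_sequences v `&` rational_sequences)
    (cauchy_sequences v) (null_sequences v).

(* All but finitely many factors are equal to 1, so that this is not the default
   value of a product with infinite support. *)
Definition height (x : K) : R :=
  \big[*%R/1]_(v \in places) Num.max (v x ^+ local_degree v) 1.

End Heights.

(** * The algorithm *)

Section Algorithm.
Variables (R : realType) (K : fieldExtType rat).

Definition bounded_ideals (B : nat) : set (set K) :=
  [set c | nonzero_ideal c /\ (ideal_norm c <= B)%N].

Definition ideal_quotient (a b : set K) : set K := ideal_mul a (ideal_inv b).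

Definition admissible_pair (ab : set K * set K) : Prop :=
  (exists xi, ideal_quotient ab.1 ab.2 = principal_ideal xi) /\
  ideal_is_gcd ab.1 ab.2 (@ring_of_integers K).

(* The algorithm does not specify which generator of a b^-1 is found in its
   second step: gen a b is the one which is found. *)
Definition finds_generators (B : nat) (gen : set K -> set K -> K) : Prop :=
  forall a b, bounded_ideals B a -> bounded_ideals B b ->
    admissible_pair (a, b) ->
    ideal_quotient a b = principal_ideal (gen a b).

(* The finite lists L, G, U, S and the number B0 are the values of the variables
   of the algorithm after its execution on input K and B. *)
Record algorithm_run (B : nat) (gen : set K -> set K -> K)
    (L : seq (set K)) (G : seq K) (B0 : R) (U S : seq K) : Prop := {
  run_uniq : uniq L;
  run_ideals : forall c, c \in L <-> bounded_ideals B c;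
  run_generators :
    G = [seq gen ab.1 ab.2 | ab <- [seq (a, b) | a <- L, b <- L]
                           & `[< admissible_pair ab >]];
  run_max_mem : exists2 xi, xi \in G & B0 = height R xi;
  run_max_ge : forall xi, xi \in G -> height R xi <= B0;
  run_units : forall u,
    u \in U <-> integer_unit u /\ height R u <= B%:R * B0;
  run_result :
    S = 0 :: [seq p.2 * p.1 | p <- [seq (xi, u) | xi <- G, u <- U]
                            & height R (p.2 * p.1) <= B%:R]
}.

Definition algorithm_outputs (B : nat) (gen : set K -> set K -> K)
    (S : seq K) : Prop :=
  exists L G B0 U, algorithm_run B gen L G B0 U S.

End Algorithm.

(* Main.v *)
Require Import Defs.
From HB Require Import structures.
From mathcomp Require Import finmap.
From mathcomp Require Import all_boot all_order all_algebra all_field.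
From mathcomp Require Import all_classical all_reals all_analysis.
From mathcomp Require Import complex Rstruct.
From mathcomp Require Import zify ring lra.

Set Implicit Arguments.
Unset Strict Implicit.
Unset Printing Implicit Defensive.

Import Order.TTheory GRing.Theory Num.Theory.
Import numFieldNormedType.Exports.

Local Open Scope classical_set_scope.
Local Open Scope ring_scope.

(** Let [x] be a nonzero element of [K], and write the fractional ideal [x O] as
    [a / b] with coprime integral ideals [a] and [b]. The finite places contribute
    exactly the norm of [b] to the height of [x], and by the product formula
    (norm_fraction) the norm of [a] is at most the height of [x] as well: the
    product of the norm of [b] by the absolute values of the conjugates of [x]
    is the norm of [a]. So if the height of [x] is at most [B], both ideals are
    in the list of the first step, and [x = u xi] for the generator [xi] which
    was found for the pair [(a, b)] and some unit [u]. The finite contributions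
    to the heights of [x] and [xi] are equal, because they depend on [a] and [b]
    only; comparing the archimedean ones gives that the height of [u] is at most
    the product of the heights of [x] and [xi], hence at most [B B0], so [u] is in
    the list of units (bounded_height_mem). The converse inclusion is built into
    the filter of the fourth step, and the algorithm stops because there are
    finitely many ideals of bounded norm and finitely many units of bounded
    height (finite_bounded_ideals, finite_bounded_integers).

    Two computations carry this argument.

    - The index of [y O] in [O] is the absolute value of the norm of [y]
      (index_principal_ideal). The powers of an integral primitive element
      span a lattice which contains [d O] for some nonzero integer [d], by the
      nondegeneracy of the trace form. On that lattice multiplication by an
      integer is an integral matrix, whose determinant is at the same time an
      index (Smith normal form) and a product of conjugates. Finiteness of these
      indices also makes ideals finitely generated and nonzero primes maximal,
      from which the unique factorization of ideals follows as usual
      (invertible_prime, ideal_factorization).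

    - The local degrees are the expected ones, so that the height is the product
      of an archimedean part over all the embeddings and of powers of norms of
      primes (height_formula). A family in [K] whose rational combinations are
      dense and control their coefficients is a basis of the completion
      (local_degree_basis). At a prime [P] above [p], of ramification index [e]
      and inertia degree [f], one lifts a basis over the field with [p] elements
      of the quotient by the [e]-th power of [P], which has [p ^ (e f)] elements
      (local_basis). At an embedding the family is [1], or [1] and an element
      with a non-real image, and two embeddings give the same place exactly when
      they are equal or conjugate (local_degree_arch). *)

(** * Indices of additive subgroups *)

Definition add_subgroup (V : zmodType) (A : set V) : Prop :=
  A 0 /\ forall x y, A x -> A y -> A (x - y).

(** The cosets of [I] in [A] are handled through a system of representatives
    indexed by a finite type, so that no quotient has to be built. *)
Definition has_index (V : zmodType) (A I : set V) (n : nat) : Prop :=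
  exists (T : finType) (r : T -> V),
    [/\ #|T| = n, forall t, A (r t), forall s t, I (r s - r t) -> s = t
      & forall x, A x -> exists t, I (x - r t)].

Section Index.
Variable V : zmodType.
Implicit Types A I J : set V.

Lemma subgroupN A x : add_subgroup A -> A x -> A (- x).
Proof. by case=> A0 AB Ax; rewrite -sub0r; apply: AB. Qed.

Lemma subgroupD A x y : add_subgroup A -> A x -> A y -> A (x + y).
Proof.
by move=> gA Ax Ay; rewrite -[y]opprK; apply: gA.2 => //; apply: subgroupN.
Qed.

Lemma subgroupMn A x n : add_subgroup A -> A x -> A (x *+ n).
Proof.
move=> gA Ax; elim: n => [|n IHn]; first exact: gA.1.
by rewrite mulrS; apply: subgroupD.
Qed.

Lemma subgroupMz A x (n : int) : add_subgroup A -> A x -> A (x *~ n).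
Proof.
move=> gA Ax; case: n => n; first exact: subgroupMn.
by apply: subgroupN => //; apply: subgroupMn.
Qed.

Lemma subgroup_sum A (T : Type) (s : seq T) (P : pred T) (F : T -> V) :
  add_subgroup A -> (forall i, P i -> A (F i)) -> A (\sum_(i <- s | P i) F i).
Proof.
move=> gA AF; apply: big_ind => //; first exact: gA.1.
by move=> x y; apply: subgroupD.
Qed.

Lemma subgroup_sub_trans I x y z :
  add_subgroup I -> I (x - y) -> I (y - z) -> I (x - z).
Proof.
by move=> gI Ixy Iyz; rewrite -[x](subrK y) -addrA; apply: subgroupD.
Qed.

Lemma subgroup_subC I x y : add_subgroup I -> I (x - y) -> I (y - x).
Proof. by move=> gI Ixy; rewrite -opprB; apply: subgroupN. Qed.

Lemma has_index_le A I m n :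
  add_subgroup I -> has_index A I m -> has_index A I n -> (m <= n)%N.
Proof.
move=> gI [S [r [<- Ar r_inj _]]] [T [q [<- _ _ q_cov]]].
have /choice[f fP] s := q_cov _ (Ar s).
suff /leq_card : injective f by [].
move=> s t fst; apply/r_inj/(subgroup_sub_trans gI (fP s)); rewrite fst.
exact: subgroup_subC.
Qed.

Lemma has_index_uniq A I m n :
  add_subgroup I -> has_index A I m -> has_index A I n -> m = n.
Proof.
by move=> gI Im In; apply/eqP; rewrite eqn_leq !(@has_index_le A I).
Qed.

Lemma has_index_trans A J I m n : J `<=` A -> add_subgroup A ->
    add_subgroup J -> I `<=` J ->
  has_index A J m -> has_index J I n -> has_index A I (m * n).
Proof.
move=> sJA gA gJ sIJ [S [r [<- Ar r_inj r_cov]]] [T [q [<- Jq q_inj q_cov]]].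
exists (S * T)%type, (fun p => r p.1 + q p.2); split.
- by rewrite card_prod.
- by move=> p; apply: subgroupD => //; apply/sJA/Jq.
- move=> [s t] [s' t'] /= Ist.
  have es : s = s'.
    apply: r_inj; rewrite -[_ - _](addrK (q t - q t')).
    apply: gJ.2; last exact: gJ.2.
    apply/sIJ; congr (I _) : Ist.
    by rewrite opprD addrACA.
  rewrite -{s'}es in Ist *; congr (_, _); apply: q_inj.
  by congr (I _) : Ist; rewrite opprD addrACA subrr add0r.
- move=> x /r_cov[s Js]; have [t It] := q_cov _ Js.
  by exists (s, t); rewrite /= opprD addrA.
Qed.

(** A finite family meeting every coset can be thinned out to a system of
    representatives. *)
Lemma has_index_cover A I (T : finType) (r : T -> V) : add_subgroup I ->
    (forall t, A (r t)) -> (forall x, A x -> exists t, I (x - r t)) ->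
  exists n, has_index A I n.
Proof.
move=> gI Ar r_cov.
pose R s t := `[< I (r s - r t) >].
pose rep t := odflt t [pick s | R t s].
have repP t : I (r t - r (rep t)).
  rewrite /rep; case: pickP => [s /asboolP//|_] /=.
  by rewrite subrr; exact: gI.1.
have rep_eq s t : I (r s - r t) -> rep s = rep t.
  move=> Ist; rewrite /rep.
  have eR : R s =1 R t.
    move=> u; apply/asboolP/asboolP; apply: subgroup_sub_trans => //.
    exact: subgroup_subC.
  rewrite (eq_pick eR); case: pickP => //= /(_ t); rewrite /R.
  by rewrite subrr => /asboolPn[]; exact: gI.1.
pose T' := {t | rep t == t}.
exists #|{: T'}|, T', (fun t => r (val t)); split=> //.
  move=> s t /rep_eq; rewrite (eqP (valP s)) (eqP (valP t)).
  exact: val_inj.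
move=> x /r_cov[t It].
have rep_rep : rep (rep t) == rep t.
  by apply/eqP/rep_eq; apply: subgroup_subC.
by exists (exist _ (rep t) rep_rep); apply: subgroup_sub_trans It _.
Qed.

Lemma has_index_upper A J I n : add_subgroup J -> I `<=` J ->
  has_index A I n -> exists m, has_index A J m.
Proof.
move=> gJ sIJ [T [r [_ Ar _ r_cov]]].
apply: (has_index_cover gJ Ar) => x /r_cov[t It].
by exists t; apply: sIJ.
Qed.

Lemma has_index_lower A J I n : add_subgroup I -> add_subgroup J -> J `<=` A ->
  has_index A I n -> exists m, has_index J I m.
Proof.
move=> gI gJ sJA [T [r [_ Ar _ r_cov]]].
have /choice[q qP] t : exists q, J q /\
    ((exists2 y, J y & I (y - r t)) -> I (q - r t)).
  have [[y Jy Iy]|nex] := pselect (exists2 y, J y & I (y - r t)).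
    by exists y.
  by exists 0; split=> //; exact: gJ.1.
apply: (@has_index_cover J I T q gI) => [t|x Jx]; first by case: (qP t).
have [t It] := r_cov _ (sJA _ Jx); exists t.
apply: (subgroup_sub_trans gI It); apply: subgroup_subC => //.
have [_] := qP t; apply.
by exists x.
Qed.

Lemma has_index_split A J I k : add_subgroup A -> add_subgroup J ->
    add_subgroup I -> I `<=` J -> J `<=` A -> has_index A I k ->
  exists m n, [/\ has_index A J m, has_index J I n & k = (m * n)%N].
Proof.
move=> gA gJ gI sIJ sJA kP.
have [m mP] := has_index_upper gJ sIJ kP.
have [n nP] := has_index_lower gI gJ sJA kP.
exists m, n; split=> //; apply: has_index_uniq gI kP _.
exact: has_index_trans mP nP.
Qed.

Lemma has_index_gt0 A I n : A 0 -> has_index A I n -> (0 < n)%N.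
Proof. by move=> A0 [T [r [<- _ _ /(_ _ A0)[t _]]]]; apply/card_gt0P; exists t. Qed.

Lemma has_index_self A : add_subgroup A -> has_index A A 1.
Proof.
move=> gA; exists unit, (fun=> 0); rewrite card_unit; split=> //.
- by move=> _; exact: gA.1.
- by move=> [] [].
- by move=> x Ax; exists tt; rewrite subr0.
Qed.

Lemma has_index1 A I : add_subgroup I -> has_index A I 1 -> A 0 -> A `<=` I.
Proof.
move=> gI [T [r [/fintype1[t0 T1] _ _ r_cov]]] A0 x /r_cov[t It].
have [s Is] := r_cov _ A0; move: It Is; rewrite (T1 t) (T1 s) sub0r => It Is.
by rewrite -[x](subrK (r t0)) -[r t0]opprK; apply: gI.2 => //; rewrite opprK.
Qed.

(** Lagrange's theorem: translation by [x] permutes the cosets of [I], so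
    comparing the sum of the representatives with that of their translates
    gives [n x] in [I]. *)
Lemma has_index_exponent A I n x : add_subgroup A -> add_subgroup I ->
  I `<=` A -> has_index A I n -> A x -> I (x *+ n).
Proof.
move=> gA gI sIA [T [r [<- Ar r_inj r_cov]]] Ax.
have /choice[f fP] t : exists s, I (r t + x - r s).
  by apply: r_cov; apply: subgroupD.
have f_inj : injective f.
  move=> s t fst; apply: r_inj.
  have : I (r s + x - (r t + x)).
    apply: subgroup_sub_trans (fP s) _ => //; rewrite fst.
    exact: subgroup_subC.
  by rewrite opprD addrACA subrr addr0.
have : I (\sum_t (r t + x - r (f t))) by apply: subgroup_sum.
rewrite sumrB big_split /= [X in X + _ - _](reindex f) /=; last first.
  exact/onW_bij/injF_bij.
by rewrite addrAC subrr add0r sumr_const.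
Qed.

End Index.

Lemma zmod_morphism0 (V W : zmodType) (f : V -> W) : zmod_morphism f -> f 0 = 0.
Proof. by move=> fB; rewrite -[0 in LHS](subrr 0) fB subrr. Qed.

Lemma subgroup_image (V W : zmodType) (f : V -> W) (A : set V) :
  zmod_morphism f -> add_subgroup A -> add_subgroup (f @` A).
Proof.
move=> fB gA; split; first by exists 0; [exact: gA.1|rewrite zmod_morphism0].
by move=> _ _ [x Ax <-] [y Ay <-]; exists (x - y); rewrite ?fB //; apply: gA.2.
Qed.

Lemma has_index_image (V W : zmodType) (f : V -> W) (A I : set V) n :
  zmod_morphism f -> injective f ->
  has_index A I n -> has_index (f @` A) (f @` I) n.
Proof.
move=> fB f_inj [T [r [cT Ar r_inj r_cov]]]; exists T, (f \o r); split=> //.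
- by move=> t; exists (r t).
- by move=> s t [x Ix]; rewrite /= -fB => /f_inj xE; apply: r_inj; rewrite -xE.
- by move=> _ [x /r_cov[t It] <-]; exists t, (x - r t); rewrite ?fB.
Qed.

(** * Linear algebra over quotients *)

(** [A0] modulo [I] is a field acting on [A] modulo [I]. *)
Record field_modulo (T : comPzRingType) (A0 A I : set T) : Prop := {
  fmod_group0 : add_subgroup A0;
  fmod_one : A0 1;
  fmod_mul : forall x y, A0 x -> A0 y -> A0 (x * y);
  fmod_ideal : add_subgroup I;
  fmod_absorb : forall a x, A a -> I x -> I (a * x);
  fmod_sub : A0 `<=` A;
  fmod_proper : ~ I 1;
  fmod_inv : forall x, A0 x -> ~ I x -> exists2 y, A0 y & I (x * y - 1) }.

Section DimensionInvariance.
Variables (T : comPzRingType) (A0 A I : set T).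
Hypothesis F : field_modulo A0 A I.
Let gA0 := fmod_group0 F.
Let gI := fmod_ideal F.

(** Gaussian elimination: with more rows than columns, the rows satisfy a
    nontrivial linear relation modulo [I]. *)
Lemma rows_dependent (J : finType) n (S : {set J}) (M : J -> 'I_n -> T) :
    (n < #|S|)%N -> (forall j i, A0 (M j i)) ->
  exists c : J -> T, [/\ forall j, A0 (c j), exists2 j, j \in S & ~ I (c j)
    & forall i, I (\sum_(j in S) c j * M j i)].
Proof.
elim: n S M => [|n IHn] S M.
  move=> /card_gt0P[j jS] _; exists (fun=> 1); split; last by case.
    by move=> _; exact: fmod_one F.
  by exists j => //; exact: fmod_proper F.
move=> ltnS A0M.
have [all0|/existsNP[j0 /not_implyP[j0S nI]]] :=
  pselect (forall j, j \in S -> I (M j ord0)).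
  have [c [A0c c_n0 Ic]] := IHn S (fun j i => M j (lift ord0 i)) (ltnW ltnS)
    (fun j i => A0M j _).
  exists c; split=> // i; have [j ->|->] := unliftP ord0 i; first exact: Ic.
  apply: subgroup_sum => // j jS; apply: (fmod_absorb F); last exact: all0.
  exact/(fmod_sub F).
have [d A0d Id] := fmod_inv F (A0M j0 ord0) nI.
pose M' j i := M j (lift ord0 i) - M j ord0 * d * M j0 (lift ord0 i).
have ltn' : (n < #|S :\ j0|)%N by rewrite [#|S|](cardsD1 j0) j0S in ltnS.
have A0M' j i : A0 (M' j i).
  by apply: gA0.2 => //; do !apply: (fmod_mul F).
have [c [A0c [j1 j1S c_n0] Ic]] := IHn _ M' ltn' A0M'.
pose c0 := - \sum_(j in S :\ j0) c j * (M j ord0 * d).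
have sumE i : \sum_(j in S) (if j == j0 then c0 else c j) * M j i =
   c0 * M j0 i + \sum_(j in S :\ j0) c j * M j i.
  rewrite (big_setD1 j0) //= eqxx; congr (_ + _); apply: eq_bigr => j.
  by rewrite !inE => /andP[/negPf->].
exists (fun j => if j == j0 then c0 else c j); split.
- move=> j; case: eqP => // _; apply: subgroupN => //; apply: subgroup_sum => //.
  by move=> k _; do !apply: (fmod_mul F).
- exists j1; first by case/setD1P: j1S.
  by case/setD1P: j1S => /negPf->.
- move=> i; rewrite sumE; have [k ->|->] := unliftP ord0 i.
    congr (I _): (Ic k); rewrite /c0 mulNr mulr_suml -sumrN -big_split /=.
    by apply: eq_bigr => j _; rewrite /M' mulrBr addrC -!mulrA.
  rewrite /c0 mulNr mulr_suml -sumrN -big_split /=.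
  apply: subgroup_sum => // j _.
  have -> : - (c j * (M j ord0 * d) * M j0 ord0) + c j * M j ord0 =
    (c j * M j ord0) * - (M j0 ord0 * d - 1) by ring.
  apply: (fmod_absorb F); last exact: subgroupN.
  by apply: (fmod_sub F); apply: (fmod_mul F).
Qed.

Lemma quotient_has_dim_le m n :
  quotient_has_dim A0 A I m -> quotient_has_dim A0 A I n -> (m <= n)%N.
Proof.
move=> [b [Ab _ b_free]] [b' [Ab' b'_span _]].
rewrite leqNgt; apply/negP => ltnm.
have /choice[M MP] j := b'_span _ (Ab j).
have cS : (n < #|[set: 'I_m]%SET|)%N by rewrite cardsT card_ord.
have [c [A0c [j _ c_n0] Ic]] :=
  rows_dependent cS (fun j i => (MP j).1 i).
apply: c_n0; apply: b_free => //.
have -> : \sum_i c i * b i = \sum_i c i * (b i - \sum_k M i k * b' k) +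
    \sum_k b' k * \sum_(i in [set: 'I_m]%SET) c i * M i k.
  transitivity (\sum_i (c i * (b i - \sum_k M i k * b' k) +
      c i * \sum_k M i k * b' k)).
    by apply: eq_bigr => i _; ring.
  rewrite big_split /=; congr (_ + _).
  under [RHS]eq_bigr => k _ do rewrite mulr_sumr.
  rewrite exchange_big /=; apply: eq_big => [i|i _]; first by rewrite inE.
  by rewrite mulr_sumr; apply: eq_bigr => k _; ring.
apply: subgroupD => //; apply: subgroup_sum => // i _.
  by apply: (fmod_absorb F); [exact/(fmod_sub F)|exact: (MP i).2].
exact: (fmod_absorb F).
Qed.

Lemma quotient_dimE n : quotient_has_dim A0 A I n -> quotient_dim A0 A I = n.
Proof.
move=> nP; apply: xget_unique => // m mP.
by apply/eqP; rewrite eqn_leq !quotient_has_dim_le.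
Qed.

End DimensionInvariance.

(** ** Groups killed by a prime *)

(** A Bezout relation between [p] and [k] would put [x] itself in [I]. *)
Lemma multiple_in_subgroup (V : zmodType) (I : set V) (p : nat) x (k : int) :
  add_subgroup I -> prime p -> I (x *+ p) -> ~ I x -> I (x *~ k) -> (p %| k)%Z.
Proof.
move=> gI p_pr Ip nIx Ik; apply/negPn/negP => npk; apply: nIx.
have : coprimez p k by rewrite coprimezE prime_coprime.
case/coprimezP=> -[u v] /= uv1.
rewrite -[x]mulr1z -uv1 mulrzDr [u * _]mulrC [v * _]mulrC.
by rewrite !mulrzA; apply: subgroupD => //; apply: subgroupMz.
Qed.

(** The basis is obtained by adding to [I] one element [x] of [A] at a time:
    each step divides the index by [p]. *)
Lemma torsion_basis (V : zmodType) (A I : set V) (p N : nat) : prime p ->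
    add_subgroup A -> add_subgroup I -> I `<=` A ->
    (forall x, A x -> I (x *+ p)) -> has_index A I N ->
  exists d (b : 'I_d -> V), [/\ N = (p ^ d)%N, forall i, A (b i),
    forall x, A x -> exists c : 'I_d -> int, I (x - \sum_i b i *~ c i)
    & forall c : 'I_d -> int, I (\sum_i b i *~ c i) ->
        forall i, (p %| c i)%Z].
Proof.
move=> p_pr gA; elim/ltn_ind: N I => N IHN I gI sIA Ip IN.
have [sAI|/existsNP[x /not_implyP[Ax nIx]]] := pselect (A `<=` I).
  exists 0, (fun=> 0); split; [|by case| |by move=> c _ []]; last first.
    by move=> x Ax; exists (fun=> 0); rewrite big_ord0 subr0; apply: sAI.
  apply: (has_index_uniq gI IN); exists unit, (fun=> 0); rewrite card_unit.
  split=> [//|_|[] []//|]; first exact: gA.1.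
  by move=> y Ay; exists tt; rewrite subr0; apply: sAI.
pose J := [set y | exists k : int, I (y - x *~ k)].
have sIJ : I `<=` J by move=> y Iy; exists 0; rewrite mulr0z subr0.
have gJ : add_subgroup J.
  split; first by apply/sIJ; exact: gI.1.
  move=> y z [k Ik] [l Il]; exists (k - l); rewrite mulrzBr.
  rewrite (_ : _ - _ = (y - x *~ k) - (z - x *~ l)); first exact: gI.2.
  by rewrite !opprB addrACA [RHS]addrACA [- z + _]addrC.
have sJA : J `<=` A.
  move=> y [k Ik]; rewrite -[y](subrK (x *~ k)); apply: subgroupD => //.
    exact: sIA.
  exact: subgroupMz.
have JIp : has_index J I p.
  exists 'I_p, (fun t : 'I_p => x *+ t); rewrite card_ord; split=> //.
  - by move=> t; exists t; rewrite subrr; exact: gI.1.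
  - move=> s t; rewrite [x *+ s - _](_ : _ = x *~ (s%:Z - t%:Z)); last first.
      by rewrite mulrzBr.
    move=> /(multiple_in_subgroup gI p_pr (Ip _ Ax) nIx).
    rewrite -eqz_mod_dvd => /eqP; rewrite !modz_nat => -[].
    by rewrite !modn_small // => /val_inj.
  - move=> y [k Ik].
    have p_gt0 : (0 < p)%N by exact: prime_gt0.
    have k_ge0 : (0 <= k %% p)%Z by apply: modz_ge0; rewrite eqz_nat -lt0n.
    have ltkp : (`|(k %% p)%Z|%N < p)%N.
      by rewrite -ltz_nat gez0_abs // ltz_pmod.
    exists (Ordinal ltkp) => /=.
    rewrite -[x *+ _]/(x *~ _%:Z) gez0_abs //.
    apply: subgroup_sub_trans Ik _ => //.
    rewrite -mulrzBr {1}(divz_eq k p) addrK mulrC mulrzA.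
    by apply: subgroupMz => //; apply: Ip.
have [m [n [AJm JIn NE]]] := has_index_split gA gJ gI sIJ sJA IN.
have np := has_index_uniq gI JIn JIp; rewrite {n JIn}np in NE.
have m_gt0 := has_index_gt0 gA.1 AJm.
have ltmN : (m < N)%N by rewrite NE ltn_Pmulr // prime_gt1.
have [d [b [mE Ab b_span b_free]]] :=
  IHN m ltmN J gJ sJA (fun y Ay => sIJ _ (Ip y Ay)) AJm.
pose b' i := if unlift ord0 i is Some j then b j else x.
have b'0 : b' ord0 = x by rewrite /b' unlift_none.
have b'S j : b' (lift ord0 j) = b j by rewrite /b' liftK.
have b'sum c : \sum_i b' i *~ c i =
    x *~ c ord0 + \sum_j b j *~ c (lift ord0 j).
  by rewrite big_ord_recl b'0; under eq_bigr => j _ do rewrite b'S.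
exists d.+1, b'; split.
- by rewrite NE mE expnSr.
- by move=> i; have [j ->|->] := unliftP ord0 i; rewrite ?b'S ?b'0.
- move=> y /b_span[c [k Ik]].
  exists (fun i => if unlift ord0 i is Some j then c j else k).
  rewrite b'sum unlift_none; under eq_bigr => j _ do rewrite liftK.
  by rewrite opprD addrA addrAC.
- move=> c; rewrite b'sum => Ic.
  have pc j : (p %| c (lift ord0 j))%Z.
    apply: (b_free (fun j => c (lift ord0 j))); exists (- c ord0).
    by rewrite mulrNz opprK addrC.
  move=> i; have [j ->|->] := unliftP ord0 i => //.
  apply: (multiple_in_subgroup gI p_pr (Ip _ Ax) nIx).
  rewrite -[_ *~ _](addrK (\sum_j b j *~ c (lift ord0 j))).
  apply: gI.2 => //; apply: subgroup_sum => // j _.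
  have /dvdzP[q ->] := pc j; rewrite mulrC mulrzA.
  by apply: subgroupMz => //; apply: Ip.
Qed.

(** * Algebraic integers of a number field *)

Lemma common_denominator (T : finType) (f : T -> rat) :
  exists2 d : int, d != 0 & forall t, exists k : int, d%:~R * f t = k%:~R.
Proof.
exists (\prod_t denq (f t)); first by apply/prodf_neq0 => t _; exact: denq_neq0.
move=> t; exists (numq (f t) * \prod_(s | s != t) denq (f s)).
rewrite (bigD1 t) //= !intrM mulrAC; congr (_ * _).
by rewrite mulrC -numqE.
Qed.

(** Transported to the algebraic complex numbers, this is the fact that a
    rational algebraic integer is an integer. *)
Lemma integral_rat (F : fieldType) (q : rat) (f : {rmorphism rat -> F}) :
  integralOver (intr : int -> F) (f q) -> exists k : int, q = k%:~R.
Proof.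
case=> p p_mon p_root.
have q_root : root (map_poly intr p) q.
  rewrite -(fmorph_root f) -map_poly_comp /=.
  by rewrite (eq_map_poly (g := intr)) // => k /=; rewrite rmorph_int.
have : (ratr q : algC) \in Aint.
  apply: (@root_monic_Aint (map_poly ratr (map_poly intr p))).
  - by rewrite fmorph_root; exact: q_root.
  - by rewrite map_monic monic_map.
  - apply/polyOverP => i; rewrite !coef_map /= ratr_int.
  exact: intr_int.
move=> /(Cint_rat_Aint (Crat_rat q)) /intrP[k qk]; exists k.
by apply: (fmorph_inj (ratr : {rmorphism rat -> algC})); rewrite /= qk ratr_int.
Qed.

Section RingOfIntegers.
Variable K : fieldExtType rat.
Implicit Types x y z : K.
Local Notation OK := (@ring_of_integers K).

Lemma integer0 : OK 0. Proof. exact: mxpoly.integral0. Qed.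
Lemma integer1 : OK 1. Proof. exact: mxpoly.integral1. Qed.
Lemma integerB x y : OK x -> OK y -> OK (x - y).
Proof. exact: mxpoly.integral_sub. Qed.
Lemma integerM x y : OK x -> OK y -> OK (x * y).
Proof. exact: mxpoly.integral_mul. Qed.
Lemma integer_group : add_subgroup OK.
Proof. by split; [exact: integer0|exact: integerB]. Qed.
Lemma integerD x y : OK x -> OK y -> OK (x + y).
Proof. exact: subgroupD integer_group. Qed.
Lemma integerN x : OK x -> OK (- x).
Proof. exact: subgroupN integer_group. Qed.
Lemma integer_int (k : int) : OK k%:~R.
Proof. exact: mxpoly.integral_id. Qed.
Lemma integer_nat (k : nat) : OK k%:R.
Proof. exact: mxpoly.integral_nat. Qed.
Lemma integerX x n : OK x -> OK (x ^+ n).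
Proof.
move=> Ox; elim: n => [|n IHn]; first by rewrite expr0; exact: integer1.
by rewrite exprS; apply: integerM.
Qed.
Lemma integer_sum (T : Type) (s : seq T) (P : pred T) (F : T -> K) :
  (forall i, P i -> OK (F i)) -> OK (\sum_(i <- s | P i) F i).
Proof. exact: subgroup_sum integer_group. Qed.

(** [z] is an eigenvalue of an integral matrix, hence a root of its
    characteristic polynomial, which is monic with integral coefficients. *)
Lemma integer_of_stable n (v : 'rV[K]_n) (A : 'M[int]_n) z :
  v != 0 -> v *m map_mx intr A = z *: v -> OK z.
Proof.
move=> v_n0 vA; exists (char_poly A); first exact: char_poly_monic.
rewrite map_char_poly -eigenvalue_root_char.
by apply/eigenvalueP; exists v.
Qed.

(** In a basis of [K], multiplication by [x] has a rational matrix, which a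
    common denominator of its entries makes integral. *)
Lemma integer_denominator x : exists2 d : int, d != 0 & OK (d%:~R * x).
Proof.
pose X := vbasis {: K}.
pose A := \matrix_(i < \dim {: K}, j < \dim {: K}) coord X i (x * X`_j).
have [d d_n0 dP] := common_denominator
  (fun ij : 'I_(\dim {: K}) * 'I_(\dim {: K}) => A ij.1 ij.2).
have {dP}/choice[B BP] ij := dP ij.
exists d => //.
apply: (@integer_of_stable _ (\row_j X`_j) (\matrix_(i, j) B (i, j))).
  apply/eqP => X0; have : (1 : K) \in {: K}%VS by exact: memvf.
  move=> /coord_vbasis; rewrite big1 => [/eqP|i _]; first by rewrite oner_eq0.
  by move/rowP: X0 => /(_ i); rewrite !mxE => ->; rewrite scaler0.
apply/rowP=> j; rewrite !mxE.
rewrite -mulrA [x * _](coord_vbasis (memvf _)) mulr_sumr.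
apply: eq_bigr => i _; rewrite !mxE.
have /= := BP (i, j); rewrite mxE -/X => BE.
by rewrite mulrzl mulrzr -!scaler_int scalerA BE.
Qed.

End RingOfIntegers.

(** * Complex embeddings *)

(** An enumeration of the complex embeddings of [K] and an integral primitive
    element. The powers of this element are a basis of [K] over [rat]: their
    independence follows from [emb_gene_inj] by a Vandermonde determinant. *)
Record embeddings (R : realType) (K : fieldExtType rat) := Embeddings {
  degree : nat;
  gene : K;
  emb : 'I_degree -> {rmorphism K -> R[i]};
  gene_integer : ring_of_integers gene;
  gene_span : forall x, exists c : 'rV[rat]_degree,
    x = \sum_j (c 0 j)%:A * gene ^+ j;
  emb_gene_inj : injective (fun k => emb k gene);
  emb_complete : forall tau : {rmorphism K -> R[i]},
    exists k, forall x, tau x = emb k x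
}.

Lemma rmorph_alg_rat (K : fieldExtType rat) (F : numFieldType)
  (f : {rmorphism K -> F}) (q : rat) : f q%:A = ratr q.
Proof.
exact: (fmorph_eq_rat (f \o in_alg K)).
Qed.

Lemma pchar0 (K : fieldExtType rat) : [pchar K] =i pred0.
Proof. by move=> p; rewrite pchar_lalg pchar_num. Qed.

(** A primitive element exists because [K] has characteristic zero; multiplying
    it by an integer makes it integral and keeps it primitive. *)
Lemma integral_primitive_element (K : fieldExtType rat) :
  exists2 theta : K, ring_of_integers theta & <<1; theta>>%VS = fullv.
Proof.
have sepK : separable 1 {:K}.
  by apply/separableP => y _; apply: pcharf0_separable (pchar0 K) _.
have := eq_adjoin_separable_generator sepK (subvf _).
set x := separable_generator _ _ => xE.
have [d d_n0 Odx] := integer_denominator x.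
exists (d%:~R * x) => //; apply/eqP; rewrite eqEsubv subvf /= xE.
apply/FadjoinP; split; first exact: sub1v.
have dK_n0 : d%:~R != 0 :> rat by rewrite intr_eq0.
rewrite -[X in X \in _](scalerK dK_n0) memvZ // scaler_int -mulrzl.
exact: memv_adjoin.
Qed.

Section Existence.
Variables (R : realType) (K : fieldExtType rat) (theta : K).
Hypothesis theta_gen : <<1; theta>>%VS = fullv.

Let ev (p : {poly rat}) : K := (map_poly (in_alg K) p).[theta].

(** The minimal polynomial of [theta], brought down from [K] to [rat]. *)
Lemma rational_minimal_polynomial : exists mu : {poly rat},
  [/\ mu \is monic, separable_poly mu & forall p, (ev p == 0) = (mu %| p)].
Proof.
have /polyOver1P[mu muE] := minPolyOver 1 theta.
exists mu; split.
- by rewrite -(map_monic (in_alg K)) -muE monic_minPoly.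
- rewrite -(separable_map (in_alg K)) -muE.
  exact: pcharf0_separable (pchar0 K) _.
- move=> p; rewrite -(dvdp_map (in_alg K)) -muE.
  apply/idP/idP=> [p0|/dvdpP[q /(congr1 (horner^~ theta))]].
    by apply: minPoly_dvdp => //; apply/polyOver1P; exists p.
  by rewrite /ev hornerM minPolyxx mulr0 => ->.
Qed.

(** Every element of [K] is [p.[theta]] for some rational [p]; sending it to
    [p.[z]] does not depend on [p], by the divisibility property of [mu]. *)
Lemma embedding_of_root (mu : {poly rat}) (z : R[i]) :
    (forall p, (ev p == 0) = (mu %| p)) -> root (map_poly ratr mu) z ->
  exists sigma : {rmorphism K -> R[i]}, sigma theta = z.
Proof.
move=> muP z_root.
have ev_surj x : exists p, x = ev p.
  have : x \in <<1; theta>>%VS by rewrite theta_gen memvf.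
  by case/Fadjoin_polyP=> p /polyOver1P[q ->] ->; exists q.
have /choice[P PE] := ev_surj.
pose f x := (map_poly ratr (P x)).[z].
have fE p : f (ev p) = (map_poly ratr p).[z].
  apply/eqP; rewrite -subr_eq0 -hornerN -hornerD -!rmorphB /=.
  have : mu %| (P (ev p) - p).
    have evB q r : ev (q - r) = ev q - ev r by rewrite /ev rmorphB hornerD hornerN.
    by rewrite -muP evB -PE subrr.
  case/dvdpP=> q ->; rewrite rmorphM hornerM.
  by move/rootP: z_root => ->; rewrite mulr0.
have evD p q : ev p + ev q = ev (p + q) by rewrite /ev rmorphD hornerD.
have evN p : - ev p = ev (- p) by rewrite /ev rmorphN hornerN.
have evM p q : ev p * ev q = ev (p * q) by rewrite /ev rmorphM hornerM.
have ev1 : 1 = ev 1 by rewrite /ev rmorph1 hornerC.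
have evX : theta = ev 'X by rewrite /ev map_polyX hornerX.
have f_zmod : zmod_morphism f.
  move=> x y; have [p ->] := ev_surj x; have [q ->] := ev_surj y.
  by rewrite evN evD !fE rmorphB hornerD hornerN.
have f_monoid : monoid_morphism f.
  have f1 : f 1 = 1 by rewrite [X in f X]ev1 fE rmorph1 hornerC.
  split=> //.
  move=> x y; have [p ->] := ev_surj x; have [q ->] := ev_surj y.
  by rewrite evM !fE rmorphM hornerM.
pose fA := GRing.isZmodMorphism.Build _ _ f f_zmod.
pose fM := GRing.isMonoidMorphism.Build _ _ f f_monoid.
pose F : {rmorphism K -> R[i]} := HB.pack f fA fM.
by exists F; rewrite -[F theta]/(f theta) evX fE map_polyX hornerX.
Qed.

Lemma rmorph_ev (tau : {rmorphism K -> R[i]}) p :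
  tau (ev p) = (map_poly ratr p).[tau theta].
Proof.
rewrite /ev -horner_map /= -map_poly_comp; congr (_.[_]).
by apply: eq_map_poly => q /=; rewrite rmorph_alg_rat.
Qed.

End Existence.

Lemma embeddings_exist (R : realType) (K : fieldExtType rat) :
  inhabited (embeddings R K).
Proof.
have [theta Otheta theta_gen] := integral_primitive_element K.
have [mu [mu_mon mu_sep muP]] := rational_minimal_polynomial theta.
have [rs rsE] := closed_field_poly_normal (map_poly ratr mu : {poly R[i]}).
rewrite (monicP _) ?map_monic // scale1r in rsE.
have rs_uniq : uniq rs.
  by rewrite -separable_prod_XsubC -rsE separable_map.
have rs_root z : (z \in rs) = root (map_poly ratr mu) z.
  by rewrite rsE root_prod_XsubC.
have rs_size : size mu = (size rs).+1.
  by rewrite -(size_map_poly (ratr : {rmorphism rat -> R[i]})) rsE size_prod_XsubC.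
have /choice[s sP] (k : 'I_(size rs)) :
    exists sigma : {rmorphism K -> R[i]}, sigma theta = rs`_k.
  apply: (embedding_of_root theta_gen muP).
  by rewrite -rs_root mem_nth.
constructor; unshelve eapply (@Embeddings R K (size rs) theta s Otheta).
- move=> x.
  have : x \in <<1; theta>>%VS by rewrite theta_gen memvf.
  case/Fadjoin_polyP=> p /polyOver1P[q ->] ->.
  exists (\row_j (q %% mu)`_j); rewrite {1}(divp_eq q mu) rmorphD hornerD /=.
  have /eqP -> : (map_poly (in_alg K) (q %/ mu * mu)).[theta] == 0.
    by rewrite muP dvdp_mulIr.
  rewrite add0r (@horner_coef_wide _ (size rs)); last first.
    by rewrite size_map_poly -ltnS -rs_size ltn_modp monic_neq0.
  by apply: eq_bigr => j _; rewrite mxE coef_map.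
- move=> k l /=; rewrite !sP => /eqP.
  by rewrite nth_uniq // => /eqP /val_inj.
- move=> tau.
  have : root (map_poly ratr mu) (tau theta).
    apply/rootP; rewrite -rmorph_ev; apply/eqP; rewrite fmorph_eq0.
    by rewrite muP.
  rewrite -rs_root => tau_rs.
  exists (Ordinal (etrans (index_mem _ _) tau_rs)) => x.
  have : x \in <<1; theta>>%VS by rewrite theta_gen memvf.
  case/Fadjoin_polyP=> p /polyOver1P[q ->] ->.
  by rewrite !rmorph_ev sP /= nth_index.
Qed.

(** * The lattice of the ring of integers *)

Lemma card_dffun_ord (n : nat) (f : 'I_n -> nat) :
  #|{dffun forall i, 'I_(f i)}| = (\prod_i f i)%N.
Proof.
rewrite card_dep_ffun foldrE big_map big_enum /=.
by apply: eq_bigr => i _; rewrite card_ord.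
Qed.

Lemma int_unit_abs (k : int) : k \is a GRing.unit -> `|k|%N = 1%N.
Proof. by move=> /orP[] /eqP->. Qed.

Lemma has_index_diag n (d : 'rV[int]_n) : (forall i, d 0 i != 0) ->
  has_index [set: 'rV[int]_n] (range (mulmxr (diag_mx d)))
    (\prod_i `|d 0%R i|%N)%N.
Proof.
move=> d_n0.
pose T := {dffun forall i, 'I_(`|d 0%R i|%N)}.
exists T, (fun t : T => \row_i Posz (t i)); split=> //.
- exact: card_dffun_ord.
- move=> s t [u _ /rowP uE]; apply/ffunP => i; apply/val_inj => /=.
  have := uE i; rewrite /= mul_mx_diag !mxE => /esym si.
  have : (d 0%R i %| (s i)%:Z - (t i)%:Z)%Z by rewrite si dvdz_mull.
  rewrite dvdzE -[X in (X %| _)%N]/(`|(`|d 0%R i|%N)%:Z|%N) -dvdzE -eqz_mod_dvd.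
  by rewrite !modz_nat !modn_small // => /eqP[].
- move=> x _.
  have lt i : (`|(x 0%R i %% d 0%R i)%Z| < `|d 0%R i|)%N.
    rewrite -ltz_nat gez0_abs ?modz_ge0 //.
    by rewrite ltz_mod.
  exists [ffun i => Ordinal (lt i)], (\row_i (x 0%R i %/ d 0%R i)%Z) => //.
  apply/rowP => i; rewrite /= mul_mx_diag !mxE ffunE /= gez0_abs ?modz_ge0 //.
  by rewrite {2}(divz_eq (x 0 i) (d 0 i)) addrK.
Qed.

(** By the Smith normal form it is enough to treat diagonal matrices. *)
Lemma has_index_det n (M : 'M[int]_n) : \det M != 0 ->
  has_index [set: 'rV[int]_n] (range (mulmxr M)) `|\det M|%N.
Proof.
have [L Lu [Q Qu [d _ ->]]] := int_Smith_normal_form M.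
set D := \matrix_(i, j) _.
pose e := \row_(i < n) d`_i.
have DE : D = diag_mx e by apply/matrixP => i j; rewrite !mxE.
rewrite !det_mulmx !mulf_eq0 !negb_or => /andP[/andP[_ D_n0] _].
have e_n0 i : e 0 i != 0.
  apply: contraNneq D_n0 => e0; rewrite DE det_diag.
  by apply/prodf_eq0; exists i => //; rewrite e0.
have Didx := has_index_diag e_n0; rewrite -DE in Didx.
have Q_inj : injective (mulmxr Q : 'rV[int]_n -> 'rV[int]_n).
  exact: (can_inj (mulmxK Qu)).
have := has_index_image (raddfB (mulmxr Q)) Q_inj Didx.
rewrite !abszM (int_unit_abs Lu) (int_unit_abs Qu) mul1n muln1.
have -> : \det D = \prod_i e 0 i by rewrite DE det_diag.
have abs1 : `|1 : int|%N = 1%N by [].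
rewrite (big_morph absz abszM abs1).
congr (has_index _ _ _).
  apply/seteqP; split=> // u _; exists (u *m invmx Q) => //=.
  by rewrite mulmxKV.
apply/seteqP; split=> [_ [_ [u _ <-] <-]|_ [u _ <-]].
  exists (u *m invmx L) => //=.
  by rewrite !mulmxA mulmxKV.
by exists (u *m L *m D); [exists (u *m L)|rewrite /= !mulmxA].
Qed.

Lemma alg_int (K : fieldExtType rat) (k : int) : (k%:~R : rat)%:A = k%:~R :> K.
Proof. by rewrite scaler_int. Qed.

Lemma intK_eq0 (K : fieldExtType rat) (k : int) : (k%:~R == 0 :> K) = (k == 0).
Proof. by rewrite -alg_int scaler_eq0 oner_eq0 orbF intr_eq0. Qed.

Lemma natK_eq0 (K : fieldExtType rat) (k : nat) : (k%:R == 0 :> K) = (k == 0)%N.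
Proof. exact: (intK_eq0 K k). Qed.

Section Lattice.
Variables (R : realType) (K : fieldExtType rat) (E : embeddings R K).
Local Notation n := (degree E).
Local Notation theta := (gene E).
Local Notation OK := (@ring_of_integers K).
Implicit Types x y : K.

Definition emb_norm x : R[i] := \prod_(k < n) emb k x.
Definition emb_trace x : R[i] := \sum_(k < n) emb k x.

Definition emb_mx : 'M[R[i]]_n := \matrix_(j, k) emb k (theta ^+ j).

Lemma det_emb_mx : \det emb_mx != 0.
Proof.
have -> : emb_mx = Vandermonde n (\row_k emb k theta).
  by apply/matrixP => j k; rewrite !mxE rmorphXn.
rewrite det_Vandermonde; apply/prodf_neq0 => i _; apply/prodf_neq0 => j ltij.
rewrite !mxE subr_eq0; apply: contraTneq ltij => /emb_gene_inj ->.
by rewrite ltnn.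
Qed.

(** Multiplication by [x] has the eigenvalues [emb k x], with the columns of
    [emb_mx] as eigenvectors. *)
Lemma mul_matrix_emb x (M : 'M[R[i]]_n) :
    (forall i (k : 'I_n), \sum_j M i j * emb k (theta ^+ j) = emb k (x * theta ^+ i)) ->
  \det M = emb_norm x /\ \tr M = emb_trace x.
Proof.
move=> MP.
have W_unit : emb_mx \in unitmx by rewrite unitmxE unitfE det_emb_mx.
have MW : M *m emb_mx = emb_mx *m diag_mx (\row_(k < n) emb k x).
  apply/matrixP => i k; rewrite mul_mx_diag !mxE -rmorphM mulrC -MP.
  by apply: eq_bigr => j _; rewrite mxE.
split.
  apply: (mulIf det_emb_mx); rewrite -det_mulmx MW det_mulmx det_diag mulrC.
  by congr (_ * _); apply: eq_bigr => k _; rewrite mxE.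
rewrite -[M](mulmxK W_unit) MW mxtrace_mulC mulmxA mulVmx // mul1mx mxtrace_diag.
by apply: eq_bigr => k _; rewrite mxE.
Qed.

Lemma mul_matrix_rat x : exists M : 'M[rat]_n,
  forall i : 'I_n, x * theta ^+ i = \sum_j (M i j)%:A * theta ^+ j.
Proof.
have /choice[c cP] (i : 'I_n) := gene_span E (x * theta ^+ i).
by exists (\matrix_(i < n) c i) => i; rewrite cP; under [RHS]eq_bigr do rewrite mxE.
Qed.

Lemma mul_matrix_ratr x (M : 'M[rat]_n) :
    (forall i : 'I_n, x * theta ^+ i = \sum_j (M i j)%:A * theta ^+ j) ->
  forall i (k : 'I_n), \sum_j map_mx ratr M i j * emb k (theta ^+ j) =
    emb k (x * theta ^+ i).
Proof.
move=> MP i k; rewrite MP rmorph_sum; apply: eq_bigr => j _.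
by rewrite mxE rmorphM rmorph_alg_rat.
Qed.

Lemma emb_integer (k : 'I_n) x : OK x -> integralOver (intr : int -> R[i]) (emb k x).
Proof.
case=> p p_mon p_root; exists p => //.
rewrite -(fmorph_root (emb k)) -map_poly_comp /= in p_root.
by congr (root _ _): p_root; apply: eq_map_poly => z /=; rewrite rmorph_int.
Qed.

(** The trace of [x] is rational, as the trace of a rational matrix, and
    integral, as a sum of conjugates. *)
Lemma emb_trace_int x : OK x -> exists t : int, emb_trace x = t%:~R.
Proof.
move=> Ox; have [M MP] := mul_matrix_rat x.
have [_ trM] := mul_matrix_emb (mul_matrix_ratr MP).
have : integralOver (intr : int -> R[i]) (ratr (\tr M)).
  rewrite -trace_map_mx trM; apply: (big_ind (integralOver intr)).
  - exact: mxpoly.integral0.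
  - exact: mxpoly.integral_add.
  - by move=> k _; apply: emb_integer.
move=> /integral_rat[t tE]; exists t.
by rewrite -trM trace_map_mx /= tE ratr_int.
Qed.

(** The coordinates of [x] on the powers of the generator are the solution of
    a linear system whose matrix has for entries the traces of these powers,
    and whose right-hand side is made of traces of integers. Both are integral,
    so that the determinant of the matrix is a common denominator. *)
Lemma integer_coordinates_bounded : exists2 d : int, d != 0 &
  forall x, OK x -> exists c : 'rV[int]_n,
    d%:~R * x = \sum_j (c 0 j)%:~R * theta ^+ j.
Proof.
have trP i : OK (theta ^+ i) by apply: integerX; exact: gene_integer.
have /choice[t tP] (m : nat) := emb_trace_int (trP m).
pose T := \matrix_(i < n, j < n) t (i + j)%N.
have TE : map_mx intr T = emb_mx *m emb_mx^T.
  apply/matrixP => i j; rewrite !mxE -tP; apply: eq_bigr => k _.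
  by rewrite !mxE -rmorphM exprD.
have T_n0 : \det T != 0.
  rewrite -(intr_eq0 R[i]) -det_map_mx TE det_mulmx det_tr mulf_neq0 //.
    exact: det_emb_mx.
  exact: det_emb_mx.
exists (\det T) => // x Ox.
have [c cE] := gene_span E x.
have /choice[s sP] (i : 'I_n) := emb_trace_int (integerM Ox (trP i)).
have cT : map_mx intr (\row_i s i) = c *m map_mx intr T.
  have ratrE p q (A : 'M[int]_(p, q)) :
      map_mx ratr (map_mx intr A : 'M[rat]_(p, q)) = map_mx intr A :> 'M[R[i]]_(p, q).
    by apply/matrixP => i j; rewrite !mxE ratr_int.
  apply: (map_mx_inj (f := (ratr : {rmorphism rat -> R[i]}))).
  rewrite map_mxM /= !ratrE.
  rewrite TE mulmxA; apply/rowP => i; rewrite !mxE -sP.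
  apply: eq_bigr => k _; rewrite !mxE rmorphM; congr (_ * _).
  rewrite cE rmorph_sum; apply: eq_bigr => j _.
  by rewrite !mxE rmorphM rmorph_alg_rat.
exists (\row_i s i *m \adj T).
have cE' : (\det T)%:~R *: c = map_mx intr (\row_i s i *m \adj T).
  rewrite map_mxM cT -mulmxA -map_mxM mul_mx_adj /= map_scalar_mx.
  by rewrite mul_mx_scalar.
rewrite cE mulr_sumr; apply: eq_bigr => j _; rewrite mulrA; congr (_ * _).
move/rowP: cE' => /(_ j); rewrite !mxE => cE'.
by rewrite -[RHS]alg_int -cE' -alg_int -scalerAl mul1r scalerA.
Qed.
End Lattice.

(** * Indices of principal ideals *)

Lemma subgroup_scale (K : fieldExtType rat) (y : K) (A : set K) :
  add_subgroup A -> add_subgroup [set y * a | a in A].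
Proof. by apply: subgroup_image => a b; rewrite mulrBr. Qed.

Lemma has_index_scale (K : fieldExtType rat) (y : K) (A I : set K) m : y != 0 ->
  has_index A I m -> has_index [set y * a | a in A] [set y * a | a in I] m.
Proof.
move=> y_n0; apply: has_index_image; last exact: mulfI.
by move=> a b; rewrite mulrBr.
Qed.

Lemma scale_comp (K : fieldExtType rat) (x y : K) (A : set K) :
  [set x * a | a in [set y * a | a in A]] = [set x * y * a | a in A].
Proof.
by rewrite image_comp; congr (image _ _); apply/funext => a /=; rewrite mulrA.
Qed.

Lemma scaleS (K : fieldExtType rat) (x : K) (A B : set K) :
  A `<=` B -> [set x * a | a in A] `<=` [set x * a | a in B].
Proof. by move=> sAB; apply: image_subset. Qed.

Lemma scale_integer_sub (K : fieldExtType rat) (x : K) :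
  ring_of_integers x -> principal_ideal x `<=` @ring_of_integers K.
Proof. by move=> Ox _ [y Oy <-]; apply: integerM. Qed.

Section PrincipalIndex.
Variables (R : realType) (K : fieldExtType rat) (E : embeddings R K).
Local Notation n := (degree E).
Local Notation theta := (gene E).
Local Notation OK := (@ring_of_integers K).
Implicit Types x y : K.

Definition lattice_map (c : 'rV[int]_n) : K := \sum_j (c 0 j)%:~R * theta ^+ j.

Fact lattice_map_zmod : zmod_morphism lattice_map.
Proof.
move=> c d; rewrite /lattice_map -sumrB; apply: eq_bigr => j _.
by rewrite !mxE rmorphB /= mulrBl.
Qed.

Local Notation Lambda := (range lattice_map).

Lemma emb_lattice_map (k : 'I_n) c :
  emb k (lattice_map c) = (map_mx intr c *m emb_mx E) 0 k.
Proof.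
rewrite rmorph_sum mxE; apply: eq_bigr => j _.
by rewrite rmorphM rmorph_int !mxE.
Qed.

Lemma lattice_map_inj : injective lattice_map.
Proof.
move=> c1 c2 /eqP; rewrite -subr_eq0 -lattice_map_zmod => /eqP.
set c := c1 - c2 => c0; apply/eqP; rewrite -subr_eq0 -/c; apply/eqP/rowP => j.
have W_unit : emb_mx E \in unitmx by rewrite unitmxE unitfE det_emb_mx.
have : map_mx intr c = 0 :> 'rV[R[i]]_n.
  rewrite -[LHS](mulmxK W_unit) (_ : _ *m emb_mx E = 0) ?mul0mx //.
  apply/rowP => k; transitivity (emb k (lattice_map c)).
    exact/esym/emb_lattice_map.
  by rewrite c0 rmorph0 mxE.
by move=> /rowP/(_ j); rewrite !mxE => /eqP; rewrite intr_eq0 => /eqP.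
Qed.

Lemma lattice_integer : Lambda `<=` OK.
Proof.
move=> _ [c _ <-]; apply: integer_sum => j _.
by apply: integerM; [exact: integer_int|apply/integerX/gene_integer].
Qed.

Lemma lattice_group : add_subgroup Lambda.
Proof.
by apply: subgroup_image; first exact: lattice_map_zmod.
Qed.

(** For an integral [y] with [y Lambda] inside [Lambda], multiplication by [y]
    is given by an integral matrix of determinant [emb_norm E y]. *)
Lemma index_lattice_scale y : y != 0 ->
    (forall j : 'I_n, Lambda (y * theta ^+ j)) ->
  exists N : nat, has_index Lambda [set y * a | a in Lambda] N
    /\ N%:R = `|emb_norm E y|.
Proof.
move=> y_n0 yL.
have /choice[c cP] (i : 'I_n) : exists c, y * theta ^+ i = lattice_map c.
  by have [c _ <-] := yL i; exists c.
pose M := \matrix_(i < n) c i.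
have detM : (\det M)%:~R = emb_norm E y :> R[i].
  rewrite -det_map_mx; apply: (mul_matrix_emb _).1 => i k.
  rewrite cP rmorph_sum; apply: eq_bigr => j _.
  by rewrite !mxE rmorphM rmorph_int.
have detM_n0 : \det M != 0.
  rewrite -(intr_eq0 R[i]) detM; apply/prodf_neq0 => k _.
  by rewrite fmorph_eq0.
exists `|\det M|%N; split; last by rewrite -detM -intr_norm natr_absz.
have := has_index_image lattice_map_zmod lattice_map_inj (has_index_det detM_n0).
congr (has_index _ _ _).
rewrite !image_comp; apply: eq_imagel => d _ /=.
rewrite /lattice_map mulr_sumr.
under eq_bigr => j _ do rewrite mxE rmorph_sum mulr_suml.
rewrite exchange_big /=; apply: eq_bigr => i _.
rewrite mulrCA cP /lattice_map mulr_sumr; apply: eq_bigr => j _.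
by rewrite !mxE rmorphM mulrA.
Qed.

(** With [D O] inside [Lambda] and [Lambda] inside [O], the index of
    [D y Lambda] in [O] can be computed through [Lambda], as a determinant, and
    through [y O]. The contributions of [D] and of the index of [Lambda] are the
    same on both sides. *)
Theorem index_principal_ideal y : OK y -> y != 0 ->
  exists N : nat, has_index OK (principal_ideal y) N /\ N%:R = `|emb_norm E y|.
Proof.
move=> Oy y_n0.
have [d d_n0 dP] := integer_coordinates_bounded E.
have dK_n0 : d%:~R != 0 :> K.
  by rewrite intK_eq0.
have dL x : OK x -> Lambda (d%:~R * x).
  by move=> /dP[c ->]; exists c.
have OL (z : K) (j : 'I_n) : OK z -> Lambda (d%:~R * z * theta ^+ j).
  move=> Oz; rewrite -mulrA; apply/dL/integerM => //.
  by apply/integerX/gene_integer.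
pose D : K := d%:~R.
have gO := integer_group K; have gL := lattice_group.
have sDL x : OK x -> [set D * x * a | a in Lambda] `<=` [set D * x * a | a in OK].
  by move=> Ox; apply: scaleS; exact: lattice_integer.
have sDO : [set D * a | a in OK] `<=` Lambda by move=> _ [x Ox <-]; apply: dL.
have [N1 [N1idx N1E]] : exists N : nat, has_index Lambda [set D * a | a in Lambda] N
    /\ N%:R = `|emb_norm E D|.
  apply: index_lattice_scale => // j; rewrite -[D]mulr1.
  by apply: OL; exact: integer1.
have [N2 [N2idx N2E]] : exists N : nat,
    has_index Lambda [set D * y * a | a in Lambda] N
    /\ N%:R = `|emb_norm E (D * y)|.
  by apply: index_lattice_scale => [|j]; [rewrite mulf_neq0|exact: OL].
have [m [k [_ kidx _]]] := has_index_split gL (subgroup_scale D gO)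
  (subgroup_scale D gL) (scaleS (@lattice_integer)) sDO N1idx.
have {}kidx : has_index OK Lambda k.
  have := has_index_scale (invr_neq0 dK_n0) kidx.
  rewrite !scale_comp mulVf //; congr (has_index _ _ _);
    by rewrite -[RHS]image_id; congr (image _ _); apply/funext => a; rewrite mul1r.
have k_gt0 := has_index_gt0 (integer0 K) kidx.
have kN1 := has_index_trans lattice_integer gO gL
  (subset_trans (scaleS (@lattice_integer)) sDO) kidx N1idx.
have sL2 : [set D * y * a | a in Lambda] `<=` Lambda.
  move=> _ [a La <-]; rewrite -mulrA; apply/dL/integerM => //.
  exact: lattice_integer.
have kN2 := has_index_trans lattice_integer gO gL sL2 kidx N2idx.
have sL2' : [set D * y * a | a in Lambda] `<=` principal_ideal y.
  move=> _ [a La <-]; exists (D * a); last by ring.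
  by apply: integerM; [exact: integer_int|exact: lattice_integer].
have [N [N' [Nidx N'idx NE]]] := has_index_split gO (subgroup_scale y gO)
  (subgroup_scale (D * y) gL) sL2' (scale_integer_sub Oy) kN2.
have N'E : N' = (k * N1)%N.
  apply: (has_index_uniq (subgroup_scale (D * y) gL) N'idx).
  have := has_index_scale y_n0 kN1.
  by rewrite scale_comp mulrC.
exists N; split => //.
have {NE N'E} NE : N2 = (N * N1)%N.
  by apply/eqP; rewrite -(eqn_pmul2l k_gt0) NE N'E mulnCA.
have N1_n0 : N1%:R != 0 :> R[i].
  rewrite N1E normr_eq0; apply/prodf_neq0 => j _.
  by rewrite fmorph_eq0.
apply: (mulIf N1_n0); rewrite -natrM -NE N2E N1E -normrM mulrC; congr (`|_|).
by rewrite /emb_norm -big_split /=; apply: eq_bigr => j _; rewrite rmorphM.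
Qed.

End PrincipalIndex.

(** * Arithmetic of modules over the ring of integers *)

Section Modules.
Variable K : fieldExtType rat.
Local Notation OK := (@ring_of_integers K).
Implicit Types (a b c d : set K) (x y z : K).

Definition omodule a : Prop :=
  add_subgroup a /\ forall r x, OK r -> a x -> a (r * x).

Lemma omodule_integers : omodule OK.
Proof. by split; [exact: integer_group|move=> r x; exact: integerM]. Qed.

Lemma omodule_ideal a : is_ideal a -> omodule a.
Proof.
case=> sa a0 aD aM; split=> //; split=> // x y ax ay; apply: aD => //.
by rewrite -mulN1r; apply: aM => //; apply/integerN/integer1.
Qed.

Lemma ideal_omodule a : omodule a -> a `<=` OK -> is_ideal a.
Proof.
move=> [ga aM] sa; split=> //; first exact: ga.1.
by move=> x y; apply: subgroupD.
Qed.

Lemma is_ideal_integers : is_ideal OK.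
Proof. exact: ideal_omodule omodule_integers _. Qed.

Lemma nonzero_ideal_integers : nonzero_ideal OK.
Proof.
split; first exact: is_ideal_integers.
by exists 1; [exact: integer1|exact: oner_neq0].
Qed.

(** A product is the least set which contains [0] and the products of elements
    and is stable by addition, whence associativity for arbitrary sets. *)
Lemma ideal_mul_le a b c : c 0 -> (forall x y, c x -> c y -> c (x + y)) ->
  (forall x y, a x -> b y -> c (x * y)) -> ideal_mul a b `<=` c.
Proof.
move=> c0 cD cM _ [n [x [y [ax bn ->]]]].
by apply: big_ind => // i _; apply: cM.
Qed.

Lemma ideal_mul_le_omodule a b c : omodule c ->
  (forall x y, a x -> b y -> c (x * y)) -> ideal_mul a b `<=` c.
Proof.
move=> [gc _]; apply: ideal_mul_le; first exact: gc.1.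
by move=> x y; apply: subgroupD.
Qed.

Lemma mem_ideal_mul a b x y : a x -> b y -> ideal_mul a b (x * y).
Proof.
move=> ax bn; exists 1, (fun=> x), (fun=> y); split=> //.
by rewrite big_ord_recl big_ord0 addr0.
Qed.

Lemma ideal_mul0 a b : ideal_mul a b 0.
Proof.
by exists 0, (fun=> 0), (fun=> 0); split; [case|case|rewrite big_ord0].
Qed.

Lemma ideal_mulD a b x y :
  ideal_mul a b x -> ideal_mul a b y -> ideal_mul a b (x + y).
Proof.
move=> [m [u [v [au bv ->]]]] [n [u' [v' [au' bv' ->]]]].
pose cat (f : 'I_m -> K) (g : 'I_n -> K) i :=
  match fintype.split i with inl j => f j | inr j => g j end.
have catP f g d : (forall i, d (f i)) -> (forall i, d (g i)) ->
  forall i, d (cat f g i) by move=> df dg i; rewrite /cat; case: fintype.split.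
exists (m + n)%N, (cat u u'), (cat v v'); split; try exact: catP.
rewrite big_split_ord /=; congr (_ + _); apply: eq_bigr => i _; rewrite /cat.
  by rewrite -[lshift _ _]/(unsplit (inl i)) unsplitK.
by rewrite -[rshift _ _]/(unsplit (inr i)) unsplitK.
Qed.

Lemma ideal_mulS a b c d : a `<=` c -> b `<=` d -> ideal_mul a b `<=` ideal_mul c d.
Proof.
move=> sac sbd; apply: ideal_mul_le; [exact: ideal_mul0|exact: ideal_mulD|].
by move=> x y ax bn; apply: mem_ideal_mul; [exact: sac|exact: sbd].
Qed.

Lemma ideal_mulC : commutative (@ideal_mul K).
Proof.
suff sub a b : ideal_mul a b `<=` ideal_mul b a.
  by move=> a b; apply/seteqP; split.
apply: ideal_mul_le; [exact: ideal_mul0|exact: ideal_mulD|].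
by move=> x y ax bn; rewrite mulrC; apply: mem_ideal_mul.
Qed.

Lemma ideal_mulA : associative (@ideal_mul K).
Proof.
suff sub a b c : ideal_mul a (ideal_mul b c) `<=` ideal_mul (ideal_mul a b) c.
  move=> a b c; apply/seteqP; split=> //.
  rewrite (ideal_mulC _ c) (ideal_mulC a b) (ideal_mulC a) (ideal_mulC b c).
  exact: sub.
apply: ideal_mul_le; [exact: ideal_mul0|exact: ideal_mulD|] => x y ax.
have := @ideal_mul_le b c [set y | ideal_mul (ideal_mul a b) c (x * y)].
apply=> /=; first by rewrite mulr0; exact: ideal_mul0.
  by move=> u v; rewrite mulrDr; exact: ideal_mulD.
by move=> u v bu cv; rewrite mulrA; do 2?apply: mem_ideal_mul.
Qed.

Lemma ideal_mulCA a b c : ideal_mul a (ideal_mul b c) = ideal_mul b (ideal_mul a c).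
Proof. by rewrite !ideal_mulA (ideal_mulC a). Qed.

Lemma ideal_mulACA a b c d : ideal_mul (ideal_mul a b) (ideal_mul c d) =
  ideal_mul (ideal_mul a c) (ideal_mul b d).
Proof. by rewrite -!ideal_mulA (ideal_mulCA b). Qed.

Lemma omodule_mul a b : omodule a -> omodule (ideal_mul a b).
Proof.
move=> [ga aM].
have mulM r x : OK r -> ideal_mul a b x -> ideal_mul a b (r * x).
  move=> Or; have := @ideal_mul_le a b [set x | ideal_mul a b (r * x)].
  apply=> /=; first by rewrite mulr0; exact: ideal_mul0.
    by move=> u v; rewrite mulrDr; exact: ideal_mulD.
  by move=> u v au bv; rewrite mulrA; apply: mem_ideal_mul => //; apply: aM.
split=> //; split=> [|x y abx aby]; first exact: ideal_mul0.
apply: ideal_mulD => //; rewrite -mulN1r; apply: mulM => //.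
exact/integerN/integer1.
Qed.

Lemma ideal_mulr1 a : omodule a -> ideal_mul a OK = a.
Proof.
move=> oa; apply/seteqP; split.
  by apply: ideal_mul_le_omodule => // x y ax Oy; rewrite mulrC; apply: oa.2.
by move=> x ax; rewrite -[x]mulr1; apply: mem_ideal_mul => //; exact: integer1.
Qed.

Lemma ideal_mul1 a : omodule a -> ideal_mul OK a = a.
Proof. by rewrite ideal_mulC; apply: ideal_mulr1. Qed.

Lemma omodule_scale x a : omodule a -> omodule [set x * y | y in a].
Proof.
move=> [ga aM]; split; first exact: subgroup_scale.
by move=> r _ Or [y ay <-]; exists (r * y); [exact: aM|ring].
Qed.

Lemma omodule_principal x : omodule (principal_ideal x).
Proof. exact: omodule_scale omodule_integers. Qed.

Lemma mem_principal x : principal_ideal x x.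
Proof. by exists 1; [exact: integer1|rewrite mulr1]. Qed.

Lemma principal_mul x a : omodule a ->
  ideal_mul (principal_ideal x) a = [set x * y | y in a].
Proof.
move=> oa; apply/seteqP; split.
  apply: ideal_mul_le_omodule; first exact: omodule_scale.
  by move=> _ y [r Or <-] ay; exists (r * y); [exact: oa.2|ring].
by move=> _ [y ay <-]; apply: mem_ideal_mul => //; exact: mem_principal.
Qed.

Lemma principal1 : principal_ideal 1 = OK.
Proof.
apply/seteqP; split; first by move=> _ [r Or <-]; rewrite mul1r.
by move=> r Or; exists r; rewrite ?mul1r.
Qed.

Lemma principalM x y :
  ideal_mul (principal_ideal x) (principal_ideal y) = principal_ideal (x * y).
Proof. by rewrite principal_mul ?scale_comp //; exact: omodule_principal. Qed.

Lemma principal_ideal_ideal x : OK x -> is_ideal (principal_ideal x).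
Proof.
by move=> Ox; apply: ideal_omodule (omodule_principal x) _; exact: scale_integer_sub.
Qed.

Lemma omodule_inv b : omodule (ideal_inv b).
Proof.
split; first split.
- by move=> y _; rewrite mul0r; exact: integer0.
- by move=> x y bx bn z bz; rewrite mulrBl; apply: integerB; [exact: bx|exact: bn].
- by move=> r x Or bx z bz; rewrite -mulrA; apply: integerM => //; apply: bx.
Qed.

(** If [a b = O] then [ideal_inv a = ideal_inv a a b] is contained in [b]. *)
Lemma ideal_inv_unique a b : omodule b -> ideal_mul a b = OK -> ideal_inv a = b.
Proof.
move=> ob abE; apply/seteqP; split; last first.
  by move=> x bx y ay; rewrite -abE mulrC; apply: mem_ideal_mul.
have oi := omodule_inv a.
rewrite -[X in X `<=` _](ideal_mulr1 oi) -abE ideal_mulA.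
rewrite -[X in _ `<=` X](ideal_mul1 ob); apply: ideal_mulS => //.
by apply: ideal_mul_le_omodule => [|x y ix ay]; [exact: omodule_integers|exact: ix].
Qed.

Definition invertible a : Prop := omodule a /\ ideal_mul a (ideal_inv a) = OK.

Lemma invertible_of a b : omodule a -> omodule b -> ideal_mul a b = OK ->
  invertible a.
Proof. by move=> oa ob abE; split=> //; rewrite (ideal_inv_unique ob abE). Qed.

Lemma invertible_integers : invertible OK.
Proof.
have oO := omodule_integers.
by apply: (invertible_of oO oO); rewrite ideal_mul1.
Qed.

Lemma invertible_mul a b : invertible a -> invertible b -> invertible (ideal_mul a b).
Proof.
move=> [oa aE] [ob bE].
apply: (@invertible_of _ (ideal_mul (ideal_inv a) (ideal_inv b))).
- exact: omodule_mul.
- exact/omodule_mul/omodule_inv.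
- by rewrite ideal_mulACA aE bE ideal_mul1 //; exact: omodule_integers.
Qed.

Lemma ideal_inv_mul a b : invertible a -> invertible b ->
  ideal_inv (ideal_mul a b) = ideal_mul (ideal_inv a) (ideal_inv b).
Proof.
move=> [oa aE] [ob bE]; apply: ideal_inv_unique; first exact/omodule_mul/omodule_inv.
by rewrite ideal_mulACA aE bE ideal_mul1 //; exact: omodule_integers.
Qed.

Lemma invertible_inv a : invertible a -> invertible (ideal_inv a).
Proof.
by move=> [oa aE]; apply: (invertible_of (omodule_inv a) oa); rewrite ideal_mulC.
Qed.

Lemma ideal_inv1 : ideal_inv OK = OK.
Proof.
by apply: ideal_inv_unique; rewrite ?ideal_mul1 //; exact: omodule_integers.
Qed.

Lemma ideal_mulKV a b : invertible a -> omodule b ->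
  ideal_mul a (ideal_mul (ideal_inv a) b) = b.
Proof. by move=> [oa aE] ob; rewrite ideal_mulA aE ideal_mul1. Qed.

Lemma ideal_mulVK a b : invertible a -> omodule b ->
  ideal_mul (ideal_inv a) (ideal_mul a b) = b.
Proof.
by move=> [oa aE] ob; rewrite ideal_mulA (ideal_mulC (ideal_inv a)) aE ideal_mul1.
Qed.

Lemma ideal_mul_cancel a b c : invertible a -> omodule b -> omodule c ->
  ideal_mul a b = ideal_mul a c -> b = c.
Proof.
by move=> ia ob oc abE; rewrite -(ideal_mulVK ia ob) abE ideal_mulVK.
Qed.

Lemma invertible_principal x : x != 0 -> invertible (principal_ideal x).
Proof.
move=> x_n0; apply: (invertible_of (omodule_principal x) (omodule_principal x^-1)).
by rewrite principalM divff // principal1.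
Qed.

(** To contain is to divide: the quotient is [ideal_inv a b]. *)
Lemma invertible_dvd a b : invertible a -> is_ideal b -> b `<=` a -> ideal_dvd a b.
Proof.
move=> ia idb sba; have ob := omodule_ideal idb.
exists (ideal_mul (ideal_inv a) b); last by rewrite ideal_mulKV.
apply: ideal_omodule; first exact/omodule_mul/omodule_inv.
have [_ <-] := ia; rewrite ideal_mulC; exact: ideal_mulS.
Qed.

Lemma dvd_sub a b : omodule a -> ideal_dvd a b -> b `<=` a.
Proof.
move=> oa [d [sd _ _ _] ->]; rewrite -[X in _ `<=` X](ideal_mulr1 oa).
exact: ideal_mulS.
Qed.

(** ** Finite generation and finite index *)

Definition finitely_generated a : Prop :=
  exists (T : finType) (g : T -> K), (forall t, a (g t)) /\
    forall y, a y -> exists c : T -> int, y = \sum_t (c t)%:~R * g t.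

(** Multiplication by [z] acts on a finite family of generators by an integral
    matrix. *)
Lemma integer_of_stable_module a z x : finitely_generated a ->
  a x -> x != 0 -> (forall y, a y -> a (z * y)) -> OK z.
Proof.
move=> [T [g [ag a_gen]]] ax x_n0 az.
have /choice[c cP] t := a_gen _ (az _ (ag t)).
pose A := \matrix_(i < #|T|, j < #|T|) c (enum_val j) (enum_val i).
apply: (@integer_of_stable _ _ (\row_i g (enum_val i)) A).
  apply: contraNneq x_n0 => /rowP g0; have [e ->] := a_gen _ ax.
  rewrite big1 // => t _.
  by have := g0 (enum_rank t); rewrite !mxE enum_rankK => ->; rewrite mulr0.
apply/rowP => j; rewrite !mxE cP (reindex (@enum_val T T)) /=; last first.
  exact/onW_bij/enum_val_bij.
by apply: eq_bigr => i _; rewrite !mxE mulrC.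
Qed.

Lemma finitely_generated_extend a b N : add_subgroup a -> b `<=` a ->
  has_index a b N -> finitely_generated b -> finitely_generated a.
Proof.
move=> ga sba [T [r [_ ar _ r_cov]]] [S [g [bg b_gen]]].
exists (T + S)%type, (fun p => match p with inl t => r t | inr s => g s end).
split=> [[t|s]|y /r_cov[t /b_gen[c cE]]]; [exact: ar|exact/sba/bg|].
exists (fun p => match p with inl u => (u == t)%:Z | inr s => c s end).
rewrite big_sumType /= -cE (bigD1 t) //= eqxx mul1r big1 ?addr0 1?addrC ?subrK //.
by move=> u /negPf->; rewrite mul0r.
Qed.

(** The statement involves no real numbers: any field of real numbers can be used
    to speak of embeddings. *)
Lemma principal_index y : OK y -> y != 0 ->
  exists N, has_index OK (principal_ideal y) N.
Proof.
have [E] := embeddings_exist Rdefinitions.R K.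
by move=> Oy y_n0; have [N [NP _]] := index_principal_ideal E Oy y_n0; exists N.
Qed.

Lemma integers_finitely_generated : finitely_generated OK.
Proof.
have [E] := embeddings_exist Rdefinitions.R K.
have [d d_n0 dP] := integer_coordinates_bounded E.
have dK_n0 : d%:~R != 0 :> K by rewrite intK_eq0.
have [N NP] := principal_index (integer_int K d) dK_n0.
have sdL : principal_ideal d%:~R `<=` range (lattice_map (E := E)).
  by move=> _ [x Ox <-]; have [c ->] := dP _ Ox; exists c.
have [m mP] := has_index_upper (lattice_group E) sdL NP.
apply: (finitely_generated_extend (integer_group K) (@lattice_integer _ _ E) mP).
exists 'I_(degree E), (fun j : 'I_(degree E) => gene E ^+ j).
split=> [j|_ [c _ <-]]; last by exists (c 0).
exists (delta_mx 0 j) => //; rewrite /lattice_map (bigD1 j) //= mxE !eqxx mul1r.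
by rewrite big1 ?addr0 // => i ne_ij; rewrite mxE eqxx (negPf ne_ij) mul0r.
Qed.

Lemma ideal_index a : nonzero_ideal a -> exists N, has_index OK a N.
Proof.
move=> [ida [x ax x_n0]]; have oa := omodule_ideal ida; case: ida => sa _ _ aM.
have [N NP] := principal_index (sa _ ax) x_n0.
apply: has_index_upper oa.1 _ NP => _ [r Or <-]; rewrite mulrC; exact: aM.
Qed.

Lemma ideal_finitely_generated a : nonzero_ideal a -> finitely_generated a.
Proof.
move=> [ida [x ax x_n0]]; have oa := omodule_ideal ida; case: ida => sa _ _ aM.
have [N NP] := principal_index (sa _ ax) x_n0.
have sxa : principal_ideal x `<=` a.
  by move=> _ [r Or <-]; rewrite mulrC; exact: aM.
have [m mP] := has_index_lower (omodule_principal x).1 oa.1 sa NP.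
apply: finitely_generated_extend oa.1 sxa mP _.
have [T [g [Og O_gen]]] := integers_finitely_generated.
exists T, (fun t => x * g t); split=> [t|_ [y /O_gen[c ->] <-]]; first by exists (g t).
by exists c; rewrite mulr_sumr; apply: eq_bigr => t _; rewrite mulrCA.
Qed.

Lemma index_proper a b m n : is_ideal a -> is_ideal b -> a `<=` b -> ~ b `<=` a ->
  has_index OK a m -> has_index OK b n -> (n < m)%N.
Proof.
move=> ida idb sab nsba mP nP.
have [ga gb] := ((omodule_ideal ida).1, (omodule_ideal idb).1).
have [sb _ _ _] := idb; have gO := integer_group K.
have [n' [k [n'P kP ->]]] := has_index_split gO gb ga sab sb mP.
rewrite -(has_index_uniq gb nP n'P).
have n_gt0 := has_index_gt0 gO.1 nP; have k_gt0 := has_index_gt0 gb.1 kP.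
rewrite ltn_Pmulr // ltn_neqAle k_gt0 andbT.
by apply/eqP => k1; rewrite -k1 in kP; apply/nsba/(has_index1 ga kP)/gb.1.
Qed.

End Modules.

(** * Unique factorization of ideals *)

Section Primes.
Variable K : fieldExtType rat.
Local Notation OK := (@ring_of_integers K).
Implicit Types (a b c d P Q : set K) (x y z : K) (s : seq (set K)).

Definition ideal_prod s : set K := foldr (@ideal_mul K) OK s.

Definition all_prime s : Prop := forall P, P \in s -> prime_ideal P.

Lemma omodule_prod s : omodule (ideal_prod s).
Proof.
by elim: s => [|P s IHs] /=; [exact: omodule_integers|rewrite ideal_mulC; exact: omodule_mul].
Qed.

Lemma ideal_prod_cat s1 s2 :
  ideal_prod (s1 ++ s2) = ideal_mul (ideal_prod s1) (ideal_prod s2).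
Proof.
elim: s1 => [|P s1 IHs] /=; last by rewrite IHs ideal_mulA.
by rewrite ideal_mul1 //; exact: omodule_prod.
Qed.

Lemma ideal_prod_rem P s : P \in s ->
  ideal_prod s = ideal_mul P (ideal_prod (rem P s)).
Proof.
elim: s => //= Q s IHs; rewrite inE eq_sym.
by case: eqVneq => [->|_ /= /IHs ->] //=; rewrite ideal_mulCA.
Qed.

Lemma all_prime_rem P s : all_prime s -> all_prime (rem P s).
Proof. by move=> ps Q /mem_rem/ps. Qed.

Lemma all_prime_cat s1 s2 : all_prime s1 -> all_prime s2 -> all_prime (s1 ++ s2).
Proof. by move=> p1 p2 P; rewrite mem_cat => /orP[/p1|/p2]. Qed.

Lemma all_prime_cons P s : prime_ideal P -> all_prime s -> all_prime (P :: s).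
Proof. by move=> pP ps Q; rewrite inE => /predU1P[->|/ps]. Qed.

Lemma prime_is_ideal P : prime_ideal P -> is_ideal P.
Proof. by case=> -[]. Qed.

Lemma prime_omodule P : prime_ideal P -> omodule P.
Proof. by move=> /prime_is_ideal/omodule_ideal. Qed.

Lemma ideal1 a : is_ideal a -> a 1 -> a = OK.
Proof.
move=> [sa _ _ aM] a1; apply/seteqP; split=> // r Or.
by rewrite -[r]mulr1; apply: aM.
Qed.

(** Multiplication by [x] is injective on the finite set of cosets of [P],
    hence surjective. *)
Lemma prime_inverse P x : prime_ideal P -> OK x -> ~ P x ->
  exists2 y, OK y & P (x * y - 1).
Proof.
move=> pP Ox nPx; have [nzP _ P_prime] := pP.
have [gP PM] := prime_omodule pP.
have [N [T [r [_ Or r_inj r_cov]]]] := ideal_index nzP.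
have /choice[f fP] t := r_cov _ (integerM Ox (Or t)).
have f_inj : injective f.
  move=> s t fst; apply: r_inj.
  have : P (x * (r s - r t)).
    rewrite mulrBr; apply: (subgroup_sub_trans gP (fP s)); rewrite fst.
    exact: subgroup_subC gP (fP t).
  by case/P_prime => //; apply: integerB.
have [t Pt] := r_cov _ (integer1 K).
have [g _ gK] := injF_bij f_inj.
exists (r (g t)) => //; have := fP (g t); rewrite gK => Pg.
exact: subgroup_sub_trans Pg (subgroup_subC gP Pt).
Qed.

Lemma prime_maximal P a : prime_ideal P -> is_ideal a -> P `<=` a -> ~ a 1 -> a = P.
Proof.
move=> pP ida sPa na1; apply/seteqP; split=> // x ax; apply: contrapT => nPx.
have [sa _ _ aM] := ida; have [ga _] := omodule_ideal ida.
have [y Oy Pxy] := prime_inverse pP (sa _ ax) nPx.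
apply: na1; rewrite -[1](subKr (x * y)); apply: ga.2; last exact: sPa.
by rewrite mulrC; apply: aM.
Qed.

Lemma prime_eq P Q : prime_ideal P -> prime_ideal Q -> Q `<=` P -> Q = P.
Proof.
move=> pP pQ sQP; have [_ nP1 _] := pP.
exact/esym/(prime_maximal pQ (prime_is_ideal pP)).
Qed.

Lemma prime_mul_sub P a b : prime_ideal P -> a `<=` OK -> b `<=` OK ->
  ideal_mul a b `<=` P -> a `<=` P \/ b `<=` P.
Proof.
move=> [_ _ P_prime] sa sb sabP.
have [|/existsNP[x /not_implyP[ax nPx]]] := pselect (a `<=` P); first by left.
right=> y bn; have : P (x * y) by apply/sabP/mem_ideal_mul.
by case/(P_prime _ _ (sa _ ax) (sb _ bn)).
Qed.

Lemma prod_integers s : all_prime s -> ideal_prod s `<=` OK.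
Proof.
elim: s => [_|P s IHs ps] /=; first exact: subset_refl.
apply: ideal_mul_le_omodule; first exact: omodule_integers.
move=> x y Px sy; apply: integerM.
  by have [sP _ _ _] := prime_is_ideal (ps P (mem_head _ _)); exact: sP.
by apply: IHs sy => Q Qs; apply: ps; rewrite inE Qs orbT.
Qed.

Lemma is_ideal_prod s : all_prime s -> is_ideal (ideal_prod s).
Proof. by move=> ps; apply: ideal_omodule (omodule_prod s) (prod_integers ps). Qed.

Lemma prime_prod_sub P s : prime_ideal P -> all_prime s ->
  ideal_prod s `<=` P -> P \in s.
Proof.
move=> pP; elim: s => [|Q s IHs] ps /=.
  by have [_ nP1 _] := pP => /(_ 1 (integer1 K)).
have pQ := ps Q (mem_head _ _).
have {}ps : all_prime s by move=> M Ms; apply: ps; rewrite inE Ms orbT.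
have [sQ _ _ _] := prime_is_ideal pQ.
case/(prime_mul_sub pP sQ (prod_integers ps)) => [sQP|/(IHs ps)].
  by rewrite inE (prime_eq pP pQ sQP) eqxx.
by rewrite inE orbC => ->.
Qed.

(** ** Ideals and their indices *)

Definition ideal_adjoin a x : set K := [set y | exists2 r, OK r & a (y - r * x)].

Lemma ideal_adjoinP a x : nonzero_ideal a -> OK x ->
  [/\ nonzero_ideal (ideal_adjoin a x), a `<=` ideal_adjoin a x
    & ideal_adjoin a x x].
Proof.
move=> [ida [u au u_n0]] Ox; have [ga aM] := omodule_ideal ida.
have [sa _ _ _] := ida.
have sub : a `<=` ideal_adjoin a x.
  by move=> y ay; exists 0; [exact: integer0|rewrite mul0r subr0].
split=> //; last first.
  by exists 1; [exact: integer1|rewrite mul1r subrr; exact: ga.1].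
split; last by exists u => //; exact: sub.
apply: ideal_omodule; last first.
  move=> y [r Or /sa ay]; rewrite -[y](subrK (r * x)).
  by apply: integerD => //; apply: integerM.
split; first split; first exact/sub/ga.1.
  move=> y z [r Or ay] [t Ot az]; exists (r - t); first exact: integerB.
  rewrite (_ : _ - _ = (y - r * x) - (z - t * x)); first exact: ga.2.
  by ring.
move=> t y Ot [r Or ay]; exists (t * r); first exact: integerM.
by rewrite -mulrA -mulrBr; apply: aM.
Qed.

Lemma nonzero_sub a b : nonzero_ideal a -> is_ideal b -> a `<=` b -> nonzero_ideal b.
Proof. by move=> [_ [x ax x_n0]] idb sab; split=> //; exists x => //; exact: sab. Qed.

(** Noetherian induction, in the form of an induction on the index. *)
Lemma ideal_ind (S : set K -> Prop) :
  (forall a, nonzero_ideal a -> (forall b, nonzero_ideal b -> a `<=` b ->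
     ~ b `<=` a -> S b) -> S a) ->
  forall a, nonzero_ideal a -> S a.
Proof.
move=> IH a nza; have [N NP] := ideal_index nza.
elim/ltn_ind: N a nza NP => N IHN a nza NP.
apply: IH => // b nzb sab nsba; have [M MP] := ideal_index nzb.
exact: (IHN M (index_proper nza.1 nzb.1 sab nsba NP MP)).
Qed.

Lemma not_prime_ideal a : nonzero_ideal a -> ~ a 1 -> ~ prime_ideal a ->
  exists x y, [/\ OK x, OK y, a (x * y), ~ a x & ~ a y].
Proof.
move=> nza na1 npa; apply: contrapT => nex; apply: npa; split=> // x y Ox Oy axy.
apply: contrapT => /not_orP[nax nay]; apply: nex.
by exists x, y.
Qed.

(** If a proper ideal [a] is not prime, say [x y] is in [a] while [x] and [y] are
    not, then [a + (x)] is still proper: from [1 = c + r x] with [c] in [a] one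
    gets [y = c y + r (x y)] in [a]. *)
Lemma prime_above a : nonzero_ideal a -> ~ a 1 ->
  exists2 P, prime_ideal P & a `<=` P.
Proof.
move: a; apply: ideal_ind => a nza IHa na1.
have [pa|npa] := pselect (prime_ideal a); first by exists a.
have [x [y [Ox Oy axy nax nay]]] := not_prime_ideal nza na1 npa.
have [nzx sax xx] := ideal_adjoinP nza Ox.
have [[r Or a1]|nx1] := pselect (ideal_adjoin a x 1).
  case: nay; have [ga aM] := omodule_ideal nza.1.
  rewrite (_ : y = y * (1 - r * x) + r * (x * y)); last by ring.
  by apply: subgroupD => //; apply: aM.
have [P pP sP] : exists2 P, prime_ideal P & ideal_adjoin a x `<=` P.
  by apply: IHa => // sxa; apply/nax/sxa.
by exists P => //; apply: subset_trans sP.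
Qed.

(** If [x y] is in [a] then [a] contains the product of [a + (x)] and
    [a + (y)]. *)
Lemma contains_prime_prod a : nonzero_ideal a ->
  exists2 s, all_prime s & ideal_prod s `<=` a.
Proof.
move: a; apply: ideal_ind => a nza IHa.
have [a1|na1] := pselect (a 1).
  by exists [::] => //=; rewrite -(ideal1 nza.1 a1).
have [pa|npa] := pselect (prime_ideal a).
  exists [:: a]; first by move=> P; rewrite inE => /eqP->.
  by rewrite /= ideal_mulr1 //; exact: prime_omodule.
have [x [y [Ox Oy axy nax nay]]] := not_prime_ideal nza na1 npa.
have [nzx sax xx] := ideal_adjoinP nza Ox.
have [nzy say yy] := ideal_adjoinP nza Oy.
have [s1 p1 s1x] := IHa _ nzx sax (fun sxa => nax (sxa _ xx)).
have [s2 p2 s2y] := IHa _ nzy say (fun sya => nay (sya _ yy)).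
exists (s1 ++ s2); first exact: all_prime_cat.
rewrite ideal_prod_cat; apply: subset_trans (ideal_mulS s1x s2y) _.
have [ga aM] := omodule_ideal nza.1; have [sa _ _ _] := nza.1.
apply: ideal_mul_le_omodule; first exact: omodule_ideal nza.1.
move=> u v [r Or au] [t Ot av].
rewrite (_ : u * v = v * (u - r * x) + (r * x) * (v - t * y) + (r * t) * (x * y)).
  apply: subgroupD => //; last by apply: aM => //; apply: integerM.
  apply: subgroupD => //; apply: aM => //; last exact: integerM.
  rewrite -[v](subrK (t * y)); apply: integerD; first exact: sa.
  exact: integerM.
by ring.
Qed.

(** ** Invertibility *)

(** A minimal product of primes inside a principal ideal [(x)] of [P] contains
    [P] as a factor; removing that factor leaves some [b] outside [(x)], and
    [b / x] works. *)
Lemma prime_inv_nontrivial P : prime_ideal P -> exists2 z, ideal_inv P z & ~ OK z.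
Proof.
move=> pP; have [[idP [x Px x_n0]] nP1 _] := pP; have [sP _ _ PM] := idP.
have Ox := sP _ Px.
have nzx : nonzero_ideal (principal_ideal x).
  by split; [exact: principal_ideal_ideal|exists x => //; exact: mem_principal].
pose has_prod n := `[< exists s, [/\ size s = n, all_prime s
  & ideal_prod s `<=` principal_ideal x] >].
have ex_prod : exists n, has_prod n.
  have [s ps sx] := contains_prime_prod nzx.
  by exists (size s); apply/asboolP; exists s.
case: (ex_minnP ex_prod) => n /asboolP[s [sz ps sx]] n_min.
have sxP : principal_ideal x `<=` P by move=> _ [r Or <-]; rewrite mulrC; apply: PM.
have Ps := prime_prod_sub pP ps (subset_trans sx sxP).
have : ~ ideal_prod (rem P s) `<=` principal_ideal x.
  move=> sx'; suff : (n <= n.-1)%N by rewrite -sz; case: (s) Ps => // ? ?; rewrite /= ltnn.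
  apply: n_min; apply/asboolP; exists (rem P s); split=> //.
    by rewrite size_rem // sz.
  exact: all_prime_rem.
move=> /existsNP[b /not_implyP[sb nxb]]; exists (b / x).
  move=> y Py; have : principal_ideal x (y * b).
    by apply: sx; rewrite (ideal_prod_rem Ps); apply: mem_ideal_mul.
  case=> r Or rE; rewrite mulrAC [b * y]mulrC -rE mulrAC divff // mul1r //.
move=> Ob; apply: nxb; exists (b / x) => //.
by rewrite mulrC divfK.
Qed.

(** By maximality [P (ideal_inv P)] is [P] or the whole ring. In the first case
    every element of [ideal_inv P] would stabilize [P], hence be integral. *)
Lemma invertible_prime P : prime_ideal P -> invertible P.
Proof.
move=> pP; have oP := prime_omodule pP; split=> //.
have [nzP nP1 _] := pP; have [sP _ _ PM] := nzP.1.
have idJ : is_ideal (ideal_mul P (ideal_inv P)).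
  apply: ideal_omodule; first exact: omodule_mul.
  apply: ideal_mul_le_omodule; first exact: omodule_integers.
  by move=> x y Px /(_ x Px); rewrite mulrC.
have sPJ : P `<=` ideal_mul P (ideal_inv P).
  move=> x Px; rewrite -[x]mulr1; apply: mem_ideal_mul => // y Py.
  by rewrite mul1r; apply: sP.
have [/(ideal1 idJ)//|nJ1] := pselect (ideal_mul P (ideal_inv P) 1).
have JP := prime_maximal pP idJ sPJ nJ1.
have [z Pz []] := prime_inv_nontrivial pP.
have [_ [x Px x_n0]] := nzP.
apply: (integer_of_stable_module (ideal_finitely_generated nzP) Px x_n0).
by move=> y Py; rewrite -JP mulrC; apply: mem_ideal_mul.
Qed.

(** Dividing [a] by a prime which contains it enlarges it, strictly because a
    non-integral element of [ideal_inv P] cannot stabilize [a]. *)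
Lemma ideal_factorization a : nonzero_ideal a ->
  exists2 s, all_prime s & a = ideal_prod s.
Proof.
move: a; apply: ideal_ind => a nza IHa; have oa := omodule_ideal nza.1.
have [/(ideal1 nza.1)->|na1] := pselect (a 1); first by exists [::].
have [P pP saP] := prime_above nza na1; have iP := invertible_prime pP.
pose b := ideal_mul (ideal_inv P) a.
have ob : omodule b by apply/omodule_mul/omodule_inv.
have sab : a `<=` b.
  rewrite -[X in X `<=` _](ideal_mul1 oa); apply: ideal_mulS => // r Or y Py.
  have [sP _ _ _] := prime_is_ideal pP.
  by apply: integerM => //; apply: sP.
have idb : is_ideal b.
  by apply: ideal_omodule ob _; rewrite -iP.2 ideal_mulC; apply: ideal_mulS.
have [|s ps bE] := IHa b (nonzero_sub nza idb sab) sab.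
  move=> sba; have [z Pz []] := prime_inv_nontrivial pP.
  have [_ [x ax x_n0]] := nza.
  apply: (integer_of_stable_module (ideal_finitely_generated nza) ax x_n0).
  by move=> y ay; apply/sba/mem_ideal_mul.
exists (P :: s); first exact: all_prime_cons.
by rewrite /= -bE ideal_mulKV.
Qed.

Lemma invertible_prod s : all_prime s -> invertible (ideal_prod s).
Proof.
elim: s => [|P s IHs] ps /=; first exact: invertible_integers.
apply: invertible_mul; first by apply/invertible_prime/ps; exact: mem_head.
by apply: IHs => Q Qs; apply: ps; rewrite inE Qs orbT.
Qed.

Lemma invertible_ideal a : nonzero_ideal a -> invertible a.
Proof. by move=> /ideal_factorization[s ps ->]; apply: invertible_prod. Qed.

Lemma invertible_nonzero a : invertible a -> exists2 x, a x & x != 0.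
Proof.
move=> [oa aE]; apply: contrapT => nex.
have a0 x : a x -> x = 0.
  by move=> ax; apply/eqP/negPn/negP => x_n0; apply: nex; exists x.
have : ideal_mul a (ideal_inv a) 1 by rewrite aE; exact: integer1.
move=> [n [x [y [ax _ /eqP]]]]; rewrite big1 ?oner_eq0 // => i _.
by rewrite (a0 _ (ax i)) mul0r.
Qed.

Lemma nonzero_prod s : all_prime s -> nonzero_ideal (ideal_prod s).
Proof.
move=> ps; split; first exact: is_ideal_prod.
exact/invertible_nonzero/invertible_prod.
Qed.

Lemma prime_dvd P a : prime_ideal P -> is_ideal a -> ideal_dvd P a <-> a `<=` P.
Proof.
move=> pP ida; split=> [dPa|sa]; first exact: dvd_sub (prime_omodule pP) dPa.
exact: invertible_dvd (invertible_prime pP) ida sa.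
Qed.

(** ** The norm *)

Lemma ideal_normE a N : omodule a -> has_index OK a N -> ideal_norm a = N.
Proof.
move=> [ga _] [T [r [<- Or r_inj r_cov]]].
have cosetE x y : a (x - y) -> ideal_coset a x = ideal_coset a y.
  move=> axy; apply/seteqP; split=> _ [u au <-].
    by exists (x - y + u); [exact: subgroupD|rewrite addrA [y + _]addrC subrK].
  exists (y - x + u); last by rewrite addrA [x + _]addrC subrK.
  by apply: subgroupD => //; apply: subgroup_subC.
have coset_mem x : ideal_coset a x x by exists 0; [exact: ga.1|rewrite addr0].
have coset_inj : injective (ideal_coset a \o r).
  move=> s t st; apply: r_inj; have : ideal_coset a (r t) (r s).
    by rewrite -[ideal_coset a (r t)]st; exact: coset_mem.
  by move=> [u au <-]; rewrite addrAC subrr add0r.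
pose S := [fset (ideal_coset a \o r) t | t in T]%fset.
rewrite /ideal_norm (_ : image _ _ = [set` S]).
  by rewrite set_fsetK card_imfset //= -cardE.
apply/seteqP; split=> [_ [x /r_cov[t at_] <-]|_ /= /imfsetP[t _ ->]].
  by apply/imfsetP; exists t => //; exact: cosetE.
by exists (r t).
Qed.

Lemma ideal_index_norm a : nonzero_ideal a -> has_index OK a (ideal_norm a).
Proof.
move=> nza; have [N NP] := ideal_index nza.
by rewrite (ideal_normE (omodule_ideal nza.1) NP).
Qed.

(** The quotient of [a] by [P a] is a one-dimensional vector space over the
    residue field of [P]. *)
Lemma index_prime_mul P a : prime_ideal P -> nonzero_ideal a ->
  has_index a (ideal_mul P a) (ideal_norm P).
Proof.
move=> pP nza; have ia := invertible_ideal nza; have iP := invertible_prime pP.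
have [nzP nP1 _] := pP; have [oP oa] := (prime_omodule pP, omodule_ideal nza.1).
have [sP _ _ _] := nzP.1.
have oPa : omodule (ideal_mul P a) by apply: omodule_mul.
have sPa : ideal_mul P a `<=` a.
  rewrite -[X in _ `<=` X](ideal_mul1 oa); exact: ideal_mulS.
have [x ax nPx] : exists2 x, a x & ~ ideal_mul P a x.
  apply: contrapT => nex; apply: nP1.
  suff -> : P = OK by exact: integer1.
  apply: (ideal_mul_cancel ia oP (omodule_integers K)).
  rewrite ideal_mulr1 // ideal_mulC; apply/seteqP; split=> // x ax.
  by apply: contrapT => nPx; apply: nex; exists x.
pose I := [set r | OK r /\ ideal_mul P a (r * x)].
have IE : I = P.
  apply: prime_maximal => //.
  - apply: ideal_omodule; last by move=> r [].
    split; first split; first by split; [exact: integer0|rewrite mul0r; exact: oPa.1.1].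
      move=> r t [Or Pr] [Ot Pt]; split; first exact: integerB.
      by rewrite mulrBl; apply: oPa.1.2.
    move=> r t Or [Ot Pt]; split; first exact: integerM.
    by rewrite -mulrA; apply: oPa.2.
  - by move=> r Pr; split; [exact: sP|exact: mem_ideal_mul].
  - by move=> [_]; rewrite mul1r.
(* [b = (x) + P a] is strictly larger than [P a]; divided by [a] it becomes an
   ideal strictly larger than [P], hence the whole ring *)
pose b := [set y | exists2 r, OK r & ideal_mul P a (y - r * x)].
have ob : omodule b.
  split; first split.
  - by exists 0; [exact: integer0|rewrite mul0r subrr; exact: oPa.1.1].
  - move=> y z [r Or ay] [t Ot az]; exists (r - t); first exact: integerB.
    rewrite (_ : _ - _ = (y - r * x) - (z - t * x)); first exact: oPa.1.2.
    by ring.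
  - move=> t y Ot [r Or ay]; exists (t * r); first exact: integerM.
    by rewrite -mulrA -mulrBr; apply: oPa.2.
have sPb : ideal_mul P a `<=` b.
  by move=> y Py; exists 0; [exact: integer0|rewrite mul0r subr0].
have sba : b `<=` a.
  move=> y [r Or Py]; rewrite -[y](subrK (r * x)); apply: subgroupD oa.1 _ _.
    exact: sPa.
  exact: oa.2.
have bx : b x by exists 1; [exact: integer1|rewrite mul1r subrr; exact: oPa.1.1].
have ba : b = a.
  pose c := ideal_mul (ideal_inv a) b.
  have oc : omodule c by apply/omodule_mul/omodule_inv.
  suff cE : c = OK by rewrite -(ideal_mulKV ia ob) -/c cE ideal_mulr1.
  have idc : is_ideal c.
    apply: ideal_omodule oc _; have [_ <-] := ia; rewrite ideal_mulC.
    by apply: ideal_mulS.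
  have sPc : P `<=` c.
    rewrite -[X in X `<=` _](ideal_mulVK ia oP) [ideal_mul a P]ideal_mulC.
    exact: ideal_mulS.
  have [/(ideal1 idc)//|nc1] := pselect (c 1).
  case: nPx; rewrite -(prime_maximal pP idc sPc nc1) /c ideal_mulC.
  by rewrite ideal_mulKV.
have [T [r [cT Or r_inj r_cov]]] := ideal_index_norm nzP.
exists T, (fun t => r t * x); split=> //.
- by move=> t; apply: oa.2.
- move=> s t; rewrite -mulrBl => Pst; apply: r_inj.
  suff : I (r s - r t) by rewrite IE.
  by split=> //; apply: integerB.
- move=> y ay; have [u /r_cov[t Pt] Py] : b y by rewrite ba.
  exists t.
  apply: (subgroup_sub_trans oPa.1 Py); rewrite -mulrBl.
  have : I (u - r t) by rewrite IE.
  by case.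
Qed.

Lemma norm_prime_mul P a : prime_ideal P -> nonzero_ideal a ->
  ideal_norm (ideal_mul P a) = (ideal_norm P * ideal_norm a)%N.
Proof.
move=> pP nza; have [nzP _ _] := pP.
have oPa := omodule_mul a (prime_omodule pP).
have [sP _ _ _] := nzP.1; have [sa _ _ _] := nza.1.
have oa := omodule_ideal nza.1.
apply: ideal_normE => //; rewrite mulnC.
apply: (has_index_trans sa (integer_group K) oa.1 _ (ideal_index_norm nza)).
  rewrite -[X in _ `<=` X](ideal_mul1 oa); exact: ideal_mulS.
exact: index_prime_mul.
Qed.

Lemma norm_integers : ideal_norm OK = 1%N.
Proof.
exact: ideal_normE (omodule_integers K) (has_index_self (integer_group K)).
Qed.

Lemma norm_prod s : all_prime s ->
  ideal_norm (ideal_prod s) = (\prod_(P <- s) ideal_norm P)%N.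
Proof.
elim: s => [|P s IHs] ps /=; first by rewrite big_nil norm_integers.
have ps' : all_prime s.
  by move=> Q Qs; apply: ps; rewrite inE Qs orbT.
rewrite big_cons norm_prime_mul ?IHs //; first by apply: ps; exact: mem_head.
exact: nonzero_prod.
Qed.

Lemma norm_prime_gt1 P : prime_ideal P -> (1 < ideal_norm P)%N.
Proof.
move=> pP; have [nzP nP1 _] := pP; have NP := ideal_index_norm nzP.
have gP := (prime_omodule pP).1.
rewrite ltn_neqAle (has_index_gt0 (integer0 K) NP) andbT.
apply/eqP => N1; rewrite -N1 in NP.
exact/nP1/(has_index1 gP NP (integer0 K))/integer1.
Qed.

End Primes.

(** * Valuations *)

Section Valuations.
Variable K : fieldExtType rat.
Local Notation OK := (@ring_of_integers K).
Implicit Types (a b c d P Q : set K) (x y z : K) (r s : seq (set K)).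

Lemma ideal_prod_nseq P n : ideal_prod (nseq n P) = ideal_expn P n.
Proof. by elim: n => //= n ->. Qed.

Lemma all_prime_nseq P n : prime_ideal P -> all_prime (nseq n P).
Proof. by move=> pP Q; rewrite mem_nseq => /andP[_ /eqP->]. Qed.

Lemma ideal_expnD P m n : prime_ideal P ->
  ideal_mul (ideal_expn P m) (ideal_expn P n) = ideal_expn P (m + n)%N.
Proof. by move=> pP; rewrite -!ideal_prod_nseq -ideal_prod_cat -nseqD. Qed.

Lemma invertible_expn P n : prime_ideal P -> invertible (ideal_expn P n).
Proof. by move=> pP; rewrite -ideal_prod_nseq; apply/invertible_prod/all_prime_nseq. Qed.

Lemma invertible_expz P n : prime_ideal P -> invertible (ideal_expz P n).
Proof.
move=> pP; case: n => n; first exact: invertible_expn.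
by apply: invertible_inv; apply: (@invertible_expn P n.+1).
Qed.

Lemma omodule_expz P n : prime_ideal P -> omodule (ideal_expz P n).
Proof. by move=> pP; have [] := invertible_expz n pP. Qed.

Lemma ideal_expzS P (n : int) : prime_ideal P ->
  ideal_mul P (ideal_expz P n) = ideal_expz P (n + 1).
Proof.
move=> pP; have iP := invertible_prime pP.
case: n => n; first by rewrite -PoszD addn1.
rewrite -[ideal_expz P (Negz n)]/(ideal_inv (ideal_mul P (ideal_expn P n))).
rewrite NegzE -addn1 PoszD opprD subrK.
have -> : ideal_expz P (- n%:Z) = ideal_inv (ideal_expn P n).
  by case: n => [|n]; rewrite ?oppr0 //= ideal_inv1.
rewrite ideal_inv_mul //; last exact: invertible_expn.
by rewrite ideal_mulKV //; exact: omodule_inv.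
Qed.

Lemma ideal_expzDn P (m : nat) (n : int) : prime_ideal P ->
  ideal_mul (ideal_expn P m) (ideal_expz P n) = ideal_expz P (m%:Z + n).
Proof.
move=> pP; elim: m => [|m IHm].
  by rewrite add0r ideal_mul1 //; exact: omodule_expz.
by rewrite -addn1 PoszD addrAC -ideal_expzS // -IHm /= addn1 ideal_mulA.
Qed.

Lemma ideal_expzD P (m n : int) : prime_ideal P ->
  ideal_mul (ideal_expz P m) (ideal_expz P n) = ideal_expz P (m + n).
Proof.
move=> pP; case: m => m; first exact: ideal_expzDn.
have oZ k := omodule_expz k pP.
apply: (@ideal_mul_cancel _ (ideal_expn P m.+1)) => //.
- exact: invertible_expn.
- by rewrite ideal_mulC; exact: omodule_mul.
- rewrite ideal_mulKV //; last exact: invertible_expn.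
  by rewrite ideal_expzDn // NegzE addrA subrr add0r.
Qed.

Lemma ideal_expz_le P (m n : int) : prime_ideal P -> m <= n ->
  ideal_expz P n `<=` ideal_expz P m.
Proof.
move=> pP lemn; rewrite -(subrK m n) addrC -ideal_expzD //.
have : 0 <= n - m by rewrite subr_ge0.
case: (n - m) => // k _; rewrite -[X in _ `<=` X]ideal_mulr1 //.
  apply: ideal_mulS => //; rewrite -[ideal_expz P k]/(ideal_expn P k).
  by rewrite -ideal_prod_nseq; apply: prod_integers; apply: all_prime_nseq.
exact: omodule_expz.
Qed.

Lemma has_valuation_of P x (n : int) a b : prime_ideal P -> x != 0 ->
    nonzero_ideal a -> nonzero_ideal b -> ~ a `<=` P -> ~ b `<=` P ->
    ideal_mul (principal_ideal x) b = ideal_mul (ideal_expz P n) a ->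
  has_valuation P x n.
Proof.
move=> pP x_n0 nza nzb naP nbP xbE; exists a, b; split=> //.
- by move=> /(prime_dvd pP nza.1).
- by move=> /(prime_dvd pP nzb.1).
- have [ob bE] := invertible_ideal nzb.
  rewrite ideal_mulA -xbE -ideal_mulA bE ideal_mulr1 //.
  exact: omodule_principal.
Qed.

(** Comparing two expressions of [x O] and clearing the denominators gives
    [a d = P ^ k c b] with [k > 0], although [P] divides neither [a] nor [d]. *)
Lemma has_valuation_unique P x (m n : int) : prime_ideal P -> x != 0 ->
  has_valuation P x m -> has_valuation P x n -> m = n.
Proof.
move=> pP x_n0.
suff le m' n' : has_valuation P x m' -> has_valuation P x n' -> ~ m' < n'.
  move=> vm vn; apply/eqP; case: (ltrgtP m n) => // lt.
    by case: (le _ _ vm vn).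
  by case: (le _ _ vn vm).
move=> [a [b [nza nzb naP nbP xab]]] [c [d [nzc nzd ncP ndP xcd]]] lt.
have [ia ib ic id] := And4 (invertible_ideal nza) (invertible_ideal nzb)
  (invertible_ideal nzc) (invertible_ideal nzd).
have [[oa _] [ob bE] [oc _] [od dE]] := And4 ia ib ic id.
have oZ k := omodule_expz k pP.
have adE : ideal_mul a d = ideal_mul (ideal_expz P (n' - m')) (ideal_mul c b).
  apply: (ideal_mul_cancel (invertible_expz m' pP)).
  - exact: omodule_mul.
  - exact: omodule_mul.
  rewrite [RHS]ideal_mulA ideal_expzD // [m' + _]addrC subrK.
  have -> : ideal_mul (ideal_expz P m') (ideal_mul a d) =
      ideal_mul (principal_ideal x) (ideal_mul b d).
    rewrite xab -!ideal_mulA; congr (ideal_mul _ (ideal_mul _ _)).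
    by rewrite ideal_mulVK.
  rewrite xcd -!ideal_mulA; congr (ideal_mul _ (ideal_mul _ _)).
  by rewrite (ideal_mulC b d) ideal_mulVK.
have [[sa _ _ _] [sb _ _ _]] := (nza.1, nzb.1).
have [[sc _ _ _] [sd _ _ _]] := (nzc.1, nzd.1).
have : ideal_mul a d `<=` P.
  rewrite adE -[X in _ `<=` X](ideal_mulr1 (prime_omodule pP)).
  apply: ideal_mulS.
    apply: subset_trans (ideal_expz_le pP (_ : 1 <= n' - m')) _.
      by rewrite -gtz0_ge1 subr_gt0.
    by rewrite /= ideal_mulr1 //; exact: prime_omodule.
  apply: ideal_mul_le_omodule; first exact: omodule_integers.
  by move=> u v /sc Ou /sb Ov; apply: integerM.
case/(prime_mul_sub pP sa sd) => [saP|sdP].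
  by apply: naP; apply/(prime_dvd pP nza.1).
by apply: ndP; apply/(prime_dvd pP nzd.1).
Qed.

Lemma valuationE P x (n : int) a b : prime_ideal P -> x != 0 ->
    nonzero_ideal a -> nonzero_ideal b -> ~ a `<=` P -> ~ b `<=` P ->
    ideal_mul (principal_ideal x) b = ideal_mul (ideal_expz P n) a ->
  valuation P x = n.
Proof.
move=> pP x_n0 nza nzb naP nbP xbE.
have vn := has_valuation_of pP x_n0 nza nzb naP nbP xbE.
apply: xget_unique => // m vm; exact: has_valuation_unique pP x_n0 vm vn.
Qed.

Lemma ideal_prod_count P s : ideal_prod s =
  ideal_mul (ideal_expn P (count_mem P s)) (ideal_prod [seq Q <- s | Q != P]).
Proof.
elim: s => [|Q s IHs] /=.
  by rewrite ideal_mul1 //; exact: omodule_integers.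
rewrite IHs; case: (eqVneq Q P) => [->|ne_QP] /=.
  by rewrite add0n ideal_mulA.
by rewrite add0n ideal_mulCA.
Qed.

Lemma all_prime_filter (p : pred (set K)) s : all_prime s -> all_prime (seq.filter p s).
Proof. by move=> ps Q; rewrite mem_filter => /andP[_ /ps]. Qed.

Lemma prod_away P s : prime_ideal P -> all_prime s ->
  ~ ideal_prod [seq Q <- s | Q != P] `<=` P.
Proof.
move=> pP ps /(prime_prod_sub pP (all_prime_filter ps)).
by rewrite mem_filter eqxx.
Qed.

Lemma prod_away_eq P x r s : prime_ideal P ->
    ideal_mul (principal_ideal x) (ideal_prod s) = ideal_prod r ->
  ideal_mul (principal_ideal x) (ideal_prod [seq Q <- s | Q != P]) =
  ideal_mul (ideal_expz P ((count_mem P r)%:Z - (count_mem P s)%:Z))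
    (ideal_prod [seq Q <- r | Q != P]).
Proof.
move=> pP xE; have oZ k := omodule_expz k pP.
apply: (ideal_mul_cancel (invertible_expn (count_mem P s) pP)).
- exact/omodule_mul/omodule_principal.
- exact: omodule_mul.
rewrite ideal_mulCA -ideal_prod_count xE (ideal_prod_count P r).
by rewrite ideal_mulA ideal_expzDn // addrC subrK.
Qed.

Lemma valuation_lists P x r s : prime_ideal P -> x != 0 ->
    all_prime r -> all_prime s ->
    ideal_mul (principal_ideal x) (ideal_prod s) = ideal_prod r ->
  valuation P x = (count_mem P r)%:Z - (count_mem P s)%:Z.
Proof.
move=> pP x_n0 pr ps xE.
have [pr' ps'] : all_prime [seq Q <- r | Q != P] /\ all_prime [seq Q <- s | Q != P].
  by split; exact: all_prime_filter.
apply: (valuationE pP x_n0 (nonzero_prod pr') (nonzero_prod ps')).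
- exact: prod_away.
- exact: prod_away.
- exact: prod_away_eq.
Qed.

Lemma fraction_lists x : x != 0 -> exists r s, [/\ all_prime r, all_prime s
  & ideal_mul (principal_ideal x) (ideal_prod s) = ideal_prod r].
Proof.
move=> x_n0; have [d d_n0 Odx] := integer_denominator x.
have dK_n0 : d%:~R != 0 :> K by rewrite intK_eq0.
have nz y : OK y -> y != 0 -> nonzero_ideal (principal_ideal y).
  move=> Oy y_n0; split; first exact: principal_ideal_ideal.
  by exists y => //; exact: mem_principal.
have [r pr rE] := ideal_factorization (nz _ Odx (mulf_neq0 dK_n0 x_n0)).
have [s ps sE] := ideal_factorization (nz _ (integer_int K d) dK_n0).
by exists r, s; split=> //; rewrite -rE -sE principalM mulrC.
Qed.

Lemma valuationM P x y : prime_ideal P -> x != 0 -> y != 0 ->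
  valuation P (x * y) = valuation P x + valuation P y.
Proof.
move=> pP x_n0 y_n0.
have [r [s [pr ps xE]]] := fraction_lists x_n0.
have [r' [s' [pr' ps' yE]]] := fraction_lists y_n0.
rewrite (valuation_lists pP x_n0 pr ps xE) (valuation_lists pP y_n0 pr' ps' yE).
rewrite (@valuation_lists _ _ (r ++ r') (s ++ s')) ?mulf_neq0 //.
- by rewrite !count_cat !PoszD opprD addrACA.
- exact: all_prime_cat.
- exact: all_prime_cat.
- by rewrite !ideal_prod_cat -principalM ideal_mulACA xE yE.
Qed.

Lemma valuation1 P : prime_ideal P -> valuation P 1 = 0.
Proof.
move=> pP; apply: (addrI (valuation P 1)).
by rewrite -valuationM ?oner_neq0 // mulr1 addr0.
Qed.

Lemma valuationV P x : prime_ideal P -> x != 0 -> valuation P x^-1 = - valuation P x.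
Proof.
move=> pP x_n0; apply: (addrI (valuation P x)).
by rewrite -valuationM ?invr_neq0 // divff // valuation1 // subrr.
Qed.

Lemma valuationX P x n : prime_ideal P -> x != 0 ->
  valuation P (x ^+ n) = valuation P x *+ n.
Proof.
move=> pP x_n0; elim: n => [|n IHn]; first by rewrite expr0 valuation1.
by rewrite exprS valuationM ?expf_neq0 // IHn mulrS.
Qed.

(** ** Inequalities between valuations *)

(** This means that [n] is at most the valuation of [x], or that [x = 0]. In this
    form, that of a localization at [P], stability by addition is immediate. *)
Definition val_ge P (n : int) x : Prop :=
  exists t, [/\ OK t, ~ P t & ideal_expz P n (t * x)].

Lemma val_ge0 P n : prime_ideal P -> val_ge P n 0.
Proof.
move=> pP; exists 1; split; [exact: integer1|by case: pP|].
by rewrite mulr0; have [[]] := omodule_expz n pP.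
Qed.

Lemma prime_notM P t u : prime_ideal P -> OK t -> OK u -> ~ P t -> ~ P u -> ~ P (t * u).
Proof. by move=> [_ _ P_prime] Ot Ou nPt nPu /(P_prime _ _ Ot Ou)[]. Qed.

(** The product of the two denominators is a denominator of the difference. *)
Lemma val_geB P n x y : prime_ideal P -> val_ge P n x -> val_ge P n y -> val_ge P n (x - y).
Proof.
move=> pP [t [Ot nPt tx]] [u [Ou nPu uy]]; exists (t * u); split.
- exact: integerM.
- exact: prime_notM.
- have [ge gM] := omodule_expz n pP.
  rewrite (_ : _ * _ = u * (t * x) - t * (u * y)); last by ring.
  by apply: ge.2; apply: gM.
Qed.

Lemma val_ge_group P n : prime_ideal P -> add_subgroup (val_ge P n).
Proof. by move=> pP; split; [exact: val_ge0|move=> x y; exact: val_geB]. Qed.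

Lemma val_ge_le P m n x : prime_ideal P -> m <= n -> val_ge P n x -> val_ge P m x.
Proof.
move=> pP lemn [t [Ot nPt tx]]; exists t; split=> //.
exact: ideal_expz_le lemn _ tx.
Qed.

Lemma valuation_unit P t : prime_ideal P -> OK t -> ~ P t -> valuation P t = 0.
Proof.
move=> pP Ot nPt; have nP1 : ~ OK `<=` P.
  by have [_ nP1 _] := pP => /(_ _ (integer1 K)).
have t_n0 : t != 0.
  by apply: contra_notN nPt => /eqP->; have [[]] := prime_omodule pP.
apply: (@valuationE _ _ _ (principal_ideal t) OK) => //.
- by split; [exact: principal_ideal_ideal|exists t => //; exact: mem_principal].
- exact: nonzero_ideal_integers.
- by move=> /(_ _ (mem_principal t)).
- by rewrite ideal_mulC.
Qed.

Lemma val_geP P n x : prime_ideal P -> x != 0 -> val_ge P n x <-> n <= valuation P x.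
Proof.
move=> pP x_n0; split=> [[t [Ot nPt tx]]|le_n].
  have t_n0 : t != 0.
    by apply: contra_notN nPt => /eqP->; have [[]] := prime_omodule pP.
  have tx_n0 : t * x != 0 by rewrite mulf_neq0.
  rewrite -[valuation P x]add0r -(valuation_unit pP Ot nPt) -valuationM //.
  have oZ k := omodule_expz k pP; have oX := omodule_principal (t * x).
  pose J := ideal_mul (ideal_expz P (- n)) (principal_ideal (t * x)).
  have sXZ : principal_ideal (t * x) `<=` ideal_expz P n.
    by move=> _ [r Or <-]; rewrite mulrC; apply: (oZ n).2.
  have idJ : is_ideal J.
    apply: ideal_omodule; first exact: omodule_mul.
    rewrite -[OK]/(ideal_expz P 0) -(subrr n) addrC -ideal_expzD //.
    exact: ideal_mulS.
  have nzJ : nonzero_ideal J.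
    split=> //; apply/invertible_nonzero/invertible_mul.
      exact: invertible_expz.
    exact: invertible_principal.
  have [s ps JE] := ideal_factorization nzJ.
  have nP1 : ~ OK `<=` P.
    by have [_ nP1 _] := pP => /(_ _ (integer1 K)).
  rewrite (@valuationE P _ (n + (count_mem P s)%:Z)
    (ideal_prod [seq Q <- s | Q != P]) OK) ?lerDl //.
  - by apply: nonzero_prod; exact: all_prime_filter.
  - exact: nonzero_ideal_integers.
  - exact: prod_away.
  rewrite -ideal_expzD // -ideal_mulA -ideal_prod_count -JE /J ideal_mulA.
  by rewrite ideal_expzD // subrr ideal_mulr1 // ideal_mul1.
have [r [s [pr ps xE]]] := fraction_lists x_n0.
have vE := valuation_lists pP x_n0 pr ps xE.
have [t st nPt] : exists2 t, ideal_prod [seq Q <- s | Q != P] t & ~ P t.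
  have /existsNP[t /not_implyP[]] := @prod_away P s pP ps.
  by exists t.
have ps' := @all_prime_filter (fun Q => Q != P) s ps.
exists t; split=> //; first exact: prod_integers st.
apply: (ideal_expz_le pP le_n).
have [oE _] := invertible_expz (valuation P x) pP.
have : ideal_mul (principal_ideal x) (ideal_prod [seq Q <- s | Q != P]) (t * x).
  by rewrite mulrC; apply: mem_ideal_mul => //; exact: mem_principal.
suff -> : ideal_mul (principal_ideal x) (ideal_prod [seq Q <- s | Q != P]) =
    ideal_mul (ideal_expz P (valuation P x)) (ideal_prod [seq Q <- r | Q != P]).
  apply: ideal_mul_le_omodule => // u v eu rv; rewrite mulrC; apply: oE.2 => //.
  exact: (prod_integers (all_prime_filter pr) rv).
by rewrite vE; apply: prod_away_eq.
Qed.

End Valuations.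

(** * The completion at a prime *)

Section LocalBasis.
Variable K : fieldExtType rat.
Local Notation OK := (@ring_of_integers K).
Implicit Types (a b P Q : set K) (x y z : K).

Lemma val_ge_mem P n x : prime_ideal P -> ideal_expz P n x -> val_ge P n x.
Proof.
move=> pP Zx; exists 1; split; [exact: integer1|by case: pP|].
by rewrite mul1r.
Qed.

Lemma val_ge_scale P n w z : prime_ideal P -> w != 0 ->
  val_ge P n z -> val_ge P (valuation P w + n) (w * z).
Proof.
move=> pP w_n0; have [->|z_n0] := eqVneq z 0.
  by move=> _; rewrite mulr0; exact: val_ge0.
rewrite !val_geP ?mulf_neq0 // valuationM // lerD2l //.
Qed.

(** The valuation of an integral [x] counts the factors [P] of the ideal
    [x O]. *)
Lemma mem_expn P (n : nat) x : prime_ideal P -> OK x -> val_ge P n x ->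
  ideal_expn P n x.
Proof.
move=> pP Ox vx; have [->|x_n0] := eqVneq x 0.
  by have [[[]]] := invertible_expn n pP.
have nzx : nonzero_ideal (principal_ideal x).
  by split; [exact: principal_ideal_ideal|exists x => //; exact: mem_principal].
have [s ps sE] := ideal_factorization nzx.
have := vx; rewrite val_geP // (@valuation_lists _ P x s [::]) //=; last first.
  by rewrite ideal_mulr1 //; exact: omodule_principal.
rewrite subr0 lez_nat => le_n.
have : principal_ideal x x by exact: mem_principal.
rewrite sE (ideal_prod_count P) -(subnK le_n) addnC -ideal_expnD // -ideal_mulA.
have [oE _] := invertible_expn n pP.
rewrite -[X in _ -> X x](ideal_mulr1 oE); apply: ideal_mulS => //.
apply: ideal_mul_le_omodule; first exact: omodule_integers.
move=> u v; rewrite -ideal_prod_nseq => /(prod_integers (all_prime_nseq pP)) Ou.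
by move=> /(prod_integers (all_prime_filter ps)) Ov; apply: integerM.
Qed.

(** ** Residue characteristic, inertia degree *)

Lemma prime_factor_mem P n : prime_ideal P -> (0 < n)%N -> P n%:R ->
  exists2 p, prime p & P p%:R.
Proof.
move=> pP; elim/ltn_ind: n => n IHn n_gt0 Pn.
have [_ nP1 P_prime] := pP.
have n_gt1 : (1 < n)%N by case: n n_gt0 Pn {IHn} => [|[]].
have [p_pr p_dvd] := (pdiv_prime n_gt1, pdiv_dvd n).
have := Pn; rewrite -(divnK p_dvd) natrM.
case/(P_prime _ _ (integer_nat _ _) (integer_nat _ _)) => [Pq|Pp]; last first.
  by exists (pdiv n).
apply: IHn Pq; first by rewrite ltn_Pdiv // prime_gt1.
by rewrite divn_gt0 ?prime_gt0 // dvdn_leq.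
Qed.

Lemma prime_int_dvd P p (k : int) : prime_ideal P -> prime p -> P p%:R ->
  P k%:~R -> (p %| k)%Z.
Proof.
move=> pP p_pr Pp Pk; have [_ nP1 _] := pP.
exact: (multiple_in_subgroup (prime_omodule pP).1 p_pr Pp nP1 Pk).
Qed.

Lemma residue_charP P : prime_ideal P ->
  prime (residue_char P) /\ P (residue_char P)%:R.
Proof.
move=> pP; have [nzP nP1 _] := pP; have [sP _ _ _] := nzP.1.
have NP := ideal_index_norm nzP.
have N_gt0 := has_index_gt0 (integer0 K) NP.
have PN := has_index_exponent (integer_group K) (prime_omodule pP).1 sP NP (integer1 K).
have [p p_pr Pp] := prime_factor_mem pP N_gt0 PN.
suff -> : residue_char P = p by [].
apply: xget_unique => // q [q_pr Pq]; have := prime_int_dvd pP p_pr Pp (Pq : P (q%:Z)%:~R).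
by rewrite dvdzE /= dvdn_prime2 // => /eqP.
Qed.

(** A basis of the residue field over its prime field also counts its
    elements. *)
Lemma inertia_degreeP P : prime_ideal P ->
  ideal_norm P = (residue_char P ^ inertia_degree P)%N /\ (0 < inertia_degree P)%N.
Proof.
move=> pP; have [p_pr Pp] := residue_charP pP; set p := residue_char P in p_pr Pp *.
have [nzP nP1 _] := pP; have [sP _ _ PM] := nzP.1; have oP := prime_omodule pP.
have [d [b [NE Ob b_span b_free]]] : exists d (b : 'I_d -> K),
    [/\ ideal_norm P = (p ^ d)%N, forall i, OK (b i),
    forall x, OK x -> exists c : 'I_d -> int, P (x - \sum_i b i *~ c i)
    & forall c : 'I_d -> int, P (\sum_i b i *~ c i) -> forall i, (p %| c i)%Z].
  apply: torsion_basis => //; first exact: integer_group.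
  - exact: oP.1.
  - by move=> x Ox; rewrite -mulr_natr; apply: PM.
  - exact: ideal_index_norm.
suff -> : inertia_degree P = d.
  split=> //; case: (d) NE => // NE.
  by have := norm_prime_gt1 pP; rewrite NE.
apply: quotient_dimE.
  split.
  - split; first by exists 0.
    by move=> _ _ [k _ <-] [l _ <-]; exists (k - l); rewrite // rmorphB.
  - by exists 1.
  - by move=> _ _ [k _ <-] [l _ <-]; exists (k * l); rewrite // rmorphM.
  - exact: oP.1.
  - by move=> a x Oa; apply: oP.2.
  - by move=> _ [k _ <-]; exact: integer_int.
  - exact: nP1.
  - move=> _ [k _ <-] nPk.
    have : coprimez p k.
      rewrite coprimezE prime_coprime //; apply/negP => pk; apply: nPk.
      have /dvdzP[q ->] : (p%:Z %| k)%Z by rewrite dvdzE.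
      by rewrite rmorphM; apply: PM => //; exact: integer_int.
    case/coprimezP=> -[u v] /= uv1; exists v%:~R; first by exists v.
    rewrite -rmorphM -[1]/(1%:~R) -rmorphB -uv1 mulrC opprD addrC addrNK.
    rewrite -mulNr rmorphM; apply: PM => //; exact: integer_int.
exists b; split=> //.
- move=> x /b_span[c cP]; exists (fun i => (c i)%:~R); split=> [i|]; first by exists (c i).
  by congr (P (_ - _)): cP; apply: eq_bigr => i _; rewrite mulrzl.
- move=> c' c'P; have /choice[c cE] i : exists k : int, k%:~R = c' i.
    by have [k _ kE] := c'P i; exists k.
  rewrite (eq_bigr (fun i => b i *~ c i)); last first.
    by move=> i _; rewrite -cE mulrzl.
  move=> /b_free pc i; rewrite -cE; have /dvdzP[q ->] := pc i.
  by rewrite rmorphM; apply: PM => //; exact: integer_int.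
Qed.

Lemma residue_char_neq0 P : prime_ideal P -> (residue_char P)%:R != 0 :> K.
Proof.
move=> pP; have [p_pr _] := residue_charP pP.
by rewrite natK_eq0 -lt0n prime_gt0.
Qed.

Lemma ramification_index_gt0 P : prime_ideal P -> 0 < ramification_index P.
Proof.
move=> pP; have [_ Pp] := residue_charP pP.
rewrite gtz0_ge1 -val_geP ?residue_char_neq0 //; apply: val_ge_mem => //.
by rewrite /= ideal_mulr1 //; exact: prime_omodule.
Qed.

End LocalBasis.

Lemma alg_div (K : fieldExtType rat) (k : int) (w : nat) :
  (k%:~R / w%:R : rat)%:A = k%:~R / w%:R :> K.
Proof.
by rewrite -in_algE fmorph_div rmorph_int rmorph_nat.
Qed.

Section LocalApproximation.
Variables (K : fieldExtType rat) (P : set K).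
Hypothesis pP : prime_ideal P.
Local Notation OK := (@ring_of_integers K).
Let p := residue_char P.
Let e := ramification_index P.
Let p_pr : prime p := (residue_charP pP).1.
Let p_n0 : p%:R != 0 :> K := residue_char_neq0 pP.
Let e_gt0 : 0 < e := ramification_index_gt0 pP.
Let oP := prime_omodule pP.
Implicit Types (x y z : K).

Let valp m : valuation P (p%:R ^+ m) = e * m%:Z.
Proof. by rewrite valuationX // -[LHS]mulr_natr natz. Qed.

Lemma val_ge_mulp (m : nat) n z : val_ge P n z -> val_ge P (e * m%:Z + n) (p%:R ^+ m * z).
Proof. by rewrite -valp; apply: val_ge_scale; rewrite // expf_neq0. Qed.

Lemma val_ge_divp (m : nat) n z :
  val_ge P (e * m%:Z + n) (p%:R ^+ m * z) -> val_ge P n z.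
Proof.
have pm_n0 : p%:R ^+ m != 0 :> K by rewrite expf_neq0.
move=> /(val_ge_scale pP (invr_neq0 pm_n0)).
by rewrite valuationV // valp addKr mulKf.
Qed.

Lemma val_ge_integer x : OK x -> val_ge P 0 x.
Proof. by move=> Ox; apply: val_ge_mem. Qed.

(** Units of the localization at [P] are units modulo any power of [P]: if
    [t w] is [1] modulo [P], then [1 - (1 - t w) ^+ n] is a multiple of [t]. *)
Lemma val_ge_approx (n : nat) y : val_ge P 0 y ->
  exists2 u, OK u & val_ge P n (y - u).
Proof.
move=> [t [Ot nPt Oty]]; have [w Ow Ptw] := prime_inverse pP Ot nPt.
have Otw : OK (1 - t * w) by apply: integerB; [exact: integer1|exact: integerM].
pose s := w * \sum_(i < n) (1 - t * w) ^+ i.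
have Os : OK s.
  by apply: integerM => //; apply: integer_sum => i _; apply: integerX.
have tsE : t * s = 1 - (1 - t * w) ^+ n.
  by rewrite -[RHS]opprB subrX1 /s; ring.
have Pn m : ideal_expn P m ((1 - t * w) ^+ m).
  elim: m => [|m IHm]; first exact: integer1.
  rewrite exprS; apply: mem_ideal_mul => //.
  by apply: subgroup_subC oP.1 _.
exists (t * y * s); first exact: integerM.
exists t; split=> //.
rewrite (_ : t * _ = t * y * (1 - t * s)); last by ring.
rewrite tsE subKr; have [eM _] := invertible_expn n pP.
exact: eM.2.
Qed.

Let E := `|e|%N.
Let eE : e = E%:Z. Proof. by rewrite gez0_abs // ltW. Qed.

(** The quotient of [O] by the [e]-th power of [P] is killed by [p], whose
    valuation is [e], and it has [p ^ (f e)] elements. *)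
Lemma residue_power_basis : exists d (b : 'I_d -> K),
  [/\ d = (E * inertia_degree P)%N, forall i, OK (b i),
    forall x, OK x -> exists c : 'I_d -> int, ideal_expn P E (x - \sum_i b i *~ c i)
    & forall c : 'I_d -> int, ideal_expn P E (\sum_i b i *~ c i) ->
       forall i, (p %| c i)%Z].
Proof.
have [eM _] := invertible_expn E pP.
have pE : ideal_expn P E p%:R.
  apply: mem_expn => //; first exact: integer_nat.
  by rewrite val_geP // -eE.
have all_p := @all_prime_nseq _ P E pP.
have nzE : nonzero_ideal (ideal_expn P E).
  by rewrite -ideal_prod_nseq; apply: nonzero_prod.
have sE : ideal_expn P E `<=` OK by have [[]] := nzE.
have NE : ideal_norm (ideal_expn P E) = (p ^ (E * inertia_degree P))%N.
  rewrite -ideal_prod_nseq norm_prod // big_nseq iter_muln_1.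
  by rewrite (inertia_degreeP pP).1 -expnM mulnC.
have [d [b [dE Ob b_span b_free]]] : exists d (b : 'I_d -> K),
    [/\ ideal_norm (ideal_expn P E) = (p ^ d)%N, forall i, OK (b i),
    forall x, OK x -> exists c : 'I_d -> int, ideal_expn P E (x - \sum_i b i *~ c i)
    & forall c : 'I_d -> int, ideal_expn P E (\sum_i b i *~ c i) ->
       forall i, (p %| c i)%Z].
  apply: torsion_basis => //; first exact: integer_group.
  - exact: eM.1.
  - by move=> x Ox; rewrite -mulr_natr; apply: eM.2.
  - exact: ideal_index_norm.
exists d, b; split=> //; apply/eqP; rewrite -(eqn_exp2l _ _ (prime_gt1 p_pr)).
by rewrite -dE NE.
Qed.

(** As [p] has valuation [e], a basis of [O] modulo the [e]-th power of [P]
    provides the successive digits of an expansion in powers of [p], which gives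
    the approximations. Conversely a combination with integral coefficients which
    has valuation at least [e] has all its coefficients divisible by [p], and
    this can be iterated. *)
Lemma local_basis : exists d (b : 'I_d -> K),
  [/\ d%:Z = e * (inertia_degree P)%:Z,
    forall x (m : int), exists c : 'I_d -> rat,
      val_ge P (e * m) (x - \sum_i (c i)%:A * b i)
    & forall (c : 'I_d -> rat) (m : int),
      val_ge P (e * m) (\sum_i (c i)%:A * b i) ->
      forall i, val_ge P (e * m) (c i)%:A].
Proof.
have [d [b [dE Ob b_span b_free]]] := residue_power_basis.
exists d, b; split; first by rewrite dE PoszM eE.
  have approx y (m : nat) : val_ge P 0 y -> exists c : 'I_d -> int,
      val_ge P (e * m%:Z) (y - \sum_i b i *~ c i).
    move=> vy; elim: m => [|m [c cP]].
      exists (fun=> 0); rewrite big1 ?subr0 ?mulr0 // => i _.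
    pose z := (p%:R ^+ m)^-1 * (y - \sum_i b i *~ c i).
    have zE : p%:R ^+ m * z = y - \sum_i b i *~ c i.
      by rewrite mulVKf // expf_neq0.
    have vz : val_ge P 0 z by apply: (@val_ge_divp m); rewrite addr0 zE.
    have [u Ou vzu] := val_ge_approx E vz.
    have [c' /(@val_ge_mem _ P E _ pP) c'P] := b_span u Ou.
    exists (fun i => c i + (p ^ m)%N%:Z * c' i).
    rewrite (_ : y - _ = p%:R ^+ m * (z - u + (u - \sum_i b i *~ c' i))).
      rewrite -addn1 PoszD mulrDr mulr1; apply: val_ge_mulp.
      by rewrite eE; apply: subgroupD => //; exact: val_ge_group.
    rewrite addrA subrK mulrBr zE mulr_sumr -addrA -opprD -big_split /=.
    congr (_ - _); apply: eq_bigr => i _.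
    rewrite -natrX; move: (p ^ m)%N => q.
    by rewrite mulrzDr mulrzA mulrzAr mulr_natl.
  move=> x m.
  (* multiplying by [p ^ k] makes the valuation of [x] nonnegative *)
  pose k := `|valuation P x|%N.
  have vk : val_ge P 0 (p%:R ^+ k * x).
    have [->|x_n0] := eqVneq x 0; first by rewrite mulr0; exact: val_ge0.
    rewrite val_geP ?mulf_neq0 ?expf_neq0 // valuationM ?expf_neq0 // valp.
    rewrite /k; nia.
  pose j := `|(m + k%:Z)%R|%N.
  have le_j : m + k%:Z <= j%:Z by rewrite /j; lia.
  have [c cP] := approx _ j vk.
  exists (fun i => (c i)%:~R / (p ^ k)%N%:R); apply: (@val_ge_divp k).
  rewrite mulrBr mulr_sumr.
  apply: (@val_ge_le _ _ _ (e * j%:Z)) => //.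
    by rewrite -mulrDr ler_pM2l // addrC.
  congr (val_ge _ _ (_ - _)): cP; apply: eq_bigr => i _.
  have pk_n0 : p%:R ^+ k != 0 :> K by rewrite expf_neq0.
  by rewrite alg_div natrX mulrA [_ * (_ / _)]mulrC divfK // mulrzl.
have bound (m : nat) : forall c : 'I_d -> int, val_ge P (e * m%:Z) (\sum_i b i *~ c i) ->
    forall i, ((p ^ m)%N%:Z %| c i)%Z.
  elim: m => [|m IHm] c vc i; first by rewrite expn0 dvd1z.
  have Osum : OK (\sum_i b i *~ c i).
    by apply: integer_sum => j _; apply: subgroupMz (integer_group K) (Ob j).
  have : ideal_expn P E (\sum_i b i *~ c i).
    apply: mem_expn => //; apply: val_ge_le vc => //.
    by rewrite -eE ler_peMr // ltW.
  move=> /b_free pc.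
  have /choice[c' c'E] j : exists k, c j = k * p%:Z by have /dvdzP := pc j.
  rewrite c'E expnSr PoszM dvdz_mul //; apply: IHm.
  apply: (@val_ge_divp 1); rewrite -mulrDr -PoszD add1n.
  congr (val_ge _ _ _): vc; rewrite mulr_sumr; apply: eq_bigr => j _.
  by rewrite c'E mulrzA expr1 mulr_natl.
move=> c m vc i.
have [D D_n0 /choice[k kE]] := common_denominator c.
pose n := `|D|%N; pose h i := sgz D * k i.
have n_gt0 : (0 < n)%N by rewrite absz_gt0.
have cE j : c j = (h j)%:~R / n%:R.
  have n_n0 : n%:R != 0 :> rat by rewrite pnatr_eq0 -lt0n.
  apply: (mulIf n_n0); rewrite divfK // mulrC /h /n rmorphM /= -kE mulrA -rmorphM.
  by rewrite -abszEsg.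
have [n' p_n' nE] := pfactor_coprime p_pr n_gt0; set a := logn p n in nE.
have nP : ~ P n'%:R.
  move=> /(prime_int_dvd pP p_pr (residue_charP pP).2 (k := n')).
  by rewrite dvdzE /= => p_dvd; move: p_n'; rewrite prime_coprime // p_dvd.
have n'_n0 : n'%:R != 0 :> K.
  by rewrite natK_eq0; apply: contraTneq n_gt0 => n0; rewrite nE n0.
have v_n' : valuation P n'%:R = 0 by apply: valuation_unit => //; exact: integer_nat.
have nKE : n%:R = p%:R ^+ a * n'%:R :> K by rewrite nE mulnC natrM natrX.
have vh : val_ge P (e * (m + a%:Z)) (\sum_j b j *~ h j).
  have -> : \sum_j b j *~ h j = p%:R ^+ a * (n'%:R * \sum_j (c j)%:A * b j).
    rewrite mulrA -nKE mulr_sumr; apply: eq_bigr => j _.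
    have n_n0 : n%:R != 0 :> K by rewrite natK_eq0 -lt0n.
    by rewrite cE alg_div mulrA [n%:R * _]mulrC divfK // mulrzl.
  rewrite mulrDr addrC; apply: val_ge_mulp.
  by rewrite -[e * m]add0r -v_n'; apply: val_ge_scale.
have vhi : val_ge P (e * (m + a%:Z)) (h i)%:~R.
  have [lt0|ge0] := ltrP (m + a%:Z) 0.
    apply: (@val_ge_le _ _ _ 0) => //; first by rewrite pmulr_rle0 // ltW.
    exact/val_ge_integer/integer_int.
  case: (m + a%:Z) ge0 vh => // j _ /bound/(_ i)/dvdzP[q ->].
  have -> : (q * (p ^ j)%N%:Z)%:~R = p%:R ^+ j * q%:~R :> K.
    by rewrite intrM mulrC -natrX.
  rewrite -[e * _]addr0.
  by apply: val_ge_mulp; apply/val_ge_integer/integer_int.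
apply: (@val_ge_divp a); rewrite addrC -mulrDr.
have -> : p%:R ^+ a * (c i)%:A = n'%:R^-1 * (h i)%:~R :> K.
  rewrite cE alg_div nKE invfM mulrCA [p%:R ^+ a * _]mulrA divff ?mul1r 1?mulrC //.
  exact: expf_neq0.
rewrite -[e * _]add0r -oppr0 -v_n' -valuationV //.
by apply: val_ge_scale => //; rewrite invr_eq0.
Qed.

End LocalApproximation.

(** * Completions *)

Record absolute_value (R : realType) (K : fieldExtType rat) (v : K -> R) : Prop := {
  abs_ge0 : forall x, 0 <= v x;
  abs_eq0 : forall x, v x = 0 <-> x = 0;
  absM : forall x y, v (x * y) = v x * v y;
  abs_triangle : forall x y, v (x + y) <= v x + v y }.

Lemma exists_natSinv_lt (R : realType) (e : R) : 0 < e ->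
  exists N : nat, forall n, (N <= n)%N -> n.+1%:R^-1 < e.
Proof.
move=> e_gt0; have [N _ NP] := near_infty_natSinv_lt (PosNum e_gt0).
by exists N => n /NP.
Qed.

Section LocalDegree.
Variables (R : realType) (K : fieldExtType rat) (v : K -> R).
Hypothesis v_abs : absolute_value v.
Implicit Types (x y : K) (u w : nat -> K).

Lemma abs0 : v 0 = 0. Proof. exact/(abs_eq0 v_abs). Qed.

Lemma abs_gt0 x : x != 0 -> 0 < v x.
Proof.
move=> x_n0; rewrite lt_def (abs_ge0 v_abs) andbT.
by apply: contraNneq x_n0 => /(abs_eq0 v_abs)->.
Qed.

Lemma abs1 : v 1 = 1.
Proof.
have v1_n0 : v 1 != 0 by rewrite gt_eqF // abs_gt0 // oner_neq0.
by apply: (mulfI v1_n0); rewrite -(absM v_abs) !mulr1.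
Qed.

Lemma absN x : v (- x) = v x.
Proof.
have vN1 : v (-1) = 1.
  apply/eqP; rewrite -(@eqrXn2 _ 2) ?ler01 ?(abs_ge0 v_abs) //.
  by rewrite expr2 -(absM v_abs) mulrNN mulr1 abs1 expr1n.
by rewrite -mulN1r (absM v_abs) vN1 mul1r.
Qed.

Lemma absV x : v x^-1 = (v x)^-1.
Proof.
have [->|x_n0] := eqVneq x 0; first by rewrite invr0 abs0 invr0.
have vx_n0 : v x != 0 by rewrite gt_eqF // abs_gt0.
by apply: (mulfI vx_n0); rewrite -(absM v_abs) !divff // abs1.
Qed.

Lemma nullP u : null_sequences v u <->
  forall e : R, 0 < e -> exists N : nat, forall n, (N <= n)%N -> v (u n) < e.
Proof.
split=> [/cvgr0Pnorm_lt u0 e e_gt0|u0].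
  have [N _ NP] := u0 e e_gt0; exists N => n /NP /=.
  by rewrite ger0_norm // (abs_ge0 v_abs).
apply/cvgr0Pnorm_lt => e e_gt0; have [N NP] := u0 e e_gt0.
by exists N => // n /NP /=; rewrite ger0_norm // (abs_ge0 v_abs).
Qed.

Lemma null_cauchy u : null_sequences v u -> cauchy_sequences v u.
Proof.
move=> /nullP u0 e e_gt0; have [N NP] := u0 _ (divr_gt0 e_gt0 (ltr0Sn _ 1)).
exists N => m n /NP um /NP un; rewrite [e]splitr.
apply: le_lt_trans (ltrD um un); rewrite -[v (u n)]absN.
exact: abs_triangle.
Qed.

Lemma cauchy_bounded u : cauchy_sequences v u ->
  exists2 M : R, 0 < M & forall n, v (u n) <= M.
Proof.
move=> /(_ 1 ltr01)[N NP].
pose M := 1 + v (u N) + \sum_(i < N) v (u i).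
have sum_ge0 : 0 <= \sum_(i < N) v (u i).
  by apply: sumr_ge0 => i _; exact: abs_ge0.
have uN_ge0 := abs_ge0 v_abs (u N).
exists M; first by rewrite /M; lra.
move=> n; have [lt_nN|le_Nn] := ltnP n N.
  rewrite /M (bigD1 (Ordinal lt_nN)) //=.
  have : 0 <= \sum_(i < N | i != Ordinal lt_nN) v (u i).
    by apply: sumr_ge0 => i _; exact: abs_ge0.
  lra.
have := NP n N le_Nn (leqnn N); have := abs_triangle v_abs (u n - u N) (u N).
rewrite subrK /M; lra.
Qed.

Lemma cauchy_sub u w : cauchy_sequences v u -> cauchy_sequences v w ->
  cauchy_sequences v (u - w).
Proof.
move=> cu cw e e_gt0; have e2_gt0 := divr_gt0 e_gt0 (ltr0Sn R 1).
have [N NP] := cu _ e2_gt0; have [M MP] := cw _ e2_gt0.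
exists (maxn N M) => m n; rewrite !geq_max => /andP[Nm Mm] /andP[Nn Mn].
rewrite -[(u - w) m]/(u m - w m) -[(u - w) n]/(u n - w n) [e]splitr.
rewrite (_ : _ - _ = (u m - u n) + - (w m - w n)); last by ring.
apply: le_lt_trans (ltrD (NP m n Nm Nn) (MP m n Mm Mn)).
rewrite -[v (w m - w n)]absN; exact: abs_triangle.
Qed.

Lemma cauchy_mul u w : cauchy_sequences v u -> cauchy_sequences v w ->
  cauchy_sequences v (u * w).
Proof.
move=> cu cw e e_gt0.
have [A A_gt0 AP] := cauchy_bounded cu; have [B B_gt0 BP] := cauchy_bounded cw.
have d1 : 0 < e / 2 / A by rewrite !divr_gt0.
have d2 : 0 < e / 2 / B by rewrite !divr_gt0.
have [M MP] := cw _ d1; have [N NP] := cu _ d2.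
exists (maxn N M) => m n; rewrite !geq_max => /andP[Nm Mm] /andP[Nn Mn].
rewrite -[(u * w) m]/(u m * w m) -[(u * w) n]/(u n * w n).
rewrite (_ : _ - _ = u m * (w m - w n) + (u m - u n) * w n); last by ring.
apply: le_lt_trans (abs_triangle v_abs _ _) _; rewrite !(absM v_abs) [e]splitr.
apply: ltrD.
  apply: le_lt_trans (_ : A * v (w m - w n) < _).
    by rewrite ler_wpM2r // (abs_ge0 v_abs).
  by rewrite mulrC -ltr_pdivlMr // MP.
apply: le_lt_trans (_ : v (u m - u n) * B < _).
  by rewrite ler_wpM2l // (abs_ge0 v_abs).
by rewrite -ltr_pdivlMr // NP.
Qed.

Lemma null_group : add_subgroup (null_sequences v).
Proof.
split; first by apply/nullP => e e_gt0; exists 0 => n _; rewrite abs0.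
move=> u w /nullP nu /nullP nw; apply/nullP => e e_gt0.
have e2_gt0 := divr_gt0 e_gt0 (ltr0Sn R 1).
have [N NP] := nu _ e2_gt0; have [M MP] := nw _ e2_gt0.
exists (maxn N M) => n; rewrite geq_max => /andP[/NP un /MP wn].
rewrite -[(u - w) n]/(u n - w n) [e]splitr.
apply: le_lt_trans (ltrD un wn); rewrite -[v (w n)]absN.
exact: abs_triangle.
Qed.

Lemma null_absorb u w : cauchy_sequences v u -> null_sequences v w ->
  null_sequences v (u * w).
Proof.
move=> /cauchy_bounded[A A_gt0 AP] /nullP nw; apply/nullP => e e_gt0.
have [N NP] := nw _ (divr_gt0 e_gt0 A_gt0); exists N => n /NP wn.
rewrite -[(u * w) n]/(u n * w n) (absM v_abs).
apply: le_lt_trans (_ : A * v (w n) < _).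
  by rewrite ler_wpM2r // (abs_ge0 v_abs).
by rewrite mulrC -ltr_pdivlMr.
Qed.

(** A Cauchy sequence which is small infinitely often tends to zero. *)
Lemma cauchy_away u : cauchy_sequences v u -> ~ null_sequences v u ->
  exists2 d : R, 0 < d & exists N : nat, forall n, (N <= n)%N -> d <= v (u n).
Proof.
move=> cu nu; apply: contrapT => nex; apply: nu; apply/nullP => e e_gt0.
have e2_gt0 := divr_gt0 e_gt0 (ltr0Sn R 1).
have [N NP] := cu _ e2_gt0; exists N => n Nn; rewrite ltNge; apply/negP => le_e.
apply: nex; exists (e / 2) => //; exists N => m Nm.
have := NP n m Nn Nm; have := abs_triangle v_abs (u n - u m) (u m).
rewrite subrK; lra.
Qed.

Lemma cauchy_inv u : cauchy_sequences v u -> ~ null_sequences v u ->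
  cauchy_sequences v (fun n => (u n)^-1) /\
  null_sequences v (u * (fun n => (u n)^-1) - 1).
Proof.
move=> cu nu; have [d d_gt0 [N NP]] := cauchy_away cu nu.
have u_n0 n : (N <= n)%N -> u n != 0.
  move=> /NP; apply: contraTneq => ->.
  by rewrite abs0 -ltNge.
split.
  move=> e e_gt0; have [M MP] := cu _ (mulr_gt0 e_gt0 (mulr_gt0 d_gt0 d_gt0)).
  exists (maxn N M) => m n; rewrite !geq_max => /andP[Nm Mm] /andP[Nn Mn].
  rewrite (_ : _ - _ = (u n - u m) * ((u m)^-1 * (u n)^-1)); last first.
    by field; rewrite !u_n0.
  rewrite !(absM v_abs) !absV -invfM ltr_pdivrMr ?mulr_gt0 ?abs_gt0 ?u_n0 //.
  apply: lt_le_trans (MP _ _ Mn Mm) _; rewrite ler_pM2l //.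
  by apply: ler_pM; [exact: ltW|exact: ltW|exact: NP|exact: NP].
apply/nullP => e e_gt0; exists N => n /u_n0 un_n0.
rewrite -[(_ - _) n]/(u n * (u n)^-1 - 1) divff // subrr abs0 //.
Qed.

Lemma completion_field : field_modulo
  (cauchy_sequences v `&` @rational_sequences K) (cauchy_sequences v) (null_sequences v).
Proof.
split.
- split.
    split; first by apply: null_cauchy; exact: null_group.1.
    by exists (fun=> 0); apply/funext => n; rewrite scale0r.
  move=> u w [cu [q qE]] [cw [r rE]]; split; first exact: cauchy_sub.
  by exists (fun n => q n - r n); rewrite qE rE; apply/funext => n; rewrite scalerBl.
- split; last by exists (fun=> 1); apply/funext => n; rewrite scale1r.
  by move=> e e_gt0; exists 0 => m n _ _; rewrite subrr abs0.
- move=> u w [cu [q qE]] [cw [r rE]]; split; first exact: cauchy_mul.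
  exists (fun n => q n * r n); rewrite qE rE; apply/funext => n.
  by rewrite -[LHS]/((q n)%:A * (r n)%:A) mulr_algl scalerA.
- exact: null_group.
- exact: null_absorb.
- by move=> u [].
- move=> /nullP/(_ 1 ltr01)[N /(_ N (leqnn N))].
  by rewrite -[(1 : nat -> K) N]/(1 : K) abs1 ltxx.
- move=> u [cu [q qE]] nu; have [cV nV] := cauchy_inv cu nu.
  exists (fun n => (u n)^-1) => //; split=> //.
  exists (fun n => (q n)^-1); rewrite qE; apply/funext => n.
  by rewrite -[RHS]in_algE fmorphV.
Qed.

(** A family of elements of [K] is a basis of the completion over the
    completion of [rat] as soon as its rational combinations are dense in [K]
    and control their coefficients: then the coefficients of approximations to
    a Cauchy sequence form Cauchy sequences. *)
Lemma local_degree_basis d (b : 'I_d -> K) (C : R) : 0 < C ->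
    (forall x (e : R), 0 < e -> exists c : 'I_d -> rat,
       v (x - \sum_i (c i)%:A * b i) < e) ->
    (forall (c : 'I_d -> rat) i, v (c i)%:A <= C * v (\sum_i (c i)%:A * b i)) ->
  local_degree v = d.
Proof.
move=> C_gt0 dense control; apply: quotient_dimE completion_field _ _.
have sumE (c : 'I_d -> nat -> K) n :
    (\sum_i c i * (fun=> b i)) n = \sum_i c i n * b i.
  by rewrite fct_sumE.
exists (fun i _ => b i); split.
- by move=> i e e_gt0; exists 0 => m n _ _; rewrite subrr abs0.
- move=> u cu.
  have inv_gt0 n : 0 < n.+1%:R^-1 :> R by rewrite invr_gt0.
  have /choice[c cP] n := dense (u n) _ (inv_gt0 n).
  pose q i : nat -> K := fun n => (c n i)%:A.
  have nq : null_sequences v (u - \sum_i q i * (fun=> b i)).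
    apply/nullP => e /exists_natSinv_lt[N NP]; exists N => n /NP.
    apply: lt_trans; rewrite -[(_ - _) n]/(u n - (\sum_i q i * (fun=> b i)) n).
    by rewrite sumE; exact: cP.
  exists q; split=> // i; split; last by exists (fun n => c n i).
  have cs : cauchy_sequences v (\sum_i q i * (fun=> b i)).
    by rewrite -[X in cauchy_sequences v X](subKr u); apply: cauchy_sub => //; exact: null_cauchy.
  move=> e e_gt0; have [N NP] := cs _ (divr_gt0 e_gt0 C_gt0).
  exists N => m n Nm Nn; have := control (fun j => c m j - c n j) i.
  rewrite scalerBl => /le_lt_trans; apply.
  rewrite mulrC -ltr_pdivlMr //; apply: le_lt_trans (NP m n Nm Nn).
  rewrite !sumE -sumrB le_eqVlt; apply/orP; left; apply/eqP; congr v.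
  by apply: eq_bigr => j _; rewrite scalerBl mulrBl.
- move=> q qP /nullP nq i.
  have /choice[c cE] j : exists c : nat -> rat, q j = fun n => (c n)%:A.
    by have [_ [c ->]] := qP j; exists c.
  apply/nullP => e e_gt0; have [N NP] := nq _ (divr_gt0 e_gt0 C_gt0).
  exists N => n /NP; rewrite sumE ltr_pdivlMr // mulrC; apply: le_lt_trans.
  have := control (fun j => c j n) i; rewrite -[(c i n)%:A]/((fun k => (c i k)%:A) n) -cE.
  move=> /le_trans; apply; rewrite le_eqVlt; apply/orP; left; apply/eqP.
  by congr (_ * v _); apply: eq_bigr => j _; rewrite cE.
Qed.

End LocalDegree.

(** ** Local degrees at the primes *)

Section PadicAbs.
Variables (R : realType) (K : fieldExtType rat) (P : set K).
Hypothesis pP : prime_ideal P.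
Local Notation v := (padic_abs R P).
Local Notation NP := ((ideal_norm P)%:R : R).
Local Notation e := (ramification_index P).
Local Notation f := (inertia_degree P).
Implicit Types (x y : K) (m n : int).

Let kappa : R := e%:~R * f%:R.

Let kappa_gt0 : 0 < kappa.
Proof.
rewrite mulr_gt0 ?ltr0z ?ramification_index_gt0 // ltr0n.
exact: (inertia_degreeP pP).2.
Qed.

Let NP_gt1 : 1 < NP. Proof. by rewrite ltr1n norm_prime_gt1. Qed.
Let NP_gt0 : 0 < NP. Proof. exact: lt_trans ltr01 NP_gt1. Qed.

(** The absolute value of the elements of valuation [n]. *)
Definition prime_pow n : R := NP `^ (- n%:~R / kappa).

Lemma padic_absE x : x != 0 -> v x = prime_pow (valuation P x).
Proof. by rewrite /padic_abs => /negPf->. Qed.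

Lemma prime_pow_gt0 n : 0 < prime_pow n.
Proof. exact: powR_gt0. Qed.

Lemma prime_powD m n : prime_pow (m + n) = prime_pow m * prime_pow n.
Proof.
rewrite /prime_pow -powRD; last by rewrite (gt_eqF NP_gt0) implybT.
by rewrite intrD opprD mulrDl.
Qed.

Lemma prime_pow_le m n : m <= n -> prime_pow n <= prime_pow m.
Proof.
move=> lemn; apply: ler_powR; first exact: ltW.
by rewrite ler_pM2r ?invr_gt0 // lerN2 ler_int.
Qed.

Lemma prime_pow_exp n d : d%:Z = e * f%:Z -> prime_pow n ^+ d = NP ^ (- n).
Proof.
move=> dE; have dR : d%:R = kappa :> R.
  by rewrite /kappa -[f%:R]/(f%:Z%:~R) -intrM -dE.
rewrite -powR_mulrn ?powR_ge0 // -powRrM dR divfK ?gt_eqF //.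
by rewrite -mulrNz powR_intmul // ltW.
Qed.

Lemma padic_abs0 : v 0 = 0.
Proof. by rewrite /padic_abs eqxx. Qed.

Lemma padic_abs_gt0 x : x != 0 -> 0 < v x.
Proof. by move=> x_n0; rewrite padic_absE // prime_pow_gt0. Qed.

Lemma padic_abs_val_ge n x : val_ge P n x -> v x <= prime_pow n.
Proof.
have [->|x_n0] := eqVneq x 0; first by rewrite padic_abs0 ltW // prime_pow_gt0.
by rewrite val_geP // padic_absE // => /prime_pow_le.
Qed.

Lemma padic_absolute_value : absolute_value v.
Proof.
split.
- move=> x; have [->|x_n0] := eqVneq x 0; first by rewrite padic_abs0.
  exact/ltW/padic_abs_gt0.
- move=> x; split=> [vx0|->]; last exact: padic_abs0.
  by apply/eqP; apply: contraTT (lexx (v x)) => /padic_abs_gt0; rewrite vx0 ltxx.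
- move=> x y; have [->|x_n0] := eqVneq x 0; first by rewrite mul0r padic_abs0 mul0r.
  have [->|y_n0] := eqVneq y 0; first by rewrite mulr0 padic_abs0 mulr0.
  by rewrite !padic_absE ?mulf_neq0 // valuationM // prime_powD.
- move=> x y; have [->|x_n0] := eqVneq x 0; first by rewrite add0r padic_abs0 add0r.
  have [->|y_n0] := eqVneq y 0; first by rewrite addr0 padic_abs0 addr0.
  wlog le_xy : x y x_n0 y_n0 / valuation P x <= valuation P y.
    move=> wl; case/orP: (le_total (valuation P x) (valuation P y)) => le.
      exact: wl.
    by rewrite addrC [leRHS]addrC; apply: wl.
  apply: (@le_trans _ _ (v x)); last by rewrite lerDl ltW // padic_abs_gt0.
  rewrite [leRHS]padic_absE //; apply: padic_abs_val_ge.
  apply: subgroupD; first exact: val_ge_group.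
    exact/val_geP.
  exact/val_geP.
Qed.

(** The control of the coefficients loses at most a factor [prime_pow (- e)], due
    to the rounding of valuations to multiples of [e]. *)
Lemma local_degree_padic : (local_degree v)%:Z = e * f%:Z.
Proof.
have [d [b [dE approx bound]]] := local_basis pP; rewrite -dE; congr Posz.
have e_gt0 := ramification_index_gt0 pP; have [_ f_gt0] := inertia_degreeP pP.
apply: (local_degree_basis padic_absolute_value (b := b) (prime_pow_gt0 (- e))).
- move=> x r /exists_natSinv_lt[k /(_ k (leqnn k)) kr].
  have [c /padic_abs_val_ge cP] := approx x (f * k)%N%:Z.
  exists c; apply: le_lt_trans cP (le_lt_trans _ kr).
  have -> : prime_pow (e * (f * k)%N%:Z) = (ideal_norm P ^ k)%N%:R^-1.
    have -> : e * (f * k)%N%:Z = k%:Z * d%:Z.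
      by rewrite dE PoszM [RHS]mulrC mulrA.
    have -> : prime_pow (k%:Z * d%:Z) = prime_pow k%:Z ^+ d.
      elim: (d) => [|j IHj]; first by rewrite mulr0 /prime_pow oppr0 mul0r powRr0.
      by rewrite -addn1 PoszD mulrDr mulr1 prime_powD IHj exprD expr1.
    by rewrite (prime_pow_exp _ dE) -exprnN natrX.
  rewrite lef_pV2 ?posrE ?ltr0n ?expn_gt0 ?(ltnW (norm_prime_gt1 pP)) // ler_nat.
  by apply: ltn_expl; exact: norm_prime_gt1.
- move=> c i; set S := \sum_i _.
  have vc m : val_ge P (e * m) S -> val_ge P (e * m) (c i)%:A by move/bound/(_ i).
  have [S0|S_n0] := eqVneq S 0.
    rewrite S0 padic_abs0 mulr0.
    suff -> : (c i)%:A = 0 :> K by rewrite padic_abs0.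
    apply/eqP/negPn/negP => ci_n0.
    have := vc (`|valuation P (c i)%:A|%N%:Z + 1); rewrite S0 => /(_ (val_ge0 _ pP)).
    by rewrite val_geP //; nia.
  pose m := (valuation P S %/ e)%Z.
  have sE := divz_eq (valuation P S) e; rewrite -/m mulrC in sE.
  have r_ge0 : 0 <= (valuation P S %% e)%Z by apply: modz_ge0; rewrite gt_eqF.
  have r_lt : (valuation P S %% e)%Z < e by apply: ltz_pmod.
  have /padic_abs_val_ge/le_trans : val_ge P (e * m) (c i)%:A.
    by apply: vc; rewrite val_geP // {1}sE lerDl.
  apply; rewrite [v S]padic_absE // -prime_powD; apply: prime_pow_le.
  by rewrite {1}sE addrCA gerDl addrC subr_le0 ltW.
Qed.

End PadicAbs.

(** ** Local degrees at the archimedean places *)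

Section ArchAbs.
Variables (R : realType) (K : fieldExtType rat).
Implicit Types (x y : K) (sigma : {rmorphism K -> R[i]}).

Lemma normc_sqr (z : R[i]) : Normc.normc z ^+ 2 = complex.Re z ^+ 2 + complex.Im z ^+ 2.
Proof. by case: z => a b /=; rewrite sqr_sqrtr // addr_ge0 // sqr_ge0. Qed.

Lemma normc_ge0 (z : R[i]) : 0 <= Normc.normc z.
Proof. by case: z => a b /=; exact: sqrtr_ge0. Qed.

Lemma normc_norm (z : R[i]) : `|z| = (Normc.normc z)%:C%C.
Proof. by rewrite normc_def; case: z. Qed.

Lemma normc_triangle (z w : R[i]) : Normc.normc (z + w) <= Normc.normc z + Normc.normc w.
Proof.
have := ler_normD z w; rewrite !normc_norm -rmorphD /= lecE /= eqxx /=.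
by [].
Qed.

Lemma normc_ge_absRe (z : R[i]) : `|complex.Re z| <= Normc.normc z.
Proof.
rewrite -(@ler_pXn2r _ 2) ?nnegrE ?normc_ge0 // normc_sqr real_normK ?num_real //.
by rewrite lerDl sqr_ge0.
Qed.

Lemma normc_ge_absIm (z : R[i]) : `|complex.Im z| <= Normc.normc z.
Proof.
rewrite -(@ler_pXn2r _ 2) ?nnegrE ?normc_ge0 // normc_sqr real_normK ?num_real //.
by rewrite lerDr sqr_ge0.
Qed.

Lemma normc_le_ReIm (z : R[i]) :
  Normc.normc z <= `|complex.Re z| + `|complex.Im z|.
Proof.
rewrite -(@ler_pXn2r _ 2) ?nnegrE ?normc_ge0 ?addr_ge0 // normc_sqr.
rewrite sqrrD !real_normK ?num_real // addrAC lerDl mulrn_wge0 // mulr_ge0 //.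
Qed.

Lemma arch_absolute_value sigma : absolute_value (arch_abs sigma).
Proof.
split.
- by move=> x; exact: normc_ge0.
- move=> x; rewrite /arch_abs; split=> [/Normc.eq0_normc/eqP|->].
    by rewrite fmorph_eq0 => /eqP.
  by rewrite rmorph0 Normc.normc0.
- by move=> x y; rewrite /arch_abs rmorphM Normc.normcM.
- by move=> x y; rewrite /arch_abs rmorphD; exact: normc_triangle.
Qed.

Lemma emb_rat sigma (q : rat) : sigma q%:A = (ratr q : R)%:C%C.
Proof.
rewrite rmorph_alg_rat; apply/esym.
exact: (fmorph_eq_rat (real_complex R \o (ratr : {rmorphism rat -> R}))).
Qed.

Lemma arch_abs_rat sigma (q : rat) : arch_abs sigma q%:A = `|ratr q : R|.
Proof. by rewrite /arch_abs emb_rat /= expr0n addr0 sqrtr_sqr. Qed.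

Lemma exists_rat_near (r e : R) : 0 < e -> exists q : rat, `|r - ratr q| < e.
Proof.
move=> e_gt0; have lt_re : r - e < r + e by lra.
have [q] := rat_in_itvoo lt_re; rewrite in_itv /= => /andP[q1 q2].
by exists q; rewrite ltr_norml; apply/andP; split; lra.
Qed.

(** The real image of [K] is approximated by rational numbers. *)
Lemma local_degree_real sigma : (forall x, complex.Im (sigma x) = 0) ->
  local_degree (arch_abs sigma) = 1%N.
Proof.
move=> real_s.
have sum1 (c : 'I_1 -> rat) : \sum_i (c i)%:A * 1 = (c ord0)%:A :> K.
  by rewrite big_ord1 mulr1.
apply: (local_degree_basis (arch_absolute_value sigma) (b := fun=> 1) ltr01).
- move=> x e e_gt0; have [q qP] := exists_rat_near (complex.Re (sigma x)) e_gt0.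
  exists (fun=> q); rewrite sum1 /arch_abs rmorphB emb_rat.
  have := real_s x; case: (sigma x) qP => a b /= qP ->.
  by rewrite subr0 expr0n addr0 sqrtr_sqr.
- by move=> c i; rewrite sum1 mul1r (ord1 i).
Qed.

(** For [sigma y = a +i* b] with [b] nonzero, the imaginary part of
    [sigma (p + q y)] controls [q], and then the real part controls [p]. *)
Lemma local_degree_complex sigma y : complex.Im (sigma y) != 0 ->
  local_degree (arch_abs sigma) = 2%N.
Proof.
case sE : (sigma y) => [a b] /= b_n0.
pose B i := if i == ord0 :> 'I_2 then 1 else y.
have sum2 (c : 'I_2 -> rat) :
    \sum_i (c i)%:A * B i = (c ord0)%:A + (c ord_max)%:A * y :> K.
  by rewrite big_ord_recl big_ord1 /B /= mulr1; congr (_ + (c _)%:A * _); apply/val_inj.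
have sigmaE (p q : rat) : sigma (p%:A + q%:A * y) =
    ((ratr p + ratr q * a) +i* (ratr q * b))%C.
  rewrite rmorphD rmorphM !emb_rat sE; congr (_ +i* _)%C => /=; ring.
pose C : R := 1 + `|a| / `|b| + `|b|^-1.
have b_gt0 : 0 < `|b| by rewrite normr_gt0.
have C_gt0 : 0 < C.
  by rewrite /C -addrA ltr_wpDr ?ltr01 // addr_ge0 ?invr_ge0 // divr_ge0.
apply: (local_degree_basis (arch_absolute_value sigma) (b := B) C_gt0).
- move=> x e e_gt0; case xE : (sigma x) => [X Y].
  have eb_gt0 : 0 < e / 2 / `|b| by rewrite !divr_gt0.
  have [q1 q1P] := exists_rat_near (Y / b) eb_gt0.
  have [q0 q0P] := exists_rat_near (X - ratr q1 * a) (divr_gt0 e_gt0 (ltr0Sn R 1)).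
  exists (fun i => if i == ord0 then q0 else q1); rewrite sum2 /= /arch_abs rmorphB.
  rewrite sigmaE xE [e]splitr; apply: le_lt_trans (normc_le_ReIm _) _; apply: ltrD => /=.
    by rewrite opprD addrA addrAC.
  rewrite ltr_pdivlMr // -normrM in q1P.
  by rewrite mulrBl divfK // in q1P.
- move=> c i; rewrite sum2; set S := _ + _.
  have [Re_le Im_le] := (normc_ge_absRe (sigma S), normc_ge_absIm (sigma S)).
  rewrite -/(arch_abs sigma S) in Re_le Im_le.
  have V_ge0 : 0 <= arch_abs sigma S by exact: normc_ge0.
  move: Re_le Im_le; rewrite {1 3}/S !sigmaE /=; set V := arch_abs sigma S in V_ge0 *.
  move: (ratr (c ord0)) (ratr (c ord_max)) (arch_abs_rat sigma (c ord0))
    (arch_abs_rat sigma (c ord_max)) => p q pE qE Re_le Im_le.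
  have q_le : `|q| <= V / `|b| by rewrite ler_pdivlMr // -normrM.
  have p_le : `|p| <= V + V / `|b| * `|a|.
    rewrite -[p](addrK (q * a)); apply: le_trans (ler_normB _ _) _.
    by rewrite normrM lerD // ler_wpM2r.
  have VC : C * V = V + V / `|b| * `|a| + V / `|b|.
    by rewrite /C; ring.
  have Vb_ge0 : 0 <= V / `|b| by rewrite divr_ge0.
  rewrite VC; have [->|/eqP i_n0] := eqVneq i ord0.
    by rewrite pE (le_trans p_le) // lerDl.
  have -> : i = ord_max by apply/val_inj; case: i i_n0 => [[|[|k]] lt_k] // [];
    apply/val_inj.
  by rewrite qE (le_trans q_le) // lerDr addr_ge0 // mulr_ge0.
Qed.

(** The real part of [sigma x] is determined by the absolute values of [x] and
    of [x + 1]. *)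
Lemma arch_abs_eq sigma tau x : arch_abs sigma = arch_abs tau ->
  tau x = sigma x \/ tau x = ((sigma x)^*)%C.
Proof.
move=> st.
have sq y : complex.Re (sigma y) ^+ 2 + complex.Im (sigma y) ^+ 2 =
    complex.Re (tau y) ^+ 2 + complex.Im (tau y) ^+ 2.
  by rewrite -!normc_sqr -/(arch_abs sigma y) st.
move: (sq x) (sq (x + 1)); rewrite !rmorphD !rmorph1.
case: (sigma x) (tau x) => [a b] [c d] /=; rewrite !addr0 => e1 e2.
have ac : a = c by lra.
have : b ^+ 2 = d ^+ 2 by apply: (addrI (a ^+ 2)); rewrite e1 ac.
move=> /eqP; rewrite eqf_sqr ac => /orP[] /eqP->; first by left.
by right; rewrite opprK.
Qed.

(** The embeddings with the same absolute value as [emb k] are [emb k] and its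
    conjugate, which differ exactly when [emb k] is not real. *)
Lemma local_degree_arch (E : embeddings R K) (k : 'I_(degree E)) :
  local_degree (arch_abs (emb k)) =
  #|[set l : 'I_(degree E) | `[< arch_abs (emb l) = arch_abs (emb k) >]]%SET|.
Proof.
have [kbar kbarE] := emb_complete E (conjc \o emb k).
have kbar_abs : arch_abs (emb kbar) = arch_abs (emb k).
  apply/funext => x; rewrite /arch_abs -kbarE /=.
  by case: (emb k x) => a b /=; rewrite sqrrN.
have -> : [set l : 'I_(degree E) | `[< arch_abs (emb l) = arch_abs (emb k) >]]%SET =
    [set k; kbar]%SET.
  apply/setP => l; rewrite !inE; apply/asboolP/orP => [lk|[] /eqP-> //].
  case: (arch_abs_eq (gene E) (esym lk)) => /= lE.
    by left; apply/eqP/emb_gene_inj.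
  by right; apply/eqP/emb_gene_inj; rewrite -kbarE.
rewrite cards2; have [real_k|/existsNP[y /eqP Imy]] :=
  pselect (forall x, complex.Im (emb k x) = 0).
  rewrite local_degree_real //.
  suff -> : k == kbar by [].
  apply/eqP/emb_gene_inj; rewrite -kbarE /=.
  by have := real_k (gene E); case: (emb k _) => a b /= ->; rewrite oppr0.
rewrite (local_degree_complex Imy).
suff -> : k != kbar by [].
apply: contraNneq Imy => kE; have := kbarE y; rewrite -kE /=.
case: (emb k y) => a b /= [] /eqP; rewrite eq_sym -addr_eq0 -mulr2n.
by rewrite mulrn_eq0.
Qed.

End ArchAbs.

(** * The height *)

(** By induction on [s]: each new element of [s] adds one to a single exponent. *)
Lemma prod_exp_count (R : comPzRingType) (T : eqType) (L s : seq T) (F : T -> R) :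
  uniq L -> {subset s <= L} ->
  \prod_(i <- L) F i ^+ count_mem i s = \prod_(i <- s) F i.
Proof.
move=> uL; elim: s => [|j s IHs] sL.
  by rewrite big_nil big1 // => i _; rewrite expr0.
have jL : j \in L by apply: sL; rewrite mem_head.
have {}sL : {subset s <= L} by move=> i si; apply: sL; rewrite inE si orbT.
rewrite big_cons -IHs // (bigD1_seq j) //= eqxx exprS -mulrA; congr (_ * _).
rewrite [RHS](bigD1_seq j) //=; congr (_ * _); apply: eq_bigr => i /negPf ne_ij.
by rewrite eq_sym ne_ij.
Qed.

Lemma max_exp (R : realDomainType) (a : R) n : 0 <= a ->
  Num.max (a ^+ n) 1 = Num.max a 1 ^+ n.
Proof.
move=> a_ge0; have [le1|/ltW ge1] := leP a 1.
  by rewrite expr1n max_r // exprn_ile1.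
by rewrite max_l // exprn_ege1.
Qed.

Section Height.
Variables (R : realType) (K : fieldExtType rat) (E : embeddings R K).
Local Notation OK := (@ring_of_integers K).
Implicit Types (x y : K) (r s : seq (set K)) (P Q : set K).

Definition arch_height x : R := \prod_(k < degree E) Num.max (arch_abs (emb k) x) 1.

(** The contribution of the primes to the height of a generator of the quotient
    of the product of the primes of [r] by that of the primes of [s]. *)
Definition finite_height r s : R :=
  \prod_(P <- undup (r ++ s))
    Num.max ((ideal_norm P)%:R ^ ((count_mem P s)%:Z - (count_mem P r)%:Z)) 1.

(** The two kinds of places are told apart by the absolute value of [2]. *)
Lemma padic_place_neq_arch P sigma : prime_ideal P ->
  padic_abs R P <> arch_abs sigma.
Proof.
move=> pP /(congr1 (fun v => v 2%:R)).
have -> : arch_abs sigma 2%:R = 2%:R.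
  by rewrite -[2%:R]mulr1 mulr_natl -scaler_nat arch_abs_rat ratr_nat normr_nat.
have : padic_abs R P 2%:R <= 1.
  have := padic_abs_val_ge R pP (val_ge_integer pP (integer_nat K 2)).
  by rewrite /prime_pow oppr0 mul0r powRr0.
by move=> le1 e2; rewrite e2 in le1; have := ltr1n R 2; rewrite ltNge le1.
Qed.

Lemma padic_abs_mem P x : prime_ideal P -> OK x -> x != 0 ->
  (padic_abs R P x < 1) <-> P x.
Proof.
move=> pP Ox x_n0; split=> [lt1|Px].
  apply: contrapT => nPx; move: lt1.
  by rewrite padic_absE // valuation_unit // /prime_pow oppr0 mul0r powRr0 ltxx.
have : val_ge P 1 x.
  by apply: val_ge_mem => //=; rewrite ideal_mulr1 //; exact: prime_omodule.
move/(padic_abs_val_ge R pP)/le_lt_trans; apply.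
rewrite ltNge; apply/negP => /(exprn_ege1 (local_degree (padic_abs R P))).
rewrite (prime_pow_exp _ pP _ (local_degree_padic R pP)) leNgt => /negP[].
by rewrite invf_lt1 ?ltr1n ?ltr0n ?norm_prime_gt1 // ltnW // norm_prime_gt1.
Qed.

(** Since a place is the function that it defines, distinct primes must be shown
    to give distinct functions: the prime is recovered as the set of integers of
    absolute value less than [1]. *)
Lemma padic_abs_inj P Q : prime_ideal P -> prime_ideal Q ->
  padic_abs R P = padic_abs R Q -> P = Q.
Proof.
move=> pP pQ ePQ; apply: (prime_eq pQ pP) => x Px.
have [->|x_n0] := eqVneq x 0; first by have [[]] := prime_omodule pQ.
have [sP _ _ _] := prime_is_ideal pP.
by apply/(padic_abs_mem pQ (sP _ Px) x_n0); rewrite -ePQ; apply/padic_abs_mem => //; exact: sP.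
Qed.

Lemma place_ge0 (v : K -> R) x : @places R K v -> 0 <= v x.
Proof.
move=> [[sigma ->]|[P pP ->]]; first exact: (abs_ge0 (arch_absolute_value sigma)).
exact: (abs_ge0 (padic_absolute_value R pP)).
Qed.

Lemma height0 : height R (0 : K) = 1.
Proof.
rewrite /height fsbig1 // => v pv; apply/max_idPr/exprn_ile1; first exact: place_ge0.
move: pv => [[sigma ->]|[P pP ->]]; last by rewrite padic_abs0 ler01.
by rewrite (abs0 (arch_absolute_value sigma)) ler01.
Qed.

Local Notation arch_seq := [seq arch_abs (emb k) | k <- enum 'I_(degree E)].

(** The local degree of an archimedean place is the number of embeddings which
    define it. *)
Lemma arch_product x :
  \prod_(v <- undup arch_seq) Num.max (v x ^+ local_degree v) 1 = arch_height x.
Proof.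
have -> : arch_height x = \prod_(v <- arch_seq) Num.max (v x) 1.
  by rewrite big_map big_enum.
have sub : {subset arch_seq <= undup arch_seq} by move=> v; rewrite mem_undup.
rewrite -(prod_exp_count _ (undup_uniq _) sub).
rewrite !big_seq; apply: eq_bigr => v; rewrite mem_undup => /mapP[k _ ->].
rewrite max_exp; last exact: (abs_ge0 (arch_absolute_value _)).
congr (_ ^+ _); rewrite local_degree_arch count_map -sum1_count.
rewrite -sum1_card big_enum_cond /=; apply: eq_bigl => l; rewrite !inE.
by apply/asboolP/eqP.
Qed.

Lemma padic_factor P x r s : prime_ideal P -> x != 0 ->
    all_prime r -> all_prime s ->
    ideal_mul (principal_ideal x) (ideal_prod s) = ideal_prod r ->
  padic_abs R P x ^+ local_degree (padic_abs R P) =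
  (ideal_norm P)%:R ^ ((count_mem P s)%:Z - (count_mem P r)%:Z).
Proof.
move=> pP x_n0 pr ps xE; rewrite padic_absE // (valuation_lists pP x_n0 pr ps xE).
by rewrite (prime_pow_exp _ pP _ (local_degree_padic R pP)) opprB.
Qed.

(** Only the archimedean places and the primes of [r] and [s] contribute. *)
Theorem height_formula x r s : x != 0 -> all_prime r -> all_prime s ->
    ideal_mul (principal_ideal x) (ideal_prod s) = ideal_prod r ->
  height R x = arch_height x * finite_height r s.
Proof.
move=> x_n0 pr ps xE; pose S := undup (r ++ s).
have prS P : P \in S -> prime_ideal P.
  by rewrite mem_undup mem_cat => /orP[/pr|/ps].
pose L := undup arch_seq ++ [seq padic_abs R P | P <- S].
have uL : uniq L.
  rewrite cat_uniq undup_uniq map_inj_in_uniq ?undup_uniq ?andbT /=; last first.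
    by move=> P Q /prS pP /prS pQ; apply: padic_abs_inj.
  apply/hasPn => v /mapP[P /prS pP ->]; rewrite mem_undup; apply/negP => /mapP[k _].
  exact: padic_place_neq_arch.
have sL : [set` L] `<=` @places R K.
  move=> v /=; rewrite mem_cat mem_undup => /orP[] /mapP[].
    by move=> k _ ->; left; exists (emb k).
  by move=> P /prS pP ->; right; exists P.
have L1 v : @places R K v -> v \notin L -> Num.max (v x ^+ local_degree v) 1 = 1.
  move=> [[sigma ->]|[P pP ->]]; rewrite mem_cat negb_or => /andP[].
    move=> /negP[]; rewrite mem_undup; have [k kE] := emb_complete E sigma.
    apply/mapP; exists k; first by rewrite mem_enum.
    by apply/funext => y; rewrite /arch_abs kE.
  move=> _ PS; rewrite (padic_factor pP x_n0 pr ps xE).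
  have : P \notin S by apply: contra PS => PS; apply/mapP; exists P.
  rewrite mem_undup mem_cat negb_or => /andP[/count_memPn-> /count_memPn->].
  by rewrite subrr expr0z maxxx.
rewrite /height (fsbigE _ _ uL sL L1) big_seq_cond.
rewrite (eq_bigl (fun v => v \in L)); last first.
  by move=> v; apply: andb_idr => /sL/mem_set.
rewrite -big_seq big_cat /= arch_product big_map; congr (_ * _).
rewrite /finite_height -/S [LHS]big_seq [RHS]big_seq; apply: eq_bigr => P /prS pP.
by rewrite (padic_factor pP x_n0 pr ps xE).
Qed.

End Height.

(** * Bounds on the height *)

Lemma finite_set_seq (T : eqType) (A : set T) : finite_set A ->
  exists2 L : seq T, uniq L & forall t, t \in L <-> A t.
Proof.
move=> /finite_seqP[L LE]; exists (undup L); first exact: undup_uniq.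
by move=> t; rewrite mem_undup LE.
Qed.

Lemma finite_image_fintype (T : finType) (U : Type) (g : T -> U) (A : set U) :
  A `<=` range g -> finite_set A.
Proof.
by move=> sA; apply: sub_finite_set sA _; apply: finite_image; exact: finite_finset.
Qed.

Section Bounds.
Variables (R : realType) (K : fieldExtType rat) (E : embeddings R K).
Local Notation OK := (@ring_of_integers K).
Implicit Types (x y u : K) (a b : set K) (r s : seq (set K)).

Definition arch_norm x : R := \prod_(k < degree E) arch_abs (emb k) x.

Lemma arch_normM x y : arch_norm (x * y) = arch_norm x * arch_norm y.
Proof.
rewrite /arch_norm -big_split; apply: eq_bigr => k _ /=.
exact: (absM (arch_absolute_value _)).
Qed.

Lemma arch_norm_gt0 x : x != 0 -> 0 < arch_norm x.
Proof.
move=> x_n0; apply: prodr_gt0 => k _.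
exact: (abs_gt0 (arch_absolute_value _)).
Qed.

Lemma norm_principal y : OK y -> y != 0 ->
  (ideal_norm (principal_ideal y))%:R = arch_norm y :> R.
Proof.
move=> Oy y_n0; have [N [/(ideal_normE (omodule_principal y)) -> NE]] :=
  index_principal_ideal E Oy y_n0.
have : (N%:R)%:C%C = (arch_norm y)%:C%C.
  rewrite rmorph_nat NE /emb_norm /arch_norm normr_prod rmorph_prod.
  by apply: eq_bigr => k _; rewrite normc_norm.
by case.
Qed.

Lemma norm_mul a b : nonzero_ideal a -> nonzero_ideal b ->
  ideal_norm (ideal_mul a b) = (ideal_norm a * ideal_norm b)%N.
Proof.
move=> /ideal_factorization[r pr ->] /ideal_factorization[s ps ->].
rewrite -ideal_prod_cat !norm_prod ?big_cat //; exact: all_prime_cat.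
Qed.

Lemma nonzero_principal y : OK y -> y != 0 -> nonzero_ideal (principal_ideal y).
Proof.
move=> Oy y_n0; split; first exact: principal_ideal_ideal.
by exists y => //; exact: mem_principal.
Qed.

(** This is the product formula. It is reduced to integers [y], for which the index
    of [y O] is [arch_norm y], by multiplying with a denominator [d] of [x]. *)
Lemma norm_fraction x a b : x != 0 -> nonzero_ideal a -> nonzero_ideal b ->
  ideal_mul (principal_ideal x) b = a ->
  arch_norm x * (ideal_norm b)%:R = (ideal_norm a)%:R.
Proof.
move=> x_n0 nza nzb xE; have [d d_n0 Odx] := integer_denominator x.
have dK_n0 : d%:~R != 0 :> K by rewrite intK_eq0.
have Od := integer_int K d.
have dx_n0 : d%:~R * x != 0 by rewrite mulf_neq0.
have dn := arch_norm_gt0 dK_n0.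
apply: (mulfI (lt0r_neq0 dn)); rewrite mulrA -arch_normM.
rewrite -!norm_principal // -!natrM -!norm_mul //; try exact: nonzero_principal.
by rewrite -principalM -ideal_mulA xE.
Qed.

Lemma prod_max1_ge1 (I : Type) (s : seq I) (Q : pred I) (F : I -> R) :
  1 <= \prod_(i <- s | Q i) Num.max (F i) 1.
Proof.
apply: (big_ind (fun z => 1 <= z)) => // [z w|i _]; first exact: mulr_ege1.
by rewrite le_max lexx orbT.
Qed.

Lemma arch_height_ge1 x : 1 <= arch_height E x.
Proof. exact: prod_max1_ge1. Qed.

Lemma arch_height_ge (k : 'I_(degree E)) x : arch_abs (emb k) x <= arch_height E x.
Proof.
rewrite /arch_height (bigD1 k) //=.
apply: (@le_trans _ _ (Num.max (arch_abs (emb k) x) 1)).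
  by rewrite le_max lexx.
rewrite ler_peMr //; first by rewrite le_max ler01 orbT.
exact: prod_max1_ge1.
Qed.

Lemma arch_norm_le x : arch_norm x <= arch_height E x.
Proof.
apply: ler_prod => k _; rewrite (abs_ge0 (arch_absolute_value _)) /=.
by rewrite le_max lexx.
Qed.

Lemma arch_heightM x y : arch_height E (x * y) <= arch_height E x * arch_height E y.
Proof.
rewrite /arch_height -big_split; apply: ler_prod => k _ /=.
rewrite le_max ler01 orbT /= (absM (arch_absolute_value _)).
have x0 := abs_ge0 (arch_absolute_value (emb k)) x.
have y0 := abs_ge0 (arch_absolute_value (emb k)) y.
rewrite ge_max ler_pM // ?le_max ?lexx //=.
by rewrite mulr_ege1 // le_max lexx orbT.
Qed.

(** At each place, [max |1 / x| 1] times [|x|] is [max 1 |x|]. *)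
Lemma arch_heightV x : x != 0 -> arch_height E x^-1 * arch_norm x = arch_height E x.
Proof.
move=> x_n0; rewrite /arch_height /arch_norm -big_split; apply: eq_bigr => k _ /=.
have v_gt0 := abs_gt0 (arch_absolute_value (emb k)) x_n0.
rewrite (absV (arch_absolute_value _)) maxr_pMl ?ltW // mulVf ?gt_eqF // mul1r.
exact: maxC.
Qed.

Lemma finite_height_ge1 r s : 1 <= finite_height R r s.
Proof. exact: prod_max1_ge1. Qed.

(** A prime of [s] is not in [r], so that its exponent is not reduced. *)
Lemma finite_height_ge r s : all_prime r -> all_prime s ->
    (forall P, P \in s -> P \notin r) ->
  (ideal_norm (ideal_prod s))%:R <= finite_height R r s.
Proof.
move=> pr ps disj; rewrite norm_prod // natr_prod.
have sub : {subset s <= undup (r ++ s)}.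
  by move=> P Ps; rewrite mem_undup mem_cat Ps orbT.
rewrite -(prod_exp_count _ (undup_uniq _) sub).
apply: ler_prod => P _; rewrite exprn_ge0 //= le_max.
have [/disj/count_memPn -> | /count_memPn->] := boolP (P \in s).
  by rewrite subr0 lexx.
by rewrite expr0 lexx orbT.
Qed.

(** ** Finiteness *)

(** The coordinates of [d x] on the lattice are integers, and they are bounded
    because they are obtained from the conjugates of [d x] by the fixed matrix
    [invmx (emb_mx E)]. *)
Lemma finite_bounded_integers (C : R) :
  finite_set [set x | OK x /\ forall k : 'I_(degree E), arch_abs (emb k) x <= C].
Proof.
have [d d_n0 dP] := integer_coordinates_bounded E.
have dK_n0 : d%:~R != 0 :> K by rewrite intK_eq0.
pose W := invmx (emb_mx E).
have W_unit : emb_mx E \in unitmx by rewrite unitmxE unitfE det_emb_mx.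
pose M : R := \sum_j \sum_k `|d|%:~R * `|C| * Normc.normc (W k j).
have M_ge0 : 0 <= M.
  by do 2![apply: sumr_ge0 => ? _]; rewrite !mulr_ge0 ?normc_ge0 // ler0z.
pose m := Num.bound M.
have c_lt (c : 'rV[int]_(degree E)) x j : OK x ->
    (forall k : 'I_(degree E), arch_abs (emb k) x <= C) ->
    d%:~R * x = lattice_map c -> `|c 0 j| < m%:Z.
  move=> Ox xC xE.
  have cE : (c 0 j)%:~R = \sum_k emb k (d%:~R * x) * W k j :> R[i].
    transitivity ((map_mx intr c *m emb_mx E *m W) 0 j).
      by rewrite mulmxK // mxE.
    by rewrite mxE; apply: eq_bigr => k _; rewrite xE emb_lattice_map.
  have cM : `|c 0 j|%:~R <= M.
    rewrite -lecR.
    have -> : (`|c 0 j|%:~R)%:C%C = `|(c 0 j)%:~R| :> R[i].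
      by rewrite rmorph_int intr_norm.
    rewrite cE; apply: le_trans (ler_norm_sum _ _ _) _.
    apply: (@le_trans _ _ (\sum_k `|d|%:~R * `|C| * Normc.normc (W k j))%:C%C).
      rewrite rmorph_sum; apply: ler_sum => k _ /=.
      rewrite normc_norm lecR Normc.normcM; apply: ler_wpM2r; first exact: normc_ge0.
      rewrite -/(arch_abs (emb k) (d%:~R * x)) (absM (arch_absolute_value _)).
      rewrite -alg_int arch_abs_rat ratr_int intr_norm ler_wpM2l ?ler0z //.
      exact: le_trans (xC k) (ler_norm C).
    rewrite lecR /M [leRHS](bigD1 j) //= lerDl.
    by do 2![apply: sumr_ge0 => ? _]; rewrite !mulr_ge0 ?normc_ge0 // ler0z.
  rewrite -(ltr_int R); apply: le_lt_trans cM _.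
  exact: archi_boundP.
pose g (t : {ffun 'I_(degree E) -> 'I_(m + m)}) : K :=
  (d%:~R)^-1 * lattice_map (E := E) (\row_j ((t j)%:Z - m%:Z)).
apply: (finite_image_fintype (g := g)) => x [Ox xC].
have [c cE] := dP _ Ox.
have lt j : (`|(c 0 j + m%:Z)%R| < m + m)%N.
  have := c_lt c x j Ox xC cE; lia.
exists [ffun j => Ordinal (lt j)] => //; rewrite /g.
have -> : \row_j (([ffun j => Ordinal (lt j)] j)%:Z - m%:Z) = c.
  apply/rowP => j; rewrite mxE ffunE /=.
  have := c_lt c x j Ox xC cE; lia.
by rewrite -[lattice_map c]cE mulKf.
Qed.

(** An ideal of norm at most [B] contains its norm, which divides [B`!]; so it is
    a union of classes modulo [B`!]. *)
Lemma finite_bounded_ideals (B : nat) : finite_set (@bounded_ideals K B).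
Proof.
pose m : K := (B`!)%:R.
have m_n0 : m != 0 by rewrite natK_eq0 -lt0n fact_gt0.
have Om : OK m := integer_nat K _.
have [N [T [t_ [_ Ot _ t_cov]]]] := principal_index Om m_n0.
pose g (A : {set T}) : set K := [set x | OK x /\ exists2 t, t \in A & principal_ideal m (x - t_ t)].
apply: (finite_image_fintype (g := g)) => c [nzc normc].
have [gc cM] := omodule_ideal nzc.1; have [sc _ _ _] := nzc.1.
have cm : principal_ideal m `<=` c.
  move=> _ [y Oy <-]; rewrite mulrC; apply: (cM y m Oy).
  have Nc := ideal_index_norm nzc.
  have N_gt0 := has_index_gt0 (integer0 K) Nc.
  have : (ideal_norm c %| B`!)%N by apply: dvdn_fact; rewrite N_gt0.
  case/dvdnP=> q qE; rewrite /m qE natrM; apply: cM; first exact: integer_nat.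
  exact: has_index_exponent (integer_group K) gc sc Nc (integer1 K).
exists [set t | `[< c (t_ t) >]]%SET => //; apply/seteqP; split=> x.
  move=> [Ox [t]]; rewrite inE => /asboolP ct /cm cxt.
  by rewrite -(subrK (t_ t) x); apply: subgroupD.
move=> cx; have Ox := sc _ cx; split=> //; have [t tm] := t_cov _ Ox.
exists t => //; rewrite inE; apply/asboolP; rewrite -[t_ t](subKr x).
by apply: gc.2 => //; exact: cm.
Qed.

End Bounds.

(** * Correctness of the algorithm *)

Lemma seq_max (R : realDomainType) (T : eqType) (F : T -> R) (G : seq T) x0 : x0 \in G ->
  exists2 xi, xi \in G & forall y, y \in G -> F y <= F xi.
Proof.
elim: G x0 => // z G IHG x0 _.
case: G IHG => [_|w G IHG].
  by exists z; rewrite ?mem_head // => y; rewrite inE => /eqP->.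
have [xi xiG xi_max] := IHG w (mem_head _ _).
have [le|/ltW le] := leP (F z) (F xi).
  exists xi; first by rewrite inE xiG orbT.
  by move=> y; rewrite inE => /predU1P[->|/xi_max].
exists z; first exact: mem_head.
by move=> y; rewrite inE => /predU1P[->//|/xi_max/le_trans]; apply.
Qed.

Section Correctness.
Variables (R : realType) (K : fieldExtType rat).
Local Notation OK := (@ring_of_integers K).
Implicit Types (x y u : K) (a b : set K) (r s : seq (set K)).

(** Take for [b] the ideal of all denominators of [x], and [a = x b]. If an ideal
    [c] divides both, then [b / c] consists of denominators of [x] too, so it is
    contained in [b], which forces [c] to be the whole ring. *)
Lemma coprime_fraction x : x != 0 -> exists a b,
  [/\ nonzero_ideal a, nonzero_ideal b, ideal_is_gcd a b OK
    & ideal_mul (principal_ideal x) b = a].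
Proof.
move=> x_n0; pose b := [set t | OK t /\ OK (t * x)].
have ob : omodule b.
  split; first split.
  - by split; rewrite ?mul0r; exact: integer0.
  - move=> t t' [Ot Otx] [Ot' Otx']; split; first exact: integerB.
    by rewrite mulrBl; apply: integerB.
  - move=> q t Oq [Ot Otx]; split; first exact: integerM.
    by rewrite -mulrA; apply: integerM.
have idb : is_ideal b by apply: ideal_omodule => // t [].
have nzb : nonzero_ideal b.
  split=> //; have [d d_n0 Odx] := integer_denominator x.
  by exists d%:~R; [split=> //; exact: integer_int|rewrite intK_eq0].
pose a := ideal_mul (principal_ideal x) b.
have oa : omodule a by apply/omodule_mul/omodule_principal.
have ida : is_ideal a.
  apply: ideal_omodule => //; rewrite /a principal_mul // => _ [t [_ Otx] <-].
  by rewrite mulrC.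
have nza : nonzero_ideal a.
  split=> //; apply/invertible_nonzero/invertible_mul.
    exact: invertible_principal.
  exact: invertible_ideal.
exists a, b; split=> //; split.
- exact: is_ideal_integers.
- by exists a => //; rewrite ideal_mul1.
- by exists b => //; rewrite ideal_mul1.
move=> c idc [a' ida' aE] [b' idb' bE].
have [oc oa' ob'] := And3 (omodule_ideal idc) (omodule_ideal ida') (omodule_ideal idb').
have nzc : nonzero_ideal c.
  apply: nonzero_sub nzb idc _; rewrite bE -[X in _ `<=` X](ideal_mulr1 oc).
  by apply: ideal_mulS => //; have [] := idb'.
have ic := invertible_ideal nzc; have iX := invertible_principal x_n0.
have xb' : ideal_mul (principal_ideal x) b' = a'.
  apply: (ideal_mul_cancel ic) => //; first exact: omodule_mul (omodule_principal x).
  by rewrite ideal_mulCA -bE -aE.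
have sb'b : b' `<=` b.
  move=> t b't; split; first by have [sb' _ _ _] := idb'; exact: sb'.
  have [sa' _ _ _] := ida'; apply: sa'; rewrite -xb' mulrC.
  by apply: mem_ideal_mul => //; exact: mem_principal.
have sbb' : b `<=` b'.
  rewrite bE -[X in _ `<=` X](ideal_mul1 ob'); apply: ideal_mulS => //.
  by have [] := idc.
have cE : c = OK.
  apply: (ideal_mul_cancel (invertible_ideal nzb)) => //; first exact: omodule_integers.
  rewrite ideal_mulr1 // ideal_mulC {2}bE; congr (ideal_mul c _).
  by apply/seteqP.
by rewrite cE; exists OK; [exact: is_ideal_integers|rewrite ideal_mul1 //; exact: omodule_integers].
Qed.

Lemma gcd_disjoint r s P : all_prime r -> all_prime s ->
  ideal_is_gcd (ideal_prod r) (ideal_prod s) OK -> P \in s -> P \notin r.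
Proof.
move=> pr ps [_ _ _ gcd] Ps; apply/negP => Pr.
have pP := ps _ Ps; have idP := prime_is_ideal pP.
have dvd l : all_prime l -> P \in l -> ideal_dvd P (ideal_prod l).
  move=> pl Pl; exists (ideal_prod (rem P l)); last exact: ideal_prod_rem.
  by apply: is_ideal_prod; exact: all_prime_rem.
have := gcd P idP (dvd r pr Pr) (dvd s ps Ps).
move=> /(dvd_sub (omodule_ideal idP))/(_ _ (integer1 K)).
by case: pP.
Qed.

(** A unit has valuation zero at every prime. *)
Lemma unit_height (E : embeddings R K) u : integer_unit u -> height R u = arch_height E u.
Proof.
move=> [u_n0 Ou OV]; rewrite (height_formula E (r := [::]) (s := [::]) u_n0) //.
  by rewrite /finite_height big_nil mulr1.
rewrite /= ideal_mulr1; last exact: omodule_principal.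
apply: ideal1; first exact: principal_ideal_ideal.
by exists u^-1; rewrite ?divff.
Qed.

Lemma finite_bounded_units (C : R) :
  finite_set [set u : K | integer_unit u /\ height R u <= C].
Proof.
have [E] := embeddings_exist R K.
apply: sub_finite_set (finite_bounded_integers E C) => u [uu]; rewrite (unit_height E) // => uC.
have [_ Ou _] := uu; split=> // k.
exact: le_trans (arch_height_ge k u) uC.
Qed.

Lemma algorithm_terminates (B : nat) (gen : set K -> set K -> K) : (0 < B)%N ->
  exists S : seq K, algorithm_outputs R B gen S.
Proof.
move=> B_gt0; have [L uL LP] := finite_set_seq (finite_bounded_ideals K B).
pose G := [seq gen ab.1 ab.2 | ab <- [seq (a, b) | a <- L, b <- L]
                           & `[< admissible_pair ab >]].
have LO : OK \in L.
  by apply/LP; split; [exact: nonzero_ideal_integers|rewrite norm_integers].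
have oO := omodule_integers K.
have GO : gen OK OK \in G.
  apply/mapP; exists (OK, OK) => //; rewrite mem_filter; apply/andP; split.
    apply/asboolP; split=> /=.
      exists 1; rewrite /ideal_quotient ideal_inv1 ideal_mul1 // principal1 //.
    have dvdO : ideal_dvd OK OK.
      by exists OK; [exact: is_ideal_integers|rewrite ideal_mul1].
    by split=> //; exact: is_ideal_integers.
  by apply/allpairsP; exists (OK, OK).
have [xi xiG xi_max] := seq_max (@height R K) GO.
have [U _ UP] := finite_set_seq (finite_bounded_units (B%:R * height R xi)).
eexists; exists L, G, (height R xi), U; split=> //; first by exists xi.
Qed.

(** With [F] the finite part of the heights of [x] and [xi], the height of the unit
    [x / xi] is bounded by the archimedean height of [x] times that of [xi^-1];
    the latter is that of [xi] divided by [arch_norm xi], and the product formula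
    shows that [1 <= arch_norm xi * F]. *)
Lemma bounded_height_mem (B : nat) (gen : set K -> set K -> K)
    (L : seq (set K)) (G : seq K) (B0 : R) (U S : seq K) x :
    finds_generators B gen -> algorithm_run B gen L G B0 U S ->
  x != 0 -> height R x <= B%:R -> x \in S.
Proof.
move=> genP [uL LP GE [xi0 xi0G B0E] B0_max UP SE] x_n0 xB.
have [E] := embeddings_exist R K.
have [a [b [nza nzb gcd xE]]] := coprime_fraction x_n0.
have [r pr rE] := ideal_factorization nza.
have [s ps sE] := ideal_factorization nzb.
have xrs : ideal_mul (principal_ideal x) (ideal_prod s) = ideal_prod r.
  by rewrite -rE -sE.
have hx := height_formula E x_n0 pr ps xrs.
have F_ge1 := finite_height_ge1 R r s; set F := finite_height R r s in hx F_ge1.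
have bF : (ideal_norm b)%:R <= F.
  rewrite sE; apply: finite_height_ge => // P; apply: gcd_disjoint => //.
  by rewrite -rE -sE.
have A_ge1 := arch_height_ge1 E x.
have nx := norm_fraction E x_n0 nza nzb xE.
have bB : (ideal_norm b <= B)%N.
  rewrite -(ler_nat R); apply: le_trans xB; rewrite hx.
  by apply: le_trans bF _; rewrite ler_peMl // (le_trans ler01).
have aB : (ideal_norm a <= B)%N.
  rewrite -(ler_nat R) -nx; apply: le_trans xB; rewrite hx.
  by apply: ler_pM => //; [exact/ltW/arch_norm_gt0|exact: arch_norm_le].
have [aL bL] : a \in L /\ b \in L by split; apply/LP.
have ib := invertible_ideal nzb.
have abx : ideal_quotient a b = principal_ideal x.
  rewrite /ideal_quotient -xE -ideal_mulA ib.2 ideal_mulr1 //.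
  exact: omodule_principal.
have adm : admissible_pair (a, b) by split=> //; exists x.
have xiE : principal_ideal x = principal_ideal (gen a b).
  by rewrite -genP // LP.
set xi := gen a b in xiE.
have xiG : xi \in G.
  rewrite GE; apply/mapP; exists (a, b) => //; rewrite mem_filter.
  by rewrite asboolT //=; apply/allpairsP; exists (a, b).
have [q Oq xq] : principal_ideal xi x by rewrite -xiE; exact: mem_principal.
have [q' Oq' xiq] : principal_ideal x xi by rewrite xiE; exact: mem_principal.
have xi_n0 : xi != 0 by apply: contraNneq x_n0 => xi_0; rewrite -xq xi_0 mul0r.
pose u := x / xi.
have u_n0 : u != 0 by rewrite mulf_neq0 ?invr_eq0.
have uu : integer_unit u.
  split=> //; first by rewrite /u -xq mulrC mulKf.
  by rewrite /u invf_div -{1}xiq mulrC mulKf.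
have hxi : height R xi = arch_height E xi * F.
  by apply: height_formula => //; rewrite -xiE.
have nxi : arch_norm E xi * (ideal_norm b)%:R = (ideal_norm a)%:R.
  by apply: norm_fraction => //; rewrite -xiE.
have uB : height R u <= B%:R * B0.
  apply: (@le_trans _ _ (height R x * height R xi)); last first.
    apply: ler_pM => //; last exact: B0_max.
      by rewrite hx mulr_ge0 // (le_trans ler01).
    by rewrite hxi mulr_ge0 ?(le_trans ler01) ?arch_height_ge1.
  rewrite (unit_height E uu) hx hxi.
  apply: le_trans (arch_heightM E x xi^-1) _.
  rewrite -mulrA; apply: ler_wpM2l; first exact: le_trans ler01 A_ge1.
  have n_gt0 := arch_norm_gt0 E xi_n0.
  rewrite -(ler_pM2r n_gt0) arch_heightV //.
  have Axi_ge1 := arch_height_ge1 E xi.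
  have a_ge1 : 1 <= (ideal_norm a)%:R :> R.
    by rewrite ler1n; exact: has_index_gt0 (integer0 K) (ideal_index_norm nza).
  have nF : 1 <= arch_norm E xi * F.
    apply: le_trans a_ge1 _; rewrite -nxi ler_pM2l //.
  rewrite (_ : _ * _ * _ = arch_height E xi * (F * (arch_norm E xi * F))); last by ring.
  rewrite ler_peMr ?(le_trans ler01) //; exact: mulr_ege1.
have uU : u \in U by apply/UP.
rewrite SE inE; apply/orP; right; apply/mapP; exists (xi, u); last by rewrite /= divfK.
by rewrite mem_filter /= divfK // xB /=; apply/allpairsP; exists (xi, u).
Qed.

End Correctness.

Theorem theorem2p3 (R : realType) (K : fieldExtType rat) (B : nat)
    (hB : (0 < B)%N) (gen : set K -> set K -> K)
    (hgen : finds_generators B gen) :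
  (exists S : seq K, algorithm_outputs R B gen S) /\
  (forall S : seq K, algorithm_outputs R B gen S ->
     forall x : K, x \in S <-> height R x <= B%:R).
Proof.
split; first exact: algorithm_terminates.
move=> S [L [G [B0 [U run]]]] x; split=> [|xB]; last first.
  have [->|x_n0] := eqVneq x 0; last exact: bounded_height_mem hgen run x_n0 xB.
  by rewrite (run_result run) mem_head.
rewrite (run_result run) inE => /predU1P[->|]; first by rewrite height0 ler1n.
by move=> /mapP[p]; rewrite mem_filter => /andP[pB _] ->.
Qed.
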